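(* There exists an absolute constant $\eta>0$ such that for every positive integer $n$, every prime $p$ with $2<p\le \exp(\eta n^{1/4})$, every $\lambda\in\mathbb{F}_p$ and every integer $0\le k\le n$, the $n\times n$ random symmetric Rademacher matrix $M_n$ satisfies $$\mathbb{P}\big[\operatorname{rank}_{\mathbb{F}_p}(M_n-\lambda I_n)=n-k\big]=\frac{\prod_{i=0}^{\infty}\big(1-p^{-(2i+1)}\big)}{\prod_{i=1}^{k}(p^i-1)}+O\big(\exp(-\eta n/\log p)\big),$$ where the implied constant in $O(\cdot)$ is absolute.
   Context: An $n\times n$ random symmetric Rademacher matrix $M_n$ is a random symmetric matrix whose entries on and above the diagonal are i.i.d. Rademacher random variables, i.e. each equals $+1$ or $-1$ with probability $1/2$ each. Its entries are reduced modulo $p$ and $M_n-\lambda I_n$ is viewed as a matrix over $\mathbb{F}_p$; $\operatorname{rank}_{\mathbb{F}_p}$ is the rank over $\mathbb{F}_p$. $\log$ is the natural logarithm. The empty product (for $k=0$) equals $1$. *)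

(* Defs.v *)
From HB Require Import structures.
From mathcomp Require Import all_boot all_order all_algebra.
From mathcomp Require Import all_classical all_reals all_analysis.
Import Order.TTheory GRing.Theory Num.Theory.
Import numFieldNormedType.Exports.

Set Implicit Arguments.
Unset Strict Implicit.
Unset Printing Implicit Defensive.

Local Open Scope classical_set_scope.
Local Open Scope ring_scope.

(* [int] carries the discrete sigma-algebra, as [nat] and [bool] do in
   MathComp-Analysis. *)
HB.instance Definition _ := isPointed.Build int 0.
HB.instance Definition _ := @isMeasurable.Build default_measure_display
  int (@discrete_measurable int) (@discrete_measurable0 int)
  (@discrete_measurableC int) (@discrete_measurableU int).

Definition mutually_independent (d d' : measure_display)
    (T : measurableType d) (U : measurableType d') (R : realType)
    (P : probability T R) (I : finType) (X : I -> T -> U) : Prop :=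
  forall (J : {set I}) (B : I -> set U),
    (forall i, i \in J -> measurable (B i)) ->
    P (\bigcap_(i in [set` J]) (X i @^-1` B i)) =
      (\prod_(i in J) P (X i @^-1` B i))%E.

Definition rademacher (d : measure_display) (T : measurableType d)
    (R : realType) (P : probability T R) (X : T -> int) : Prop :=
  [/\ measurable_fun setT X,
      P (X @^-1` [set 1]) = (2^-1)%:E &
      P (X @^-1` [set -1]) = (2^-1)%:E].

Definition upper_index (n : nat) : finType :=
  {ij : 'I_n * 'I_n | (ij.1 <= ij.2)%N}.

Definition upper_entry (T : Type) (n : nat) (M : T -> 'M[int]_n)
    (ij : upper_index n) : T -> int :=
  fun w => M w (val ij).1 (val ij).2.

Definition symmetric_rademacher_matrix (d : measure_display)
    (T : measurableType d) (R : realType) (P : probability T R)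
    (n : nat) (M : T -> 'M[int]_n) : Prop :=
  [/\ forall w, (M w)^T = M w,
      forall ij, rademacher P (upper_entry M ij) &
      mutually_independent P (upper_entry M)].

Definition shifted_mod (p n : nat) (A : 'M[int]_n) (lambda : 'F_p) :
    'M['F_p]_n :=
  map_mx intr A - lambda%:M.

(* prod_(i >= 0) (1 - p^-(2i+1)); the partial products are nonincreasing and
   nonnegative for p >= 1, so the limit exists (lemma below). *)
Definition odd_euler_product (R : realType) (p : nat) : R :=
  limn (fun N => \prod_(0 <= i < N) (1 - (p%:R : R) ^- (2 * i + 1))).

Lemma is_cvg_odd_euler_product (R : realType) (p : nat) : (0 < p)%N ->
  cvgn (fun N => \prod_(0 <= i < N) (1 - (p%:R : R) ^- (2 * i + 1))).
Proof.
move=> p0.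
have f01 i : 0 <= 1 - (p%:R : R) ^- (2 * i + 1) <= 1.
  have p1 : 1 <= (p%:R : R) by rewrite ler1n.
  by rewrite subr_ge0 gerBl invr_ge0 exprn_ge0 ?ler0n// andbT
    invf_le1 ?exprn_ege1// exprn_gt0// ltr0n.
apply: nonincreasing_is_cvgn.
  apply/nonincreasing_seqP => N; rewrite big_nat_recr//=.
  rewrite ler_piMr ?(andP (f01 N)).2//.
  by apply: prodr_ge0 => i _; case/andP: (f01 i).
exists 0 => _ [N _ <-].
by apply: prodr_ge0 => i _; case/andP: (f01 i).
Qed.

Definition corank_main_term (R : realType) (p k : nat) : R :=
  odd_euler_product R p / \prod_(1 <= i < k.+1) ((p%:R : R) ^+ i - 1).

(* Main.v *)
Require Import Defs.
From mathcomp Require Import all_boot all_order all_algebra.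
From mathcomp Require Import all_classical all_reals all_analysis.
From mathcomp Require Import ring lra zify.
Import Order.TTheory GRing.Theory Num.Theory.

(** Let [A m] be the trailing [m] by [m] principal submatrix of the shifted matrix.
    Passing from [A m] to [A m.+1] adds one fresh random row and its transpose, so
    the corank changes by at most one. If [A m] has corank [k], it

    - drops by one when the new row is outside the row space of [A m], that is,
      unless [k] independent linear forms vanish on it;
    - grows by one when the row is inside and a further equation, between a
      quadratic form of the row and the new diagonal entry, holds;
    - stays the same otherwise.

    Were these [k] and [k + 1] equations equidistributed over the field, their
    probabilities would be [p ^- k] and [p ^- k.+1] and the corank would be a
    Markov chain on the integers ([chain]). That chain moves between neighbours,
    hence is reversible with explicit weights [1 / \prod_(i <= k) (p ^ i - 1)]
    ([weight_balance]); Euler's identity between products over odd exponents and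
    products of [1 + q ^ i] normalizes them to the main term. It also contracts
    increments by a factor [3/5] once the level [k] is rescaled by [2 ^ k]
    ([incr_contract]), so it forgets its starting point geometrically fast
    ([chain_limit]); the corank may therefore be followed only over the last
    [15/16] of the sizes, from an arbitrary corank at size [m0].

    What has to be shown is equidistribution at each size, up to an error
    [exp (- c n / log p)]. By Fourier inversion ([equidistributed]) it suffices to
    bound characters. For the linear forms the characters are products of cosines
    over the coordinates of a kernel vector of [A m]. For the quadratic form,
    squaring and resampling a set [J] of [h] coordinates ([decouple]) linearizes
    the phase. The quadratic form is given by a generalized inverse of [A m]
    supported on a nonsingular principal minor of full rank; with [J] inside that
    support, the linearized phase is a vector annihilated by all rows of [A m]
    except at most [2 h] of them ([quad_le]). The two resampled copies coincide
    with probability [2 ^- h], which for [h] of order [n / log p] is the size of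
    the error.

    Thus everything rests on one structural statement ([bad_prob]): except with
    probability [exp (- c m)], no nonzero vector annihilated by all but few rows
    of [A m] has a large Fourier coefficient. It is a union bound over vectors
    [w]. The rows outside a block [S] of coordinates hold independently enough
    that [w] is almost in the kernel with probability at most [rho S w] to the
    number of remaining rows ([prob_rows_le]), where [rho] is the Fourier bound for
    the concentration of a signed sum. Freiman's [3/2] theorem makes level sets of
    the phase grow geometrically ([lvl_grow]), so that [rho] is at most
    [(5/4 + N / 768) / p] for a block whose level set has [N < p] elements.
    Cut the coordinates into about [log p] blocks. Either all blocks are sparse, and there
    are few such vectors; or [N] is bounded for some block, and the largeness of
    the Fourier coefficient confines most coordinates to short arcs; or all level
    sets have at least [N > 192] elements, and then a greedy choice of
    [O (log p)] frequencies in each of them confines the coordinates of that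
    block, up to few exceptions, to a set of size [O (p / N)] ([greedy]). In each
    case the number of vectors times the probability is exponentially small. The
    exceptions number about [(log p) ^ 3] and each costs a factor [p], which fits
    when [(log p) ^ 4] is a small multiple of [n], which is the range of [p]. *)

Set Implicit Arguments.
Unset Strict Implicit.
Unset Printing Implicit Defensive.
Local Open Scope ring_scope.

(** * Real characters of the prime field *)

Section Characters.
Variables (R : realType) (p : nat).
Hypotheses (p_pr : prime p) (p_gt2 : (2 < p)%N).
Local Notation F := 'F_p.

Definition ang (a : nat) : R := a%:R * (pi *+ 2 / p%:R).
(** Real and imaginary part of the additive character
    [y |-> exp (2 i pi y / p)]. *)
Definition ec (y : F) : R := cos (ang y).
Definition es (y : F) : R := sin (ang y).

Lemma p_gt0R : 0 < (p%:R : R).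
Proof. by rewrite ltr0n prime_gt0. Qed.

Lemma angD a b : ang (a + b) = ang a + ang b.
Proof. by rewrite /ang natrD mulrDl. Qed.

Lemma ang_mod a : ang a = ang (a %% p) + (pi *+ 2) *+ (a %/ p).
Proof.
rewrite {1}(divn_eq a p) addnC angD /ang natrM -mulr_natr.
have := p_gt0R; move=> /lt0r_neq0 hp; congr (_ + _).
by field.
Qed.

Lemma ecE (a : nat) : ec a%:R = cos (ang a).
Proof.
rewrite /ec (ang_mod a) val_Fp_nat //.
by rewrite (periodicn (@cosD2pi R)).
Qed.

Lemma esE (a : nat) : es a%:R = sin (ang a).
Proof.
rewrite /es (ang_mod a) val_Fp_nat //.
by rewrite (periodicn (@sinD2pi R)).
Qed.

Lemma ecD x y : ec (x + y) = ec x * ec y - es x * es y.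
Proof. by rewrite -(natr_Zp x) -(natr_Zp y) -natrD !ecE !esE angD cosD. Qed.

Lemma esD x y : es (x + y) = es x * ec y + ec x * es y.
Proof. by rewrite -(natr_Zp x) -(natr_Zp y) -natrD !ecE !esE angD sinD. Qed.

Lemma ec0 : ec 0 = 1.
Proof. by rewrite /ec /ang mul0r cos0. Qed.

Lemma es0 : es 0 = 0.
Proof. by rewrite /es /ang mul0r sin0. Qed.

Lemma ec2Des2 x : ec x ^+ 2 + es x ^+ 2 = 1.
Proof. exact: cos2Dsin2. Qed.

Lemma ecN x : ec (- x) = ec x.
Proof.
have h := ecD x (- x); have k := esD x (- x).
move: h k; rewrite subrr ec0 es0 => h k.
have := ec2Des2 x => l.
transitivity (ec (- x) * (ec x ^+ 2 + es x ^+ 2)); first by rewrite l mulr1.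
transitivity (ec x * (ec x * ec (- x) - es x * es (- x)) +
  es x * (es x * ec (- x) + ec x * es (- x))); first by ring.
by rewrite -h -k; ring.
Qed.

Lemma esN x : es (- x) = - es x.
Proof.
have h := ecD x (- x); have k := esD x (- x).
move: h k; rewrite subrr ec0 es0 => h k.
have := ec2Des2 x => l.
transitivity (es (- x) * (ec x ^+ 2 + es x ^+ 2)); first by rewrite l mulr1.
transitivity (ec x * (es x * ec (- x) + ec x * es (- x)) -
  es x * (ec x * ec (- x) - es x * es (- x))); first by ring.
by rewrite -h -k; ring.
Qed.

Lemma ecB x y : ec (x - y) = ec x * ec y + es x * es y.
Proof. by rewrite ecD ecN esN mulrN opprK. Qed.

Lemma ec_norm x : `|ec x| <= 1.
Proof. exact: cos_max. Qed.

Lemma es2_ge0 x : 0 <= es x ^+ 2.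
Proof. exact: sqr_ge0. Qed.

Lemma ec_double x : ec (x *+ 2) = 1 - 2 * es x ^+ 2.
Proof. by rewrite mulr2n ecD; have := ec2Des2 x; move=> h; lra. Qed.

Lemma es2_double x : es x ^+ 2 = (1 - ec (x *+ 2)) / 2.
Proof. by rewrite ec_double; lra. Qed.

(** The defect [es ^ 2] behaves like a squared distance to the nearest
    multiple of [p/2]; this is its weak triangle inequality. *)
Lemma es2D x y : es (x + y) ^+ 2 <= 2 * es x ^+ 2 + 2 * es y ^+ 2.
Proof.
rewrite esD.
have hx := ec2Des2 x; have hy := ec2Des2 y.
have hx2 : 0 <= ec x ^+ 2 by exact: sqr_ge0.
have hy2 : 0 <= ec y ^+ 2 by exact: sqr_ge0.
apply: (@le_trans _ _ (2 * (es x * ec y) ^+ 2 + 2 * (ec x * es y) ^+ 2)).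
  have : 0 <= (es x * ec y - ec x * es y) ^+ 2 by exact: sqr_ge0.
  by move=> h; lra.
rewrite !exprMn lerD // ler_wpM2l //.
  by rewrite ler_piMr ?es2_ge0 //; have := es2_ge0 y; lra.
by rewrite ler_piMl ?es2_ge0 //; have := es2_ge0 x; lra.
Qed.

Lemma ec_le_exp x : `|ec x| <= expR (- (es x ^+ 2 / 2)).
Proof.
rewrite -ler_sqr ?nnegrE ?expR_ge0 // real_normK ?num_real //.
rewrite -expRM_natl; have -> : 2 * - (es x ^+ 2 / 2) = - es x ^+ 2 by field.
apply: le_trans (expR_ge1Dx _).
by have := ec2Des2 x; lra.
Qed.

Lemma ec1_lt1 : ec 1 < 1.
Proof.
rewrite -(natr_Zp 1) ecE.
have -> : (1 : F) = 1%N :> nat by rewrite -[1]/(1%:R) val_Fp_nat // modn_small // prime_gt1.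
have pi0 := pi_gt0 R; have p0 := p_gt0R.
have h : 0 < pi *+ 2 / p%:R :> R by rewrite divr_gt0 // mulr2n addr_gt0.
have h2 : pi *+ 2 / p%:R <= pi :> R.
  by rewrite ler_pdivrMr // -[pi *+ 2]mulr_natr ler_wpM2l ?(ltW pi0) // ler_nat ltnW.
rewrite /ang mul1r -[X in _ < X](@cos0 R) ltr_cos //.
  by rewrite in_itv /= lexx ltW.
by rewrite in_itv /= (ltW h) h2.
Qed.

Lemma card_F : #|{: F}| = p.
Proof. exact: card_Fp. Qed.

(** Translation by 1 rotates the pair of sums by a nontrivial angle, so both vanish. *)
Lemma sum_ec1 : \sum_(t : F) ec t = 0 /\ \sum_(t : F) es t = 0.
Proof.
set a := \sum_t ec t; set b := \sum_t es t.
have ha : a = a * ec 1 - b * es 1.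
  rewrite {1}/a (reindex_inj (addIr 1)) /=.
  rewrite (eq_bigr _ (fun t _ => ecD t 1)) sumrB -!mulr_suml //.
have hb : b = b * ec 1 + a * es 1.
  rewrite {1}/b (reindex_inj (addIr 1)) /=.
  by rewrite (eq_bigr _ (fun t _ => esD t 1)) big_split -!mulr_suml.
have h1 := ec1_lt1; have h2 := ec2Des2 1.
have h3 : (1 - ec 1) ^+ 2 + es 1 ^+ 2 != 0 by rewrite gt_eqF //; lra.
have Ha : a * ((1 - ec 1) ^+ 2 + es 1 ^+ 2) = 0.
  transitivity ((a - (a * ec 1 - b * es 1)) * (1 - ec 1) + (- (b - (b * ec 1 + a * es 1))) * es 1).
    by ring.
  by rewrite -ha -hb; ring.
have Hb : b * ((1 - ec 1) ^+ 2 + es 1 ^+ 2) = 0.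
  transitivity ((b - (b * ec 1 + a * es 1)) * (1 - ec 1) + (a - (a * ec 1 - b * es 1)) * es 1).
    by ring.
  by rewrite -ha -hb; ring.
by move: Ha Hb => /eqP; rewrite mulf_eq0 (negPf h3) orbF => /eqP -> /eqP;
  rewrite mulf_eq0 (negPf h3) orbF => /eqP ->.
Qed.

Lemma sum_ecM y : \sum_(t : F) ec (t * y) = p%:R * (y == 0)%:R.
Proof.
have [->|y0] := eqVneq y 0.
  rewrite (eq_bigr (fun=> 1)) => [|t _]; last by rewrite mulr0 ec0.
  by rewrite sumr_const card_F mulr1.
by rewrite mulr0 -[RHS]sum_ec1.1 [RHS](reindex_inj (mulIf y0)).
Qed.

Lemma sum_esM y : \sum_(t : F) es (t * y) = 0.
Proof.
have [->|y0] := eqVneq y 0.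
  by rewrite big1 // => t _; rewrite mulr0 es0.
by rewrite -[RHS]sum_ec1.2 [RHS](reindex_inj (mulIf y0)).
Qed.

Lemma two_neq0 : (2%:R : F) != 0.
Proof.
apply/eqP => h; have := val_Fp_nat p_pr 2.
by rewrite h modn_small.
Qed.

Lemma mulr2n_eq0F (y : F) : (y *+ 2 == 0) = (y == 0).
Proof. by rewrite -mulr_natr mulf_eq0 (negPf two_neq0) orbF. Qed.

Lemma sum_es2M y : \sum_(t : F) es (t * y) ^+ 2 = p%:R / 2 * (y != 0)%:R.
Proof.
under eq_bigr do rewrite es2_double -mulrnAr.
rewrite -mulr_suml sumrB sum_ecM sumr_const card_F mulr2n_eq0F.
by case: eqVneq => _ /=; lra.
Qed.

Lemma sum_ec_shift b y : y != 0 -> \sum_(t : F) ec (b + t * y) = 0.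
Proof.
move=> y0; under eq_bigr do rewrite ecD.
by rewrite sumrB -!mulr_sumr sum_ecM sum_esM (negPf y0) !mulr0 subrr.
Qed.

(** Orthogonality in several variables: averaging over the line through a
    coordinate on which [y] does not vanish already gives 0. *)
Lemma sum_ec_dot (J : finType) (y : J -> F) :
  \sum_(t : {ffun J -> F}) ec (\sum_j t j * y j) =
  p%:R ^+ #|J| * [forall j, y j == 0]%:R.
Proof.
case: (boolP [forall j, y j == 0]) => [/forallP y0|].
  rewrite (eq_bigr (fun=> 1)) => [|t _]; last first.
    by rewrite big1 ?ec0 // => j _; rewrite (eqP (y0 j)) mulr0.
  by rewrite sumr_const mulr1 card_ffun card_F natrX.
rewrite negb_forall => /existsP [j0 yj0].
set S := \sum_t _; rewrite mulr0.
pose sh (c : F) (t : {ffun J -> F}) := [ffun j => t j + c * (j == j0)%:R].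
have shK c : injective (sh c).
  move=> t1 t2 /ffunP e; apply/ffunP => j; have := e j; rewrite !ffunE.
  exact: addIr.
have hS c : S = \sum_(t : {ffun J -> F}) ec (\sum_j t j * y j + c * y j0).
  rewrite /S (reindex_inj (shK c)) /=; apply: eq_bigr => t _; congr ec.
  under eq_bigr do rewrite ffunE mulrDl.
  rewrite big_split /=; congr (_ + _).
  rewrite (bigD1 j0) //= eqxx mulr1 big1 ?addr0 // => j /negPf ->.
  by rewrite mulr0 mul0r.
have : p%:R * S = 0.
  transitivity (\sum_(c : F) S); first by rewrite sumr_const card_F mulr_natl.
  under eq_bigr => c _ do rewrite (hS c).
  by rewrite exchange_big /= big1 // => t _; rewrite sum_ec_shift.
by move/eqP; rewrite mulf_eq0 gt_eqF ?p_gt0R //= => /eqP.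
Qed.

End Characters.

(** * Averages over finite types and over random signs *)

Section Mean.
Variable R : realType.
Implicit Types T : finType.

Definition mean T (f : T -> R) : R := (\sum_x f x) / #|T|%:R.

Lemma eq_mean T (f g : T -> R) : f =1 g -> mean f = mean g.
Proof. by move=> fg; rewrite /mean (eq_bigr g). Qed.

Lemma card_inv_ge0 T : 0 <= (#|T|%:R : R)^-1.
Proof. by rewrite invr_ge0 ler0n. Qed.

Lemma mean_ge0 T (f : T -> R) : (forall x, 0 <= f x) -> 0 <= mean f.
Proof. by move=> f0; rewrite mulr_ge0 ?card_inv_ge0 ?sumr_ge0. Qed.

Lemma ler_mean T (f g : T -> R) : (forall x, f x <= g x) -> mean f <= mean g.
Proof. by move=> fg; rewrite ler_wpM2r ?card_inv_ge0 // ler_sum. Qed.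

Lemma meanD T (f g : T -> R) : mean (fun x => f x + g x) = mean f + mean g.
Proof. by rewrite /mean big_split mulrDl. Qed.

Lemma meanN T (f : T -> R) : mean (fun x => - f x) = - mean f.
Proof. by rewrite /mean sumrN mulNr. Qed.

Lemma meanB T (f g : T -> R) : mean (fun x => f x - g x) = mean f - mean g.
Proof. by rewrite meanD meanN. Qed.

Lemma meanMl T (f : T -> R) c : mean (fun x => c * f x) = c * mean f.
Proof. by rewrite /mean -mulr_sumr mulrA. Qed.

Lemma meanMr T (f : T -> R) c : mean (fun x => f x * c) = mean f * c.
Proof. by rewrite /mean -mulr_suml mulrAC. Qed.

Lemma mean_sum T (I : Type) (r : seq I) (P : pred I) (F : T -> I -> R) :
  mean (fun x => \sum_(i <- r | P i) F x i) =
  \sum_(i <- r | P i) mean (fun x => F x i).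
Proof. by rewrite /mean exchange_big /= mulr_suml. Qed.

Lemma mean_exchange T1 T2 (F : T1 -> T2 -> R) :
  mean (fun x => mean (F x)) = mean (fun y => mean (fun x => F x y)).
Proof. by rewrite /mean -!mulr_suml exchange_big /= -!mulrA; congr (_ * _); rewrite mulrC. Qed.

Lemma mean_const T c : (0 < #|T|)%N -> mean (fun _ : T => c) = c.
Proof.
move=> T0; rewrite /mean sumr_const -[c *+ _]mulr_natr mulfK //.
by rewrite pnatr_eq0 -lt0n.
Qed.

Lemma ler_mean_norm T (f : T -> R) : `|mean f| <= mean (fun x => `|f x|).
Proof.
rewrite normrM (ger0_norm (card_inv_ge0 T)) ler_wpM2r ?card_inv_ge0 //.
exact: ler_norm_sum.
Qed.

Lemma mean_sqr T (f : T -> R) : mean f ^+ 2 <= mean (fun x => f x ^+ 2).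
Proof.
have [T0|T0] := posnP #|T|.
  by rewrite /mean T0 invr0 !mulr0 expr0n.
have : 0 <= mean (fun x => (f x - mean f) ^+ 2).
  by apply: mean_ge0 => x; exact: sqr_ge0.
rewrite (eq_mean (_ : _ =1 (fun x => f x ^+ 2 + (- 2 * mean f * f x + mean f ^+ 2)))).
  by rewrite !meanD meanMl mean_const // => h; lra.
by move=> x; ring.
Qed.

Lemma mean_le1 T (f : T -> R) : (forall x, f x <= 1) -> mean f <= 1.
Proof.
move=> f1; have [T0|T0] := posnP #|T|.
  by rewrite /mean T0 invr0 mulr0.
by rewrite -[X in _ <= X](@mean_const T 1 T0) ler_mean.
Qed.

End Mean.

Section Signs.
Variables (R : realType) (K : finType).
Local Notation X := {ffun K -> bool}.
Implicit Types (x : X) (J : {set K}).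

Lemma card_signs : (0 < #|{: X}|)%N.
Proof. by rewrite card_ffun card_bool expn_gt0. Qed.

Definition splice J (y u : X) : X := [ffun k => if k \in J then y k else u k].

(** Exchanging the coordinates in [J] between two independent copies preserves
    their joint law. *)
Lemma mean_splice J (h : X -> R) :
  mean h = mean (fun u => mean (fun y => h (splice J y u))).
Proof.
rewrite -[LHS](@mean_const _ {: X} _ card_signs) /mean -!mulr_suml.
congr (_ / _ / _); rewrite !pair_bigA /=.
pose sw (uy : X * X) := (splice J uy.1 uy.2, splice J uy.2 uy.1).
have swK : involutive sw.
  move=> [u y]; rewrite /sw /=; congr (_, _); apply/ffunP => k;
  by rewrite !ffunE; case: (k \in J).
by rewrite (reindex_inj (inv_inj swK)).
Qed.

Definition flip (k : K) x : X := [ffun j => (j == k) (+) x j].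

Lemma flipK k : involutive (flip k).
Proof. by move=> x; apply/ffunP => j; rewrite !ffunE addbA addbb. Qed.

(** Signs read off through an injection [i] are independent of every function
    of [x] that ignores the coordinates in the image of [i]. *)
Lemma mean_resample (K' : finType) (i : K' -> K) (G : X -> {ffun K' -> bool} -> R) :
  injective i ->
  (forall x x' z, (forall k, k \notin codom i -> x k = x' k) -> G x z = G x' z) ->
  mean (fun x => G x [ffun j => x (i j)]) = mean (fun x => mean (G x)).
Proof.
move=> iI GE; have K'0 : (0 < #|{: {ffun K' -> bool}}|)%N.
  by rewrite card_ffun card_bool expn_gt0.
pose tr (y : {ffun K' -> bool}) x : X :=
  [ffun k => (if [pick j | i j == k] is Some j then y j else false) (+) x k].
have trK y : involutive (tr y).
  by move=> x; apply/ffunP => j; rewrite !ffunE addbA addbb.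
have tri y x j : tr y x (i j) = y j (+) x (i j).
  rewrite ffunE; case: pickP => [j' /eqP/iI -> //|/(_ j)]; by rewrite eqxx.
have trG y x z : G (tr y x) z = G x z.
  apply: GE => k hk; rewrite ffunE; case: pickP => [j /eqP ek|//].
  by move: hk; rewrite -ek codom_f.
transitivity (mean (fun y : {ffun K' -> bool} =>
    mean (fun x => G x [ffun j => y j (+) x (i j)]))).
  rewrite -[LHS](@mean_const _ {: {ffun K' -> bool}} _ K'0).
  apply: eq_mean => y; rewrite /mean (reindex_inj (inv_inj (trK y))) /=.
  congr (_ / _); apply: eq_bigr => x _; rewrite trG; congr G.
  by apply/ffunP => j; rewrite !ffunE -(tri y x j) !ffunE.
rewrite mean_exchange; apply: eq_mean => x.
pose tx (y : {ffun K' -> bool}) := [ffun j => y j (+) x (i j)].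
have txK : involutive tx.
  by move=> y; apply/ffunP => j; rewrite !ffunE -addbA addbb addbF.
by rewrite /mean [in RHS](reindex_inj (inv_inj txK)).
Qed.

Variable p : nat.
Hypotheses (p_pr : prime p) (p_gt2 : (2 < p)%N).
Local Notation F := 'F_p.

Definition sg (b : bool) : F := (-1) ^+ b.

Lemma sgN b : sg (~~ b) = - sg b.
Proof. by case: b; rewrite /sg ?expr1 ?expr0 ?opprK. Qed.

Lemma ec_sg y b : ec R (y * sg b) = ec R y.
Proof. by case: b; rewrite /sg ?expr1 ?expr0 ?mulr1 ?mulrN1 ?ecN. Qed.

Lemma sum_ec_sg_seq (r : seq K) (b : K -> F) c : uniq r ->
  \sum_(x : X) ec R (c + \sum_(k <- r) b k * sg (x k)) =
  #|{: X}|%:R * (ec R c * \prod_(k <- r) ec R (b k)).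
Proof.
elim: r => [_|k r IH /= /andP [kr ur]].
  rewrite big_nil mulr1 (eq_bigr (fun=> ec R c)) => [|x _]; last by rewrite big_nil addr0.
  by rewrite sumr_const mulr_natl.
have e : \sum_(x : X) ec R (c + \sum_(k <- k :: r) b k * sg (x k)) =
  \sum_(x : X) ec R (c + \sum_(k <- r) b k * sg (x k)) * ec R (b k).
  have e2 (S S' : R) : S + S = S' + S' -> S = S' by move=> h; lra.
  apply: e2; rewrite {2}(reindex_inj (inv_inj (flipK k))) /= -!big_split /=.
  apply: eq_bigr => x _; rewrite !big_cons ffunE eqxx /= sgN.
  have -> : \sum_(j <- r) b j * sg (flip k x j) = \sum_(j <- r) b j * sg (x j).
    rewrite big_seq [RHS]big_seq; apply: eq_bigr => j jr; rewrite ffunE.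
    by case: eqVneq jr kr => [-> ->|].
  set s := \sum_(j <- r) _.
  rewrite !(addrCA c) mulrN; set z := c + s.
  by rewrite !ecD // esN // !ecN // ec_sg; ring.
by rewrite e -mulr_suml IH // big_cons; ring.
Qed.

(** A real character of a random signed sum factors: both values of a sign give
    the same cosine, and the sines cancel. *)
Lemma mean_ec_sg (b : K -> F) c :
  mean (fun x : X => ec R (c + \sum_k b k * sg (x k))) =
  ec R c * \prod_k ec R (b k).
Proof.
rewrite /mean sum_ec_sg_seq ?index_enum_uniq // mulrAC mulfV ?mul1r //.
by rewrite pnatr_eq0 -lt0n card_signs.
Qed.

End Signs.

(** * Level sets of the defect and their growth *)

Section Growth.
Variable p : nat.
Hypotheses (p_pr : prime p) (p_gt2 : (2 < p)%N).
Local Notation F := 'F_p.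

Definition sumset (A : {set F}) : {set F} := [set x + y | x in A, y in A].

(** Freiman's [3/2] theorem for symmetric sets: below that growth, every
    element of [A + A] is a difference of elements of [A] in more than [|A|/2]
    ways, so [A + A] is a subgroup. *)
Lemma sumset_growth (A : {set F}) : (forall x, x \in A -> - x \in A) ->
  [\/ (#|A| <= 1)%N, sumset A = [set: F] | (3 * #|A| <= 2 * #|sumset A|)%N].
Proof.
move=> sA; have [h|h] := leqP (3 * #|A|) (2 * #|sumset A|); first by constructor 3.
have BN x : x \in sumset A -> - x \in sumset A.
  move=> /imset2P [a b aA bA ->]; apply/imset2P.
  by exists (- a) (- b); rewrite ?sA // opprD.
have H x : x \in sumset A -> (#|A| < 2 * #|[set c in A | (x + c)%R \in A]|)%N.
  move=> /imset2P [a b aA bA ->].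
  pose U := [set a + c | c in A]; pose V := [set - b + c | c in A].
  have cU : #|U| = #|A| by apply: card_imset; exact: addrI.
  have cV : #|V| = #|A| by apply: card_imset; exact: addrI.
  have UB : U :|: V \subset sumset A.
    apply/fintype.subsetP => z /setUP [] /imsetP [c cA ->]; apply/imset2P.
      by exists a c.
    by exists (- b) c; rewrite ?sA.
  have := subset_leq_card UB; have := cardsUI U V; rewrite cU cV => h1 h2.
  have h3 : (#|U :&: V| <= #|[set c in A | (a + b + c)%R \in A]|)%N.
    rewrite -(card_imset (mem (U :&: V)) (addIr (- a))); apply: subset_leq_card.
    apply/fintype.subsetP => _ /imsetP [z /setIP [/imsetP [c cA ->] /imsetP [c' c'A e]] ->].
    rewrite inE addrC addKr cA /=; suff -> : a + b + c = c' by [].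
    by rewrite addrAC e addrC addrA subrr add0r.
  have ar (n b' v i c : nat) : (2 * b' < 3 * n -> v + i = n + n -> v <= b' -> i <= c ->
    n < 2 * c)%N by lia.
  exact: ar h h1 h2 h3.
have clo x y : x \in sumset A -> y \in sumset A -> x + y \in sumset A.
  move=> xB /BN yB; have := H _ xB; have := H _ yB.
  set C1 := [set c in A | - y + c \in A]; set C2 := [set c in A | x + c \in A].
  have : C1 :|: C2 \subset A by apply/fintype.subsetP => c; rewrite !inE => /orP [] /andP [].
  move=> /subset_leq_card; have := cardsUI C1 C2 => h1 h2 h3 h4.
  have ar (n v i c c' : nat) : (v + i = c + c' -> v <= n -> n < 2 * c -> n < 2 * c' ->
    0 < i)%N by lia.
  have := ar _ _ _ _ _ h1 h2 h3 h4; case/card_gt0P => c; rewrite !inE => /andP [/andP [cA yc] /andP [_ xc]].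
  apply/imset2P; exists (x + c) (- (- y + c)); rewrite ?sA //.
  by rewrite opprD opprK addrACA subrr addr0.
have [/existsP [z /andP [zB z0]]|/existsPn all0] :=
  boolP [exists z, (z \in sumset A) && (z != 0)].
  constructor 2; apply/setP => y; rewrite inE.
  have mul k : z *+ k.+1 \in sumset A.
    by elim: k => [|k IH]; rewrite ?mulr1n // mulrS clo.
  have [k ->] : exists k : nat, y = z *+ k.
    by exists (y / z : F); rewrite -mulr_natr natr_Zp mulrC mulfVK.
  case: k => [|k]; last exact: mul.
  by have := clo _ _ zB (BN _ zB); rewrite subrr.
constructor 1; rewrite -(cards1 (0 : F)); apply: subset_leq_card.
apply/fintype.subsetP => a aA; have aB : a + a \in sumset A.
  by apply/imset2P; exists a a.
by have := all0 (a + a); rewrite aB /= negbK -mulr2n mulr2n_eq0F // inE.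
Qed.

End Growth.

Section Levels.
Variables (R : realType) (p : nat).
Hypotheses (p_pr : prime p) (p_gt2 : (2 < p)%N).
Local Notation F := 'F_p.
Local Notation es := (@es R p).
Local Notation ec := (@ec R p).

Section Vec.
Variables (I : finType) (S : {set I}) (u : I -> F).

Definition defect (t : F) : R := \sum_(i in S) es (t * u i) ^+ 2.
Definition lvl (r : R) : {set F} := [set t | defect t <= r].
(** Fourier bound for the largest atom of the signed sum of [u] over [S]. *)
Definition rho : R := p%:R^-1 * \sum_(t : F) \prod_(i in S) `|ec (t * u i)|.

Lemma in_lvl r t : (t \in lvl r) = (defect t <= r).
Proof. by rewrite inE. Qed.

Lemma defect_ge0 t : 0 <= defect t.
Proof. by apply: sumr_ge0 => i _; exact: es2_ge0. Qed.

Lemma lvl_sub r r' : r <= r' -> lvl r \subset lvl r'.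
Proof. by move=> rr'; apply/fintype.subsetP => t; rewrite !in_lvl => /le_trans; apply. Qed.

Lemma lvl_neq0 r : 0 <= r -> (0 < #|lvl r|)%N.
Proof.
move=> r0; apply/card_gt0P; exists 0; rewrite in_lvl /defect big1 // => i _.
by rewrite mul0r es0 expr0n.
Qed.

Lemma sumset_lvl r : sumset (lvl r) \subset lvl (4 * r).
Proof.
apply/fintype.subsetP => _ /imset2P [s t hs ht ->]; move: hs ht; rewrite !in_lvl => hs ht.
apply: (@le_trans _ _ (2 * defect s + 2 * defect t)); last by lra.
rewrite /defect !mulr_sumr -big_split /=; apply: ler_sum => i _.
by rewrite mulrDl; exact: es2D.
Qed.

(** The weak triangle inequality puts [lvl r + lvl r] inside [lvl (4 * r)], so each
    factor 4 in the level gains a factor [3/2] in size, until everything is filled. *)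
Lemma lvl_grow a r : lvl (4 ^+ a * r) != [set: F] ->
  (#|lvl r| <= 1)%N \/ (3 / 2) ^+ a * #|lvl r|%:R <= #|lvl (4 ^+ a * r)|%:R :> R.
Proof.
have [r0|r0] := ltP r 0.
  left; rewrite (_ : lvl r = finset.set0) ?cards0 //; apply/setP => t.
  by rewrite in_lvl inE; apply/negbTE; rewrite -ltNge (lt_le_trans r0) ?defect_ge0.
elim: a r r0 => [|a IH] r r0; first by rewrite !expr0 !mul1r => _; right.
rewrite exprSr -mulrA => hT.
have sub : lvl (4 * r) \subset lvl (4 ^+ a * (4 * r)).
  apply: lvl_sub; rewrite ler_peMl ?mulr_ge0 ?exprn_ege1 //; lra.
have r40 : 0 <= 4 * r by lra.
have := IH _ r40 hT.
have lr : (#|lvl r| <= #|lvl (4 * r)|)%N.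
  by apply: subset_leq_card; apply: lvl_sub; lra.
case=> [h|h]; first by left; rewrite (leq_trans lr).
have sym x : x \in lvl r -> - x \in lvl r.
  rewrite !in_lvl; suff -> : defect (- x) = defect x by [].
  by apply: eq_bigr => i _; rewrite mulNr esN // sqrrN.
have := subset_leq_card (sumset_lvl r).
case: (sumset_growth p_pr p_gt2 sym) => [?|e|g] ss; [by left| |].
  case/eqP: hT; apply/eqP; rewrite finset.eqEsubset finset.subsetT /= -e.
  exact: fintype.subset_trans (sumset_lvl r) sub.
right; apply: le_trans h; rewrite exprSr -mulrA ler_wpM2l ?exprn_ge0 //.
have : (3 * #|lvl r|)%:R <= (2 * #|lvl (4 * r)|)%:R :> R by rewrite ler_nat; lia.
by rewrite !natrM; lra.
Qed.

Lemma card_lvl_le a r : lvl (4 ^+ a * r) != [set: F] ->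
  #|lvl r|%:R <= 1 + (2 / 3) ^+ a * #|lvl (4 ^+ a * r)|%:R :> R.
Proof.
move=> /lvl_grow [h|h].
  apply: (@le_trans _ _ 1%:R); first by rewrite ler_nat.
  by rewrite lerDl mulr_ge0 // exprn_ge0 //; lra.
have -> : #|lvl r|%:R = (2 / 3) ^+ a * ((3 / 2) ^+ a * #|lvl r|%:R) :> R.
  rewrite mulrA -exprMn (_ : 2 / 3 * (3 / 2) = 1) ?expr1n ?mul1r //; lra.
by rewrite (le_trans (ler_wpM2l _ h)) ?lerDr // exprn_ge0 //; lra.
Qed.

Lemma prod_ec_le t : \prod_(i in S) `|ec (t * u i)| <= expR (- (defect t / 2)).
Proof.
rewrite /defect mulr_suml -sumrN expR_sum; apply: ler_prod => i _.
by rewrite normr_ge0 ec_le_exp.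
Qed.

Lemma rho_ge0 : 0 <= rho.
Proof. by rewrite mulr_ge0 ?invr_ge0 ?sumr_ge0 // => t _; rewrite prodr_ge0. Qed.

(** The frequencies are split at the levels [r] and [4 ^ a * r]; the lowest
    level is a geometrically small fraction of the highest one. *)
Lemma rho_le a r : lvl (4 ^+ a * r) != [set: F] ->
  p%:R * rho <= 1 + ((2 / 3) ^+ a + expR (- (r / 2))) * #|lvl (4 ^+ a * r)|%:R
     + p%:R * expR (- (4 ^+ a * r / 2)).
Proof.
move=> hT; have p0 := p_gt0R R p_pr.
rewrite /rho mulrA mulfV ?gt_eqF // mul1r.
apply: (@le_trans _ _ (\sum_(t : F) ((t \in lvl r)%:R +
   expR (- (r / 2)) * (t \in lvl (4 ^+ a * r))%:R + expR (- (4 ^+ a * r / 2))))).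
  apply: ler_sum => t _; apply: (le_trans (prod_ec_le t)).
  rewrite !in_lvl; case: (leP (defect t) r) => h1 /=.
    rewrite (@le_trans _ _ 1) // ?expR_le1 ?oppr_le0 ?mulr_ge0 ?defect_ge0 ?invr_ge0 //.
    by rewrite -addrA lerDl addr_ge0 ?mulr_ge0 ?expR_ge0.
  case: (leP (defect t) (4 ^+ a * r)) => h2 /=.
    by rewrite add0r mulr1 ler_wpDr ?expR_ge0 // ler_expR; lra.
  by rewrite add0r mulr0 add0r ler_expR; lra.
rewrite !big_split /= sumr_const card_F // -[expR _ *+ p]mulr_natl lerD2r.
rewrite -mulr_sumr mulrDl addrA lerD //.
  by rewrite -natr_sum -big_mkcond /= sum1_card card_lvl_le.
by rewrite -natr_sum -big_mkcond /= sum1_card.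
Qed.

(** A nonzero coordinate has mean defect [1/2] over all frequencies, so uniformly small
    defects force a small support. *)
Lemma lvlT_supp f : lvl f = [set: F] -> #|[set i in S | u i != 0]|%:R <= 2 * f.
Proof.
move=> hT; have p0 := p_gt0R R p_pr.
have h : \sum_(t : F) defect t <= p%:R * f.
  rewrite mulr_natl; have <- : \sum_(t : F) f = f *+ p by rewrite sumr_const card_F.
  by apply: ler_sum => t _; rewrite -in_lvl hT inE.
have e : \sum_(t : F) defect t = p%:R / 2 * #|[set i in S | u i != 0]|%:R.
  rewrite /defect exchange_big /= (eq_bigr _ (fun i _ => sum_es2M R p_pr p_gt2 (u i))).
  rewrite -mulr_sumr -natr_sum -big_mkcondr /= -sum1_card; congr (_ * _%:R).
  by apply: eq_bigl => i; rewrite !inE.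
move: h; rewrite e -mulrA ler_pM2l // => h; lra.
Qed.

End Vec.

Definition bohr1 (b : R) : {set F} := [set x | es x ^+ 2 <= b].

(** An arc is a level set of the vector with the single coordinate 1, so the
    growth of level sets also bounds arcs. *)
Lemma card_bohr1 a b : 4 ^+ a * b < 1 / 2 -> #|bohr1 b|%:R <= 1 + (2 / 3) ^+ a * p%:R :> R.
Proof.
move=> hb; have d x : defect [set: unit] (fun=> 1) x = es x ^+ 2.
  rewrite /defect (eq_bigl xpredT) => [|i]; last by rewrite inE.
  by rewrite big_const card_unit /= addr0 mulr1.
have -> : bohr1 b = lvl [set: unit] (fun=> 1) b.
  by apply/setP => x; rewrite inE in_lvl d.
apply: le_trans (card_lvl_le _) _.
  apply/eqP => /lvlT_supp; rewrite (_ : [set _ in _ | _] = [set: unit]).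
    by rewrite cardsT card_unit => h; lra.
  by apply/setP => i; rewrite !inE oner_neq0.
rewrite lerD2l ler_wpM2l ?exprn_ge0 //.
by rewrite ler_nat; have := max_card (mem (lvl [set: unit] (fun=> 1) (4 ^+ a * b))); rewrite card_F.
Qed.

(** Since [|c| <= 3/4 c ^ 2 + 1/3], the mean of [|cos|] is controlled by the mean of
    [cos ^ 2], which is [1/2]. *)
Lemma rho_single (I : finType) (i0 : I) (u : I -> F) : u i0 != 0 -> rho [set i0] u <= 3 / 4.
Proof.
move=> u0; have p0 := p_gt0R R p_pr.
rewrite /rho mulrC ler_pdivrMr // .
apply: (@le_trans _ _ (\sum_(t : F) (3 / 4 * (1 - es (t * u i0) ^+ 2) + 1 / 3))).
  apply: ler_sum => t _; rewrite big_set1.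
  have -> : es (t * u i0) ^+ 2 = 1 - `|ec (t * u i0)| ^+ 2.
    by rewrite real_normK ?num_real //; have := ec2Des2 R (t * u i0) => h; lra.
  move: (`|_|) => c; have : 0 <= (c - 2 / 3) ^+ 2 by exact: sqr_ge0.
  by rewrite sqrrB => h; lra.
rewrite big_split /= -mulr_sumr sumrB sum_es2M // u0 !sumr_const card_F //.
by rewrite -[1 *+ p]/(p%:R) -[(1 / 3) *+ p]mulr_natr mulr1; lra.
Qed.

End Levels.

(** * Counting vectors with many large Fourier coefficients *)

Section Greedy.
Variables (R : realType) (p : nat).
Hypotheses (p_pr : prime p) (p_gt2 : (2 < p)%N).
Local Notation F := 'F_p.
Local Notation es := (@es R p).
Local Notation ec := (@ec R p).

Lemma sum_sqr_ec_le (A : {set F}) :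
  \sum_(t : F) (\sum_(x in A) ec (t * x)) ^+ 2 <= p%:R * #|A|%:R.
Proof.
have p0 := p_gt0R R p_pr.
have h (x : F) : \sum_(y in A) \sum_(t : F) ec (t * x) * ec (t * y) <= p%:R.
  have -> : \sum_(y in A) \sum_(t : F) ec (t * x) * ec (t * y) =
      \sum_(y in A) (p%:R / 2 * (y == x)%:R + p%:R / 2 * (y == - x)%:R).
    apply: eq_bigr => y _.
    have e t : ec (t * x) * ec (t * y) = (ec (t * (y - x)) + ec (t * (y + x))) / 2.
      by rewrite mulrBr mulrDr ecB // ecD //; field.
    rewrite (eq_bigr _ (fun t _ => e t)) -mulr_suml big_split /= !sum_ecM //.
    by rewrite subr_eq0 addr_eq0; field.
  have one (z : F) : \sum_(y in A) (p%:R / 2 * (y == z)%:R) <= p%:R / 2 :> R.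
    rewrite -mulr_sumr ler_piMr ?divr_ge0 ?(ltW p0) // -natr_sum -big_mkcondr /= sum1_card.
    rewrite (@ler_nat R _ 1) -(cards1 z); apply: subset_leq_card.
    by apply/fintype.subsetP => y; rewrite unfold_in /= inE => /andP [].
  by rewrite big_split /=; have := one x; have := one (- x) => h1 h2; lra.
have -> : \sum_(t : F) (\sum_(x in A) ec (t * x)) ^+ 2 =
   \sum_(x in A) \sum_(y in A) \sum_(t : F) ec (t * x) * ec (t * y).
  rewrite [RHS](eq_bigr (fun x => \sum_(t : F) \sum_(y in A) ec (t * x) * ec (t * y))).
    rewrite [RHS]exchange_big /=; apply: eq_bigr => t _.
    by rewrite expr2 mulr_suml; apply: eq_bigr => x _; rewrite mulr_sumr.
  by move=> x _; rewrite exchange_big.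
rewrite mulr_natr -sumr_const; apply: ler_sum => x _; exact: h.
Qed.

(** If every [t] in [T] kept more than three quarters of [A], the cosine sums
    over [A] would all be large on [T], against Parseval. *)
Lemma greedy_step (A T : {set F}) : 64 * p%:R < #|A|%:R * #|T|%:R :> R ->
  exists2 t, t \in T & #|[set x in A | es (t * x) ^+ 2 <= 4^-1]|%:R <= 3 / 4 * #|A|%:R :> R.
Proof.
move=> big; apply/exists_inP; apply: contraT => /exists_inPn H.
have p0 := p_gt0R R p_pr.
have A0 : 0 < #|A|%:R :> R.
  rewrite lt_neqAle ler0n andbT; apply/eqP => e; move: big; rewrite -e mul0r.
  by rewrite ltNge mulr_ge0 ?ltW.
have low t : t \in T -> #|A|%:R / 8 <= \sum_(x in A) ec ((t *+ 2) * x).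
  move=> /H; rewrite -ltNge => h.
  have : \sum_(x in A) (3 / 2 * (es (t * x) ^+ 2 <= 4^-1)%R%:R - 1) <= \sum_(x in A) ec (t *+ 2 * x).
    apply: ler_sum => x _; rewrite (mulrnAl t) ec_double //.
    have := ec2Des2 R (t * x); have := sqr_ge0 (ec (t * x)).
    by case: (leP (es (t * x) ^+ 2)) => h1 h2 h3; rewrite ?mulr1 ?mulr0; lra.
  rewrite sumrB -mulr_sumr -natr_sum -big_mkcondr /= sum1_card sumr_const.
  have -> : #|[pred x in A | es (t * x) ^+ 2 <= 4^-1]| = #|[set x in A | es (t * x) ^+ 2 <= 4^-1]|.
    by apply: eq_card => x; rewrite !inE.
  rewrite -[1 *+ #|A|]/(#|A|%:R) => h1; lra.
have h1 : \sum_(t in T) (#|A|%:R / 8) ^+ 2 <= p%:R * #|A|%:R :> R.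
  apply: le_trans (sum_sqr_ec_le A).
  rewrite [X in _ <= X](reindex_inj (_ : injective (fun t : F => t *+ 2))) /=; last first.
    by move=> x y /eqP; rewrite -subr_eq0 -mulrnBl mulr2n_eq0F // subr_eq0 => /eqP.
  rewrite [X in _ <= X](bigID (mem T)) /= ler_wpDr ?sumr_ge0 // => [t _|]; first exact: sqr_ge0.
  apply: ler_sum => t tT; rewrite ler_sqr ?nnegrE ?low // ?divr_ge0 ?(ltW A0) //.
  by rewrite (le_trans _ (low t tT)) // divr_ge0 ?(ltW A0).
move: h1; rewrite sumr_const -[X in X <= _]mulr_natl expr2 => h1.
have : #|A|%:R * (#|A|%:R * #|T|%:R) <= #|A|%:R * (64 * p%:R) :> R by lra.
by rewrite ler_pM2l // leNgt big.
Qed.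

Definition bohr (ts : seq F) : {set F} :=
  [set x | all (fun t => es (t * x) ^+ 2 <= 4^-1) ts].

Lemma bohr_cons t ts : bohr (t :: ts) = [set x in bohr ts | es (t * x) ^+ 2 <= 4^-1].
Proof. by apply/setP => x; rewrite !inE /= andbC. Qed.

(** Each step removes a quarter of the set, so [k] of order [log p] steps suffice. The
    gain is that a set of size [64 p / |T|] is described by only [k] frequencies. *)
Lemma greedy (T : {set F}) k : (0 < #|T|)%N -> (3 / 4) ^+ k * p%:R <= 1 :> R ->
  exists2 ts : k.-tuple F, all (mem T) ts & #|bohr ts|%:R * #|T|%:R <= 64 * p%:R :> R.
Proof.
move=> T0 hk; have p0 := p_gt0R R p_pr.
have Tp : #|T|%:R <= p%:R :> R by rewrite ler_nat; have := max_card (mem T); rewrite card_F.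
have [t0 t0T] := card_gt0P T0.
have : exists2 ts : k.-tuple F, all (mem T) ts &
   #|bohr ts|%:R * #|T|%:R <= 64 * p%:R :> R \/ #|bohr ts|%:R <= (3 / 4) ^+ k * p%:R :> R.
  elim: {hk} k => [|k [ts tsT H]].
    exists [tuple] => //; right; rewrite expr0 mul1r ler_nat.
    by have := max_card (mem (bohr [tuple])); rewrite card_F.
  have [small|/greedy_step [t tT ht]] := leP (#|bohr ts|%:R * #|T|%:R) (64 * p%:R : R).
    exists [tuple of t0 :: ts]; first by rewrite /= t0T.
    left; apply: le_trans small; rewrite ler_wpM2r // ler_nat.
    by apply: subset_leq_card; rewrite /= bohr_cons; apply/fintype.subsetP => x; rewrite inE => /andP [].
  exists [tuple of t :: ts]; first by rewrite /= tT.
  case: H => [H|H].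
    left; apply: le_trans H; rewrite ler_wpM2r // ler_nat.
    by apply: subset_leq_card; rewrite /= bohr_cons; apply/fintype.subsetP => x; rewrite inE => /andP [].
  by right; rewrite /= bohr_cons (le_trans ht) // exprS -[X in _ <= X]mulrA ler_wpM2l //; lra.
case=> ts tsT H; exists ts => //; case: H => // H.
have := le_trans H hk; move=> h1; apply: (@le_trans _ _ (1 * p%:R)).
  by apply: ler_pM => //.
by rewrite mul1r; lra.
Qed.

(** Each coordinate excluded by a frequency costs it a defect [1/4]. *)
Lemma card_exceptions (I : finType) (S : {set I}) (u : I -> F) (ts : seq F) (f : R) :
  (forall t, t \in ts -> defect R S u t <= f) ->
  #|[set i in S | u i \notin bohr ts]|%:R <= 4 * f * (size ts)%:R.
Proof.
elim: ts => [_|t ts IH H].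
  rewrite (_ : [set _ in _ | _] = finset.set0) ?cards0 ?mulr0 //.
  by apply/setP => i; rewrite !inE /= andbF.
have Ht : #|[set i in S | ~~ (es (t * u i) ^+ 2 <= 4^-1)]|%:R <= 4 * f.
  have := H t (mem_head _ _); rewrite /defect.
  have -> : #|[set i in S | ~~ (es (t * u i) ^+ 2 <= 4^-1)]|%:R =
     \sum_(i in S) (~~ (es (t * u i) ^+ 2 <= 4^-1)%R)%:R :> R.
    rewrite -natr_sum -big_mkcondr /= sum1_card; congr _%:R.
    by apply: eq_card => i; rewrite !inE.
  move=> h; apply: (@le_trans _ _ (4 * \sum_(i in S) es (t * u i) ^+ 2)); last by lra.
  rewrite mulr_sumr; apply: ler_sum => i _; have := es2_ge0 R (t * u i).
  by case: (leP (es (t * u i) ^+ 2)) => h1 h2; rewrite ?mulr1n ?mulr0n; lra.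
have {}IH := IH (fun s hs => H s (@mem_behead _ (t :: ts) s hs)).
rewrite [size _]/= -[(size ts).+1%:R]natr1 mulrDr mulr1; apply: le_trans (lerD IH Ht).
rewrite -natrD ler_nat; apply: leq_trans (leq_card_setU _ _).
apply: subset_leq_card; apply/fintype.subsetP => i.
by rewrite !inE /=; case: (i \in S) => //=; rewrite negb_and orbC.
Qed.

End Greedy.

Section Counting.
Variables (R : realType) (p : nat).
Hypothesis p_pr : prime p.
Local Notation F := 'F_p.

(** Each vector is weighted by [x ^+ e] with [e] its number of exceptional coordinates
    and [x = dl * l / p]; the weighted count factors over the coordinates. *)
Lemma card_few_exceptions (I : finType) (Lam : I -> {set F}) (d : nat) (l dl : R) :
  1 <= l -> (forall i, #|Lam i|%:R <= l) -> 0 < dl <= 1 ->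
  #|[set w : {ffun I -> F} | (#|[set i | w i \notin Lam i]| <= d)%N]|%:R <=
  (p%:R / dl) ^+ d * (l * (1 + dl)) ^+ #|I|.
Proof.
move=> l1 hL /andP [dl0 dl1]; have p0 := p_gt0R R p_pr.
have p1 : 1 <= p%:R :> R by rewrite (@ler_nat R 1) prime_gt0.
have l0 : 0 < l by lra.
have pd1 : 1 <= p%:R / dl by rewrite ler_pdivlMr // mul1r (le_trans dl1).
set W := [set w : {ffun I -> F} | _].
have [big|small] := leP (p%:R) (l * dl).
  apply: (@le_trans _ _ (p%:R ^+ #|I|)).
    by rewrite -natrX ler_nat; have := max_card (mem W); rewrite card_ffun card_F.
  apply: (@le_trans _ _ (l ^+ #|I|)).
    by rewrite lerXn2r ?nnegrE ?(ltW p0) ?(ltW l0) // (le_trans big) // ler_piMr // ltW.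
  apply: (@le_trans _ _ ((l * (1 + dl)) ^+ #|I|)).
    rewrite lerXn2r ?nnegrE ?(ltW l0) ?mulr_ge0 ?(ltW l0) //; first by lra.
    by rewrite ler_peMr ?(ltW l0) //; lra.
  by rewrite ler_peMl ?exprn_ge0 ?exprn_ege1 // mulr_ge0 ?(ltW l0) //; lra.
pose x := l * dl / p%:R.
have x0 : 0 < x by rewrite divr_gt0 ?mulr_gt0.
have x1 : x <= 1 by rewrite ler_pdivrMr // mul1r ltW.
have H : #|W|%:R * x ^+ d <= \sum_(w : {ffun I -> F}) \prod_i (if w i \in Lam i then 1 else x).
  rewrite mulr_natl -sumr_const [X in _ <= X](bigID (mem W)) /=.
  rewrite ler_wpDr ?sumr_ge0 // => [w _|].
    by apply: prodr_ge0 => i _; case: ifP; rewrite ?ltW.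
  apply: ler_sum => w; rewrite inE => hw.
  rewrite (bigID (fun i => w i \in Lam i)) /= big1 ?mul1r => [|i ->//].
  rewrite (eq_bigr (fun=> x)) => [|i /negPf -> //].
  rewrite prodr_const; apply: ler_wiXn2l; rewrite ?(ltW x0) //.
  by move: hw; rewrite cardsE.
have E : \sum_(w : {ffun I -> F}) \prod_i (if w i \in Lam i then 1 else x) <= (l * (1 + dl)) ^+ #|I|.
  rewrite -(bigA_distr_bigA (fun i (y : F) => if y \in Lam i then 1 else x)) /=.
  rewrite -prodr_const; apply: ler_prod => i _; apply/andP; split.
    by apply: sumr_ge0 => y _; case: ifP; rewrite ?ltW.
  rewrite (bigID (mem (Lam i))) /= (eq_bigr (fun=> 1)) => [|y -> //].
  rewrite sumr_const -[_ *+ _]/(#|Lam i|%:R) mulrDr mulr1 lerD ?hL //.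
  rewrite (eq_bigr (fun=> x)) => [|y /negPf -> //].
  rewrite sumr_const -[x *+ _]mulr_natl.
  apply: (@le_trans _ _ (p%:R * x)); last by rewrite /x mulrC mulfVK ?gt_eqF.
  rewrite ler_wpM2r ?(ltW x0) // ler_nat.
  by have := max_card (predC (mem (Lam i))); rewrite card_F.
have := le_trans H E; rewrite -ler_pdivlMr ?exprn_gt0 // => /le_trans; apply.
rewrite mulrC ler_wpM2r ?exprn_ge0 ?mulr_ge0 ?(ltW l0) //; first by lra.
rewrite -exprVn lerXn2r ?nnegrE ?invr_ge0 ?(ltW x0) ?divr_ge0 ?(ltW p0) ?(ltW dl0) //.
rewrite /x invf_div ler_pM2l // lef_pV2 ?posrE ?mulr_gt0 //.
by rewrite ler_peMl // ltW.
Qed.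

(** The same weighting for subsets of a finite set. *)
Lemma card_small_sets (I : finType) (e : nat) (dl : R) : 0 < dl <= 1 ->
  #|[set E : {set I} | (#|E| <= e)%N]|%:R <= dl^-1 ^+ e * (1 + dl) ^+ #|I|.
Proof.
move=> /andP [d0 d1]; set W := [set E | _].
have H : #|W|%:R * dl ^+ e <= \sum_(E : {set I}) dl ^+ #|E|.
  rewrite mulr_natl -sumr_const [X in _ <= X](bigID (mem W)) /=.
  rewrite ler_wpDr ?sumr_ge0 // => [w _|]; first by rewrite exprn_ge0 // ltW.
  apply: ler_sum => E; rewrite inE => hE.
  by apply: ler_wiXn2l; rewrite ?(ltW d0).
have E : \sum_(E : {set I}) dl ^+ #|E| = (1 + dl) ^+ #|I|.
  rewrite addrC -prodr_const bigA_distr /=; apply: eq_big => [E|E _]; first by rewrite inE.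
  by rewrite -big_mkcond prodr_const.
move: H; rewrite E -ler_pdivlMr ?exprn_gt0 // exprVn mulrC //.
Qed.

End Counting.

(** * Structured vectors are rarely almost in the kernel *)

Lemma prodr_le1 (R : numDomainType) (I : Type) (r : seq I) (P : pred I) (F : I -> R) :
  (forall i, P i -> 0 <= F i <= 1) -> \prod_(i <- r | P i) F i <= 1.
Proof.
by move=> h; have := @ler_prod R I r P F (fun=> 1) h; rewrite [X in _ <= X]big1.
Qed.

Section Rows.
Variables (R : realType) (p : nat).
Hypotheses (p_pr : prime p) (p_gt2 : (2 < p)%N).
Local Notation F := 'F_p.
Local Notation ec := (@ec R p).
Variables (K I : finType) (en : I -> I -> K) (lam : F).
Hypothesis enI : forall i j i' j', en i j = en i' j' ->
  (i = i' /\ j = j') \/ (i = j' /\ j = i').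
Local Notation X := {ffun K -> bool}.

Definition row_form (x : X) (w : {ffun I -> F}) (i : I) : F :=
  \sum_j sg p (x (en i j)) * w j - lam * w i.

Lemma rho_le1 (S : {set I}) (w : I -> F) : rho R S w <= 1.
Proof.
have p0 := p_gt0R R p_pr; rewrite /rho mulrC ler_pdivrMr // mul1r.
apply: (@le_trans _ _ (\sum_(t : F) 1)); last by rewrite sumr_const card_F.
apply: ler_sum => t _; apply: prodr_le1 => i _; rewrite normr_ge0; exact: ec_norm.
Qed.

Lemma row_form_dot (Rw : {set I}) (w t : {ffun I -> F}) (x : X) :
  \sum_i t i * (if i \in Rw then row_form x w i else 0) =
  - (lam * \sum_(i in Rw) t i * w i) +
  \sum_k (\sum_(i in Rw) \sum_j (en i j == k)%:R * (t i * w j)) * sg p (x k).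
Proof.
transitivity (\sum_(i in Rw) t i * row_form x w i).
  rewrite [RHS]big_mkcond /=; apply: eq_bigr => i _.
  by case: ifP => _; rewrite ?mulr0.
have -> : \sum_(k : K) (\sum_(i in Rw) \sum_j (en i j == k)%:R * (t i * w j)) * sg p (x k)
  = \sum_(i in Rw) \sum_j t i * w j * sg p (x (en i j)).
  under eq_bigr do rewrite mulr_suml.
  rewrite exchange_big /=; apply: eq_bigr => i _.
  under eq_bigr do rewrite mulr_suml.
  rewrite exchange_big /=; apply: eq_bigr => j _.
  rewrite (bigD1 (en i j)) //= eqxx mul1r big1 ?addr0 // => k.
  by rewrite eq_sym => /negPf ->; rewrite !mul0r.
rewrite mulr_sumr -sumrN -big_split /=; apply: eq_bigr => i _.
rewrite /row_form mulrBr addrC; congr (_ - _); last by rewrite mulrCA.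
by rewrite mulr_sumr; apply: eq_bigr => j _; rewrite [sg _ _ * _]mulrC mulrA.
Qed.

(** The entries in rows [Rw] and columns [S] occur once each, since no
    pair meets its transpose; so the characters of the event factor there, and
    all remaining entries contribute at most 1. *)
Lemma prob_rows_le (Rw S : {set I}) (w : {ffun I -> F}) : [disjoint Rw & S] ->
  mean (fun x : X => [forall i in Rw, row_form x w i == 0]%:R) <= rho R S w ^+ #|Rw|.
Proof.
move=> dRS; have p0 := p_gt0R R p_pr.
pose y x i := if i \in Rw then row_form x w i else 0.
have e x : [forall i in Rw, row_form x w i == 0]%:R =
   p%:R ^- #|I| * \sum_(t : {ffun I -> F}) ec (\sum_i t i * y x i).
  rewrite (sum_ec_dot R p_pr p_gt2) mulKf ?expf_neq0 ?gt_eqF //; congr (nat_of_bool _)%:R.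
  apply/forall_inP/forallP => [h i|h i iR]; first by rewrite /y; case: ifP => [/h //|].
  by have := h i; rewrite /y iR.
rewrite (eq_mean e) meanMl mean_sum.
have Nt (t : {ffun I -> F}) : mean (fun x : X => ec (\sum_i t i * y x i)) <=
    \prod_i (if i \in Rw then \prod_(j in S) `|ec (t i * w j)| else 1).
  pose b k := \sum_(i in Rw) \sum_j (en i j == k)%:R * (t i * w j).
  under eq_mean => x do rewrite row_form_dot.
  apply: le_trans (ler_norm _) _; rewrite (mean_ec_sg R p_pr b) normrM normr_prod.
  apply: (@le_trans _ _ (\prod_k `|ec (b k)|)).
    by rewrite ler_piMl ?prodr_ge0 // ec_norm.
  rewrite -big_mkcond /= (bigID [in [set en ij.1 ij.2 | ij in finset.setX Rw S]]) /=.
  apply: (@le_trans _ _ (\prod_(k in [set en ij.1 ij.2 | ij in finset.setX Rw S]) `|ec (b k)|)).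
    rewrite ler_piMr ?prodr_ge0 // prodr_le1 // => k _.
    by rewrite normr_ge0 ec_norm.
  rewrite big_imset /=; last first.
    move=> [i j] [i' j'] /finset.setXP /= [iR jS] /finset.setXP /= [iR' jS'].
    move=> /enI [[-> ->] //|[ij' ji']].
    by have := disjointFr dRS iR'; rewrite -ji' jS.
  rewrite (eq_bigl (fun ij => (ij.1 \in Rw) && (ij.2 \in S))) => [|[i j]]; last by rewrite finset.in_setX.
  rewrite -(pair_big_dep (mem Rw) (fun _ j => j \in S) (fun i j => `|ec (b (en i j))|)) /=.
  rewrite le_eqVlt; apply/orP; left; apply/eqP; apply: eq_bigr => i iR; apply: eq_bigr => j jS.
  congr (`|ec _|); rewrite /b (bigD1 i) //= (bigD1 j) //= eqxx mul1r.
  rewrite big1 => [|j' jj']; last first.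
    case: eqP => [/enI [[_ e1]|[e1 e2]]|]; rewrite ?mul0r //; first by rewrite e1 eqxx in jj'.
    by rewrite e2 e1 eqxx in jj'.
  rewrite big1 ?addr0 // => i' /andP [iR' ii']; rewrite big1 // => j' _.
  case: eqP => [/enI [[e1 _]|[e1 _]]|]; rewrite ?mul0r //; first by rewrite e1 eqxx in ii'.
  by have := disjointFr dRS iR'; rewrite e1 jS.
have E : \sum_(t : {ffun I -> F}) \prod_i (if i \in Rw then \prod_(j in S) `|ec (t i * w j)| else 1)
   = p%:R ^+ #|I| * rho R S w ^+ #|Rw|.
  rewrite -(bigA_distr_bigA (fun i (z : F) => if i \in Rw then \prod_(j in S) `|ec (z * w j)| else 1)).
  rewrite (eq_bigr (fun i => p%:R * (if i \in Rw then rho R S w else 1))) => [|i _].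
    rewrite big_split /= prodr_const -big_mkcond /= prodr_const //.
  case: ifP => _; last by rewrite sumr_const card_F // mulr1.
  by rewrite /rho mulrA mulfV ?mul1r // gt_eqF.
rewrite mulrC ler_pdivrMr ?exprn_gt0 // mulrC -E; apply: ler_sum => t _; exact: Nt.
Qed.

End Rows.

Lemma arith_rows (m cE E D T S e c : nat) : (E + cE = m -> D = cE - T -> T <= S ->
  S <= c -> E <= e -> m - (e + c) <= D)%N.
Proof. lia. Qed.

Lemma arith_mulL (L m x : nat) : (0 < L -> 100 * (L * x) <= m -> 100 * x <= m)%N.
Proof. by move=> L0; apply: leq_trans; rewrite leq_mul2l leq_pmull // orbT. Qed.

Lemma arith_es (m e s k q : nat) : (100 * (e + s) <= m -> 100 * (k * q + 2) <= m ->
  100 * (e + 1) <= 2 * m /\ e + 1 <= m)%N.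
Proof. lia. Qed.

Section Structure.
Variables (R : realType) (p : nat).
Hypotheses (p_pr : prime p) (p_gt2 : (2 < p)%N).
Local Notation F := 'F_p.
Local Notation ec := (@ec R p).
Local Notation es := (@es R p).
Variables (K I : finType) (en : I -> I -> K) (lam : F).
Hypothesis enI : forall i j i' j', en i j = en i' j' ->
  (i = i' /\ j = j') \/ (i = j' /\ j = i').
Local Notation X := {ffun K -> bool}.
Local Notation row_form := (row_form en lam).
Local Notation m := #|I|.

(* Roles of the parameters: [L] bounds [ln p]; [col] cuts the coordinates into [q]
   blocks of size at most [s]; [e] rows are allowed to fail; [d] bounds the number of
   coordinates outside the sets that confine a vector; [k] frequencies are chosen in
   each block; [r] and [4 ^ a * r] are the two levels in the bound on [rho]; [be] and
   [b] describe the arc; [expR (- ka)] is the threshold for a large Fourier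
   coefficient. *)
Variables (L q s e d k a b : nat) (r be ka : R) (col : I -> 'I_q).
Local Notation f := (4 ^+ a * r).
Local Notation g0 := ((2 / 3 : R) ^+ a + expR (- (r / 2))).
Local Notation dl := (100^-1 : R).

Hypothesis pL : p%:R <= expR L%:R :> R.
Hypothesis L1 : (0 < L)%N.
Hypothesis r0 : 0 <= r.
Hypothesis col_le : forall j, (#|[set i | col i == j]| <= s)%N.
Hypothesis g0_le : g0 <= 768^-1.
Hypothesis pf_le : p%:R * expR (- (f / 2)) <= 4^-1.
Hypothesis be_le : 4 ^+ b * be < 1 / 2.
Hypothesis be_gt0 : 0 < be.
Hypothesis b_le : (2 / 3) ^+ b <= 25^-1 :> R.
Hypothesis k_le : (3 / 4) ^+ k * p%:R <= 1 :> R.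
Hypothesis dA : e%:R + 2 * ka / be <= d%:R.
Hypothesis dB : e%:R + 4 * f * k%:R * q%:R <= d%:R.
Hypothesis dC : e%:R + 2 * f * q%:R <= d%:R.
Hypothesis d_le : (800 * (L * d) <= m)%N.
Hypothesis es_le : (100 * (L * (e + s)) <= m)%N.
Hypothesis kq_le : (100 * (L * (k * q + 2)) <= m)%N.

Definition kernel_off (x : X) (E : {set I}) (w : {ffun I -> F}) : bool :=
  [forall i in ~: E, row_form x w i == 0].

(** These are the vectors whose product with a fresh random row may fail to be
    equidistributed. *)
Definition structured (E : {set I}) (w : {ffun I -> F}) : bool :=
  expR (- ka) <= \prod_(i in ~: E) `|ec (w i)|.

Definition bad (x : X) : bool :=
  [exists E : {set I}, (#|E| <= e)%N &&
     [exists w : {ffun I -> F}, [&& w != 0, structured E w & kernel_off x E w]]].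

Section FixedE.
Variable E : {set I}.
Hypothesis Ee : (#|E| <= e)%N.

Definition blk (j : 'I_q) : {set I} := [set i in ~: E | col i == j].
Definition lev (w : {ffun I -> F}) (j : 'I_q) : {set F} := lvl (blk j) w f.
Definition prob_off (w : {ffun I -> F}) : R := mean (fun x => (kernel_off x E w)%:R).

Lemma prob_off_ge0 w : 0 <= prob_off w.
Proof. by apply: mean_ge0. Qed.

Lemma prob_off_le (S : {set I}) (w : {ffun I -> F}) (c : nat) (rh : R) :
  (#|S| <= c)%N -> rho R S w <= rh -> rh <= 1 -> prob_off w <= rh ^+ (m - (e + c)).
Proof.
move=> Sc Srh rh1.
apply: (@le_trans _ _ (mean (fun x => [forall i in ~: E :\: S, row_form x w i == 0]%:R))).
  apply: ler_mean => x; rewrite ler_nat /kernel_off.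
  case: forall_inP => // H; case: forall_inP => // H2; case: H2 => i.
  by rewrite inE => /andP [_ /H].
have dis : [disjoint ~: E :\: S & S].
  by rewrite -setI_eq0 -finset.subset0; apply/fintype.subsetP => i; rewrite !inE => /andP [/andP [/negPf ->]].
apply: le_trans (prob_rows_le R p_pr p_gt2 lam enI w dis) _.
have rr := rho_ge0 R S w.
apply: (@le_trans _ _ (rho R S w ^+ (m - (e + c)))).
  apply: ler_wiXn2l; rewrite ?rho_le1 //.
  exact: (arith_rows (cardsC E) (cardsD (~: E) S) (subset_leq_card (finset.subsetIr (~: E) S))).
by rewrite lerXn2r ?nnegrE // (le_trans rr).
Qed.

Lemma pow_p_le c : p%:R ^+ c <= expR (L * c)%:R :> R.
Proof.
by rewrite natrM expRM_natr lerXn2r ?nnegrE ?expR_ge0.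
Qed.

Lemma pow_pdl_le c : (p%:R / dl) ^+ c <= expR (8 * (L * c))%:R.
Proof.
have -> : (8 * (L * c) = (8 * L) * c)%N by rewrite mulnA.
rewrite natrM expRM_natr lerXn2r ?nnegrE ?expR_ge0 ?divr_ge0 ?invr_ge0 //.
have -> : (8 * L)%:R = L%:R + (7 * L)%:R :> R by rewrite -natrD -mulSn.
rewrite expRD; apply: ler_pM => //; rewrite ?invr_ge0 ?invrK //.
apply: (@le_trans _ _ (expR 7%:R)); last by rewrite ler_expR ler_nat leq_pmulr.
have h : 2 <= expR 1 :> R by have := expR_ge1Dx (1 : R); lra.
rewrite -[7%:R]mul1r expRM_natr; apply: (@le_trans _ _ (2 ^+ 7)); first by rewrite -natrX ler_nat.
by rewrite lerXn2r ?nnegrE ?expR_ge0.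
Qed.

Lemma pow_dl_le : (1 + dl) ^+ m <= expR (m%:R / 100).
Proof.
rewrite mulrC expRM_natr lerXn2r ?nnegrE ?expR_ge0 //.
exact: expR_ge1Dx.
Qed.

Let m0R : 0 <= (m%:R : R). Proof. exact: ler0n. Qed.
Let d_leR : 800 * (L * d)%:R <= m%:R :> R.
Proof. by rewrite -natrM ler_nat. Qed.
Let es_leR : 100 * (L * (e + s))%:R <= m%:R :> R.
Proof. by rewrite -natrM ler_nat. Qed.
Let kq_leR : 100 * (L * (k * q + 2))%:R <= m%:R :> R.
Proof. by rewrite -natrM ler_nat. Qed.
Let es_m : (e + s <= m)%N.
Proof. by apply: leq_trans (arith_mulL L1 es_le); rewrite leq_pmull. Qed.

Lemma few_exceptions_le (Lam : I -> {set F}) (l : R) (W : {set {ffun I -> F}}) :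
  1 <= l -> (forall i, #|Lam i|%:R <= l) ->
  (forall w, w \in W -> (#|[set i | w i \notin Lam i]| <= d)%N) ->
  #|W|%:R <= expR (m%:R / 50) * l ^+ m.
Proof.
move=> l1 hl hW.
have dl01 : 0 < dl <= 1 by apply/andP; split; lra.
apply: le_trans (_ : _ <= #|[set w : {ffun I -> F} | (#|[set i | w i \notin Lam i]| <= d)%N]|%:R) _.
  by rewrite ler_nat; apply: subset_leq_card; apply/fintype.subsetP => w wW; rewrite inE hW.
apply: le_trans (card_few_exceptions p_pr d l1 hl dl01) _.
rewrite [(l * _) ^+ m]exprMn mulrCA [X in _ <= X]mulrC ler_wpM2l ?exprn_ge0 //; first by lra.
apply: (@le_trans _ _ (expR (8 * (L * d))%:R * expR (m%:R / 100))).
  by rewrite ler_pM ?pow_pdl_le ?pow_dl_le ?exprn_ge0 ?divr_ge0 ?invr_ge0 //; lra.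
rewrite -expRD ler_expR natrM; move: d_leR; lra.
Qed.

(** If every level set is everything, all blocks have small support. There are so few
    such vectors that the bound [3/4] per row, from a single nonzero coordinate,
    suffices. *)
Lemma case_sparse (W : {set {ffun I -> F}}) :
  (forall w, w \in W -> w != 0 /\ forall j, lev w j = [set: F]) ->
  \sum_(w in W) prob_off w <= expR (- (m%:R / 5)).
Proof.
move=> hW; have cW : #|W|%:R <= expR (m%:R / 50) * 1 ^+ m :> R.
  apply: (@few_exceptions_le (fun=> [set 0]) 1 W) => // [i|w wW]; first by rewrite cards1.
  have [_ wT] := hW w wW.
  rewrite -(ler_nat R); apply: le_trans dC.
  apply: (@le_trans _ _ (#|E|%:R + \sum_(j < q) #|[set i in blk j | w i != 0]|%:R)).
    rewrite -natr_sum -natrD ler_nat.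
    apply: (@leq_trans #|E :|: \bigcup_j [set i in blk j | w i != 0]|).
      apply: subset_leq_card; apply/fintype.subsetP => i; rewrite !inE => wi.
      have [//|iE /=] := boolP (i \in E); apply/bigcupP; exists (col i) => //.
      by rewrite !inE iE eqxx wi.
    apply: leq_trans (leq_card_setU _ _) _; rewrite leq_add2l.
    elim/big_ind2: _ => [|m1 n1 m2 n2 h1 h2|//]; first by rewrite cards0.
    exact: leq_trans (leq_card_setU _ _) (leq_add h1 h2).
  rewrite lerD ?ler_nat //; apply: (@le_trans _ _ (\sum_(j < q) (2 * f))).
    by apply: ler_sum => j _; have := (lvlT_supp p_pr p_gt2 (wT j)).
  by rewrite sumr_const card_ord mulr_natr.
have hp w : w \in W -> prob_off w <= (3 / 4) ^+ (m - (e + 1)).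
  move=> /hW [w0 _]; have [i0 wi0] : exists i0, w i0 != 0.
    apply/existsP; rewrite -negb_forall; apply: contra w0 => /forallP h.
    by apply/eqP/ffunP => i; rewrite ffunE; apply/eqP; exact: h.
  apply: (@prob_off_le [set i0]); rewrite ?cards1 //; last by lra.
  exact: rho_single.
apply: (@le_trans _ _ (#|W|%:R * (3 / 4) ^+ (m - (e + 1)))).
  by rewrite mulr_natl -sumr_const; apply: ler_sum.
apply: (@le_trans _ _ (expR (m%:R / 50) * expR (- ((m - (e + 1))%:R / 4)))).
  rewrite ler_pM ?exprn_ge0 //; [by move: cW; rewrite expr1n mulr1|].
  rewrite -mulrN expRM_natl lerXn2r ?nnegrE ?expR_ge0 //.
  by have := expR_ge1Dx (- 4^-1 : R); lra.
have [e1 e2] := arith_es (arith_mulL L1 es_le) (arith_mulL L1 kq_le).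
rewrite -expRD ler_expR natrB // natrD; move: e1; rewrite -(ler_nat R) !natrM natrD; move: m0R; lra.
Qed.

(** Giving up [e + s] rows costs at most a factor [p ^ (e + s)]. *)
Lemma split_power (y : R) : p%:R^-1 <= y ->
  y ^+ (m - (e + s)) <= y ^+ m * expR (m%:R / 100).
Proof.
move=> py; have p0 := p_gt0R R p_pr.
have y0 : 0 < y by rewrite (lt_le_trans _ py) ?invr_gt0.
rewrite -{2}(subnK es_m) exprD -mulrA ler_peMr ?exprn_ge0 ?(ltW y0) //.
apply: (@le_trans _ _ ((y * p%:R) ^+ (e + s))).
  by rewrite exprn_ege1 // -ler_pdivrMr // mul1r.
rewrite exprMn ler_wpM2l ?exprn_ge0 ?(ltW y0) //; apply: le_trans (pow_p_le _) _.
rewrite ler_expR; move: es_leR; lra.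
Qed.

Lemma rho_blk w j : lev w j != [set: F] ->
  rho R (blk j) w <= (5 / 4 + 768^-1 * #|lev w j|%:R) / p%:R.
Proof.
move=> jT; have p0 := p_gt0R R p_pr.
have H := rho_le p_pr p_gt2 jT.
rewrite ler_pdivlMr // mulrC; apply: (le_trans H).
have : g0 * #|lev w j|%:R <= 768^-1 * #|lev w j|%:R by rewrite ler_wpM2r.
by rewrite -/(lev w j); move: pf_le; lra.
Qed.

Lemma card_blk j : (#|blk j| <= s)%N.
Proof.
apply: leq_trans (col_le j); apply: subset_leq_card.
by apply/fintype.subsetP => i; rewrite !inE => /andP [].
Qed.

(** A block with a bounded level set makes each row hold with probability at most
    [3/2 / p], but nearly all vectors have such a block. Those with a large Fourier
    coefficient have nearly all their coordinates in short arcs, around 0 and [p / 2],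
    of total size about [p / 25], which beats [3/2]. *)
Lemma case_box (W : {set {ffun I -> F}}) :
  (forall w, w \in W -> structured E w /\
     exists2 j, lev w j != [set: F] & #|lev w j|%:R <= 192 :> R) ->
  \sum_(w in W) prob_off w <= expR (- (m%:R / 5)).
Proof.
move=> hW; have p0 := p_gt0R R p_pr.
have p3 : 3 <= p%:R :> R by rewrite (ler_nat R 3).
have cW : #|W|%:R <= expR (m%:R / 50) * (1 + 25^-1 * p%:R) ^+ m :> R.
  apply: (@few_exceptions_le (fun=> bohr1 p be) _ W) => [|i|w wW]; first by lra.
    apply: le_trans (card_bohr1 p_pr p_gt2 be_le) _.
    by rewrite lerD2l ler_wpM2r.
  have [st _] := hW w wW.
  rewrite -(ler_nat R); apply: le_trans dA.
  have h1 : \sum_(i in ~: E) es (w i) ^+ 2 <= 2 * ka.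
    have : expR (- ka) <= expR (- (\sum_(i in ~: E) es (w i) ^+ 2 / 2)).
      apply: le_trans st _; rewrite -sumrN expR_sum; apply: ler_prod => i _.
      by rewrite normr_ge0 ec_le_exp.
    by rewrite ler_expR -mulr_suml => h; lra.
  have h2 : #|[set i in ~: E | w i \notin bohr1 p be]|%:R * be <= 2 * ka.
    apply: le_trans h1; rewrite mulr_natl -sumr_const.
    rewrite [X in _ <= X](bigID (fun i => w i \notin bohr1 p be)) /=.
    rewrite (eq_bigl (fun i => (i \in ~: E) && (w i \notin bohr1 p be))) => [|i]; last by rewrite inE.
    rewrite ler_wpDr ?sumr_ge0 // => [i _|]; first exact: es2_ge0.
    by apply: ler_sum => i /andP [_]; rewrite inE -ltNge => /ltW.
  move: h2; rewrite -ler_pdivlMr // => h2.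
  apply: le_trans (_ : #|E|%:R + #|[set i in ~: E | w i \notin bohr1 p be]|%:R <= _); last first.
    by rewrite lerD ?ler_nat.
  rewrite -natrD ler_nat; apply: leq_trans (leq_card_setU _ _); apply: subset_leq_card.
  by apply/fintype.subsetP => i; rewrite !inE; case: (i \in E).
have hp w : w \in W -> prob_off w <= (3 / 2 / p%:R) ^+ (m - (e + s)).
  move=> /hW [_ [j jT jN]]; apply: prob_off_le (card_blk j) _ _.
    apply: le_trans (rho_blk jT) _; rewrite ler_wpM2r ?invr_ge0 ?(ltW p0) //; lra.
  by rewrite ler_pdivrMr //; lra.
apply: (@le_trans _ _ (#|W|%:R * (3 / 2 / p%:R) ^+ (m - (e + s)))).
  by rewrite mulr_natl -sumr_const; apply: ler_sum.
have h3 : p%:R^-1 <= 3 / 2 / p%:R :> R.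
  by rewrite ler_peMl ?invr_ge0 ?(ltW p0) //; lra.
have y0 : 0 <= 3 / 2 / p%:R :> R by rewrite divr_ge0 ?(ltW p0) //; lra.
have z0 : 0 <= 1 + 25^-1 * p%:R :> R by lra.
apply: le_trans (ler_pM (ler0n _ _) (exprn_ge0 _ y0) cW (split_power h3)) _.
have -> : forall u v x y : R, (u * v) * (x * y) = u * y * (v * x) by move=> *; ring.
rewrite -exprMn -expRD.
apply: (@le_trans _ _ (expR (m%:R / 50 + m%:R / 100) * expR (m%:R * - (2 / 5)))).
  rewrite ler_wpM2l ?expR_ge0 // expRM_natl lerXn2r ?nnegrE ?expR_ge0 ?(mulr_ge0 z0 y0) //.
  apply: le_trans (expR_ge1Dx _).
  have -> : (1 + 25^-1 * p%:R) * (3 / 2 / p%:R) = 3 / 2 * (p%:R^-1 + 25^-1) :> R.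
    by field; rewrite gt_eqF.
  have : p%:R^-1 <= 3^-1 :> R by rewrite lef_pV2 ?posrE //; lra.
  lra.
rewrite -expRD ler_expR; move: m0R; lra.
Qed.

(** Let [N > 192] be the least size of a level set. A row holds with probability at
    most [y = 6 / 768 * N / p], while the frequencies chosen by [greedy] confine each
    coordinate to at most [l = 64 * p / N] values. Since [l * y = 1/2], each coordinate
    gains a constant factor, which pays for the [p ^ (k * q)] choices of
    frequencies. *)
Lemma case_concentrated (W : {set {ffun I -> F}}) :
  (forall w, w \in W -> exists j, [/\ lev w j != [set: F], 192 < #|lev w j|%:R :> R &
     forall j', (#|lev w j| <= #|lev w j'|)%N]) ->
  \sum_(w in W) prob_off w <= expR (- (m%:R / 5)).
Proof.
move=> hW; have p0 := p_gt0R R p_pr.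
have p1 : 1 <= p%:R :> R by rewrite (ler_nat R 1) prime_gt0.
pose WN (N : nat) := [set w in W | [exists j, [&& lev w j != [set: F], 192 < #|lev w j|%:R :> R,
   #|lev w j| == N & [forall j', (#|lev w j| <= #|lev w j'|)%N]]]].
have sumN : \sum_(w in W) prob_off w <= \sum_(N < p.+1) \sum_(w in WN N) prob_off w.
  rewrite (eq_bigr (fun N : 'I_p.+1 => \sum_(w in W) (w \in WN N)%:R * prob_off w)) => [|N _]; last first.
    rewrite big_mkcond [RHS]big_mkcond /=; apply: eq_bigr => w _.
    by rewrite inE; case: (w \in W) => //=; case: ifP => _; rewrite ?mul1r ?mul0r.
  rewrite exchange_big /=; apply: ler_sum => w wW; have [j [j1 j2 j3]] := hW w wW.
  have jp : (#|lev w j| < p.+1)%N by rewrite ltnS; have := max_card (mem (lev w j)); rewrite card_F.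
  rewrite (bigD1 (Ordinal jp)) //= ler_wpDr ?sumr_ge0 // => [N _|].
    by rewrite mulr_ge0 ?prob_off_ge0.
  rewrite (_ : w \in _) ?mul1r //; rewrite inE wW; apply/existsP; exists j.
  by rewrite j1 j2 eqxx; apply/forallP.
apply: le_trans sumN _.
have hN (N : nat) : (N <= p)%N -> \sum_(w in WN N) prob_off w <=
    p%:R ^+ (k * q) * expR (m%:R / 50) * expR (m%:R / 100) * (2^-1) ^+ m.
  move=> Np; have [NS|NS] := leP (N%:R : R) 192.
    rewrite big1 ?mulr_ge0 ?exprn_ge0 ?expR_ge0 ?invr_ge0 // => w; rewrite inE => /andP [_].
    case/existsP => j /and4P [_ h /eqP h2 _]; move: h; rewrite h2; lra.
  have N0 : 0 < N%:R :> R by lra.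
  have Npl : N%:R <= p%:R :> R by rewrite ler_nat.
  (* [5 / 4 + N / 768 <= 6 * N / 768] because [N > 192]. *)
  pose y : R := 768^-1 * 6 * N%:R / p%:R.
  have hp w : w \in WN N -> prob_off w <= y ^+ (m - (e + s)).
    rewrite inE => /andP [_ /existsP [j /and4P [jT _ /eqP jN _]]].
    apply: prob_off_le (card_blk j) _ _.
      apply: le_trans (rho_blk jT) _; rewrite jN ler_wpM2r ?invr_ge0 ?(ltW p0) //; lra.
    by rewrite ler_pdivrMr //; lra.
  have py : p%:R^-1 <= y.
    by rewrite /y ler_peMl ?invr_ge0 ?(ltW p0) //; lra.
  have y0 : 0 <= y by rewrite (le_trans _ py) // invr_ge0 ltW.
  pose l : R := 64 * p%:R / N%:R.
  have l1 : 1 <= l by rewrite ler_pdivlMr // mul1r; lra.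
  pose cod := {ffun 'I_q -> k.-tuple F}.
  pose Wc (c : cod) := [set w in WN N | [forall j, all (mem (lev w j)) (c j) &&
     (#|bohr R (c j)|%:R * N%:R <= 64 * p%:R :> R)]].
  have cWc c : #|Wc c|%:R <= expR (m%:R / 50) * l ^+ m.
    have [->|[w0 w0W]] := set_0Vmem (Wc c).
      by rewrite cards0 mulr_ge0 ?expR_ge0 // exprn_ge0 // (le_trans _ l1).
    apply: (@few_exceptions_le (fun i => bohr R (c (col i))) l (Wc c)) => // [i|w].
      move: w0W; rewrite inE => /andP [_ /forallP /(_ (col i)) /andP [_]].
      by rewrite ler_pdivlMr.
    rewrite inE => /andP [_ /forallP hc].
    rewrite -(ler_nat R); apply: le_trans dB.
    apply: (@le_trans _ _ (#|E|%:R + \sum_(j < q) #|[set i in blk j | w i \notin bohr R (c j)]|%:R)).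
      rewrite -natr_sum -natrD ler_nat.
      apply: (@leq_trans #|E :|: \bigcup_j [set i in blk j | w i \notin bohr R (c j)]|).
        apply: subset_leq_card; apply/fintype.subsetP => i; rewrite inE => wi.
        rewrite inE; have [//|iE /=] := boolP (i \in E); apply/bigcupP; exists (col i) => //.
        by rewrite inE wi !inE iE eqxx.
      apply: leq_trans (leq_card_setU _ _) _; rewrite leq_add2l.
      elim/big_ind2: _ => [|m1 n1 m2 n2 h1 h2|//]; first by rewrite cards0.
      exact: leq_trans (leq_card_setU _ _) (leq_add h1 h2).
    rewrite lerD ?ler_nat //; apply: (@le_trans _ _ (\sum_(j < q) (4 * f * k%:R))).
      apply: ler_sum => j _; have /andP [/allP hj _] := hc j.
      have H : #|[set i in blk j | w i \notin bohr R (c j)]|%:R <= 4 * f * (size (c j))%:R.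
        by apply: card_exceptions => t /hj; rewrite /= in_lvl.
      by move: H; rewrite size_tuple.
    by rewrite sumr_const card_ord -[X in X <= _]mulr_natr.
  have cov : \sum_(w in WN N) prob_off w <= \sum_(c : cod) \sum_(w in Wc c) prob_off w.
    rewrite [X in _ <= X](eq_bigr (fun c : cod => \sum_(w in WN N) (w \in Wc c)%:R * prob_off w)) => [|c _]; last first.
      rewrite big_mkcond [RHS]big_mkcond /=; apply: eq_bigr => w _.
      by rewrite [w \in Wc c]inE; case: (w \in WN N) => //=; case: ifP => _; rewrite ?mul1r ?mul0r.
    rewrite exchange_big /=; apply: ler_sum => w wW.
    have ex j : exists ts : k.-tuple F, all (mem (lev w j)) ts &&
        (#|bohr R ts|%:R * N%:R <= 64 * p%:R :> R).
      have [||ts h1 h2] := @greedy R p p_pr p_gt2 (lev w j) k.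
      + by apply: lvl_neq0; rewrite mulr_ge0 ?exprn_ge0.
      + exact: k_le.
      exists ts; rewrite h1 /=; apply: le_trans h2; rewrite ler_wpM2l // ler_nat.
      by move: wW; rewrite inE => /andP [_ /existsP [j' /and4P [_ _ /eqP <- /forallP]]].
    pose c0 : cod := [ffun j => xchoose (ex j)].
    rewrite (bigD1 c0) //= ler_wpDr ?sumr_ge0 // => [c _|].
      by rewrite mulr_ge0 ?prob_off_ge0.
    rewrite (_ : w \in _) ?mul1r //; rewrite inE wW; apply/forallP => j.
    by rewrite ffunE; exact: (xchooseP (ex j)).
  apply: le_trans cov _.
  apply: (@le_trans _ _ (\sum_(c : cod) (expR (m%:R / 50) * l ^+ m) * (y ^+ m * expR (m%:R / 100)))).
    apply: ler_sum => c _.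
    apply: (@le_trans _ _ (#|Wc c|%:R * y ^+ (m - (e + s)))).
      rewrite mulr_natl -sumr_const; apply: ler_sum => w; rewrite inE => /andP [wW _]; exact: hp.
    by rewrite ler_pM ?exprn_ge0 ?split_power.
  rewrite sumr_const card_ffun card_tuple card_F // card_ord -expnM -[_ *+ _]mulr_natl natrX.
  have -> : forall u v x y z : R, u * ((v * x) * (y * z)) = u * v * z * (x * y) by move=> *; ring.
  rewrite -exprMn ler_wpM2l ?mulr_ge0 ?exprn_ge0 ?expR_ge0 ?invr_ge0 //.
  have l0 : 0 <= l by rewrite (le_trans _ l1).
  rewrite lerXn2r ?nnegrE ?(mulr_ge0 l0 y0) ?invr_ge0 //.
  have -> : l * y = 768^-1 * 6 * 64 :> R.
    by rewrite /l /y; field; rewrite !gt_eqF.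
  lra.
apply: (@le_trans _ _ (\sum_(N < p.+1) p%:R ^+ (k * q) * expR (m%:R / 50) * expR (m%:R / 100) * (2^-1) ^+ m)).
  by apply: ler_sum => N _; apply: hN; rewrite -ltnS.
rewrite sumr_const card_ord -[_ *+ _]mulr_natl.
apply: (@le_trans _ _ (p%:R ^+ 2 * (p%:R ^+ (k * q) * expR (m%:R / 50) * expR (m%:R / 100) * (2^-1) ^+ m))).
  rewrite ler_wpM2r ?mulr_ge0 ?exprn_ge0 ?expR_ge0 ?invr_ge0 // -natrX ler_nat.
  by rewrite -mulnn; apply: leq_trans (_ : p * 2 <= _)%N; rewrite ?leq_mul2l ?(ltnW p_gt2) ?orbT // muln2 -addnn -addn1 leq_add2l prime_gt0.
rewrite !mulrA -exprD addnC.
apply: (@le_trans _ _ (expR (L * (k * q + 2))%:R * expR (m%:R / 50) * expR (m%:R / 100) * expR (m%:R * - 2^-1))).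
  rewrite ler_pM ?mulr_ge0 ?exprn_ge0 ?expR_ge0 ?invr_ge0 //.
    by rewrite ler_wpM2r ?expR_ge0 // ler_wpM2r ?expR_ge0 // pow_p_le.
  rewrite expRM_natl lerXn2r ?nnegrE ?expR_ge0 ?invr_ge0 //.
  by have := expR_ge1Dx (- 2^-1 : R); lra.
rewrite -!expRD ler_expR; move: kq_leR m0R; lra.
Qed.

(** A vector falls into one of the three cases according to the block whose level set
    is smallest. *)
Lemma bad_prob_off :
  mean (fun x => [exists w : {ffun I -> F}, [&& w != 0, structured E w & kernel_off x E w]]%:R)
  <= 3 * expR (- (m%:R / 5)) :> R.
Proof.
pose W := [set w : {ffun I -> F} | (w != 0) && structured E w].
pose W1 := [set w in W | [forall j, lev w j == [set: F]]].
pose W2 := [set w in W | [exists j, (lev w j != [set: F]) && (#|lev w j|%:R <= 192 :> R)]].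
pose W3 := [set w in W | [exists j, [&& lev w j != [set: F], 192 < #|lev w j|%:R :> R &
     [forall j', (#|lev w j| <= #|lev w j'|)%N]]]].
have cov w : w \in W -> [|| w \in W1, w \in W2 | w \in W3].
  move=> wW; rewrite [w \in W1]inE [w \in W2]inE [w \in W3]inE wW /=.
  case: (boolP [forall j, lev w j == [set: F]]) => [//|]; rewrite negb_forall => /existsP [j0 hj0] /=.
  case: (arg_minnP (fun j => #|lev w j|) (isT : xpredT j0)) => j _ jmin.
  have jT : lev w j != [set: F].
    apply: contra hj0 => /eqP h; rewrite finset.eqEcard finset.subsetT /=.
    by rewrite -h; exact: jmin.
  have [h|h] := leP (#|lev w j|%:R : R) 192.
    by apply/orP; left; apply/existsP; exists j; rewrite jT h.
  apply/orP; right; apply/existsP; exists j; rewrite jT h /=.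
  by apply/forallP => j'; exact: jmin.
have le3 : \sum_(w in W) prob_off w <= \sum_(w in W1) prob_off w + \sum_(w in W2) prob_off w + \sum_(w in W3) prob_off w.
  rewrite [X in X <= _]big_mkcond [X in _ <= X + _ + _]big_mkcond [X in _ <= _ + X + _]big_mkcond.
  rewrite [X in _ <= _ + X]big_mkcond -!big_split /=; apply: ler_sum => w _.
  have := prob_off_ge0 w; case: ifP => [/cov|_]; last by do 3!case: ifP => _; lra.
  by case: (w \in W1) (w \in W2) (w \in W3) => [] [] [] //= _; lra.
apply: (@le_trans _ _ (\sum_(w in W) prob_off w)).
  rewrite /prob_off -mean_sum; apply: ler_mean => x.
  case: existsP => [[w /and3P [w0 sw kw]]|_]; last by rewrite sumr_ge0.
  have wW : w \in W by rewrite inE w0 sw.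
  by rewrite (bigD1 w) //= kw ler_wpDr ?sumr_ge0.
apply: le_trans le3 _.
have c1 : \sum_(w in W1) prob_off w <= expR (- (m%:R / 5)).
  apply: case_sparse => w; rewrite !inE => /andP [/andP [w0 _] /forallP h].
  by split=> // j; apply/eqP.
have c2 : \sum_(w in W2) prob_off w <= expR (- (m%:R / 5)).
  apply: case_box => w; rewrite !inE => /andP [/andP [_ sw] /existsP [j /andP [h1 h2]]].
  by split=> //; exists j.
have c3 : \sum_(w in W3) prob_off w <= expR (- (m%:R / 5)).
  apply: case_concentrated => w; rewrite !inE => /andP [_ /existsP [j /and3P [h1 h2 /forallP h3]]].
  by exists j.
lra.
Qed.

End FixedE.

(** The number of sets [E] of at most [e] rows is a small exponential in [m], by the
    choice of [e], so the union over them loses only half of the exponent. *)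
Lemma bad_prob : mean (fun x => (bad x)%:R) <= 3 * expR (- (m%:R / 10)) :> R.
Proof.
pose EE := [set E : {set I} | (#|E| <= e)%N].
apply: (@le_trans _ _ (\sum_(E in EE) mean (fun x =>
    ([exists w : {ffun I -> F}, [&& w != 0, structured E w & kernel_off x E w]]%:R : R)))).
  rewrite -mean_sum; apply: ler_mean => x; rewrite /bad.
  case: existsP => [[E /andP [Ee h]]|_]; last by rewrite sumr_ge0.
  have EI : E \in EE by rewrite inE.
  by rewrite (bigD1 E) //= h ler_wpDr ?sumr_ge0.
apply: (@le_trans _ _ (\sum_(E in EE) 3 * expR (- (m%:R / 5)))).
  by apply: ler_sum => E; rewrite inE => Ee; exact: bad_prob_off.
have dl01 : 0 < dl <= 1 by apply/andP; split; lra.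
rewrite sumr_const -[_ *+ _]mulr_natl mulrCA ler_wpM2l //.
apply: (@le_trans _ _ ((expR (8 * (L * e))%:R * expR (m%:R / 100)) * expR (- (m%:R / 5)))).
  rewrite ler_wpM2r ?expR_ge0 //; apply: le_trans (card_small_sets I e dl01) _.
  rewrite ler_pM ?exprn_ge0 ?pow_dl_le //.
  apply: le_trans (pow_pdl_le e).
  rewrite lerXn2r ?nnegrE ?divr_ge0 ?invr_ge0 ?invr_ge0 //.
  by rewrite ler_peMl ?invr_ge0 // (ler_nat R 1) prime_gt0.
rewrite -!expRD ler_expR.
have : (100 * (8 * (L * e)) <= 8 * m)%N.
  by rewrite mulnCA leq_mul2l /=; apply: leq_trans es_le; rewrite !leq_mul2l leq_addr !orbT.
by rewrite -(ler_nat R) !natrM; move: (ler0n R m); lra.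
Qed.

End Structure.

(** * Bordered symmetric matrices *)

Section Bordering.
Variables (F : fieldType) (m : nat) (A : 'M[F]_m).
Hypothesis symA : A^T = A.

Local Notation r := (\rank A).
Local Notation f := (maxrankfun A).
Let Q : 'M[F]_(r, m) := rowsub f 1%:M.

(** A generalized inverse of [A] supported on a nonsingular principal submatrix of
    full rank; supporting it there keeps [A *m ginv] close to the identity
    coordinatewise. *)
Definition ginv : 'M[F]_m := Q^T *m invmx (Q *m A *m Q^T) *m Q.

Let QQ : Q *m Q^T = 1%:M.
Proof.
apply/matrixP => i j; rewrite !mxE (bigD1 (f i)) //= !mxE eqxx mul1r big1 ?addr0.
  by rewrite (inj_eq (@maxrankfun_inj _ _ _ A)) eq_sym.
by move=> l; rewrite !mxE eq_sym => /negPf ->; rewrite mul0r.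
Qed.

Let factor : exists C : 'M[F]_(m, r), A = C *m (Q *m A).
Proof.
have : (A <= rowsub f A)%MS by rewrite eq_maxrowsub.
by move=> /submxP [C hC]; exists C; rewrite /Q -rowsubE.
Qed.

Let inner_unit : Q *m A *m Q^T \in unitmx.
Proof.
have [C AC] := factor.
have fr : row_free (Q *m A) by rewrite /Q -rowsubE maxrowsub_free.
rewrite -row_free_unit -row_leq_rank.
have {1}<- : \rank (Q *m A) = r by apply/eqP.
have h : Q *m A = (Q *m A *m Q^T) *m C^T.
  by rewrite -!mulmxA -trmx_mul; congr (_ *m _); rewrite -{1}symA {1}AC !trmx_mul symA !mulmxA.
by have := mxrankM_maxl (Q *m A *m Q^T) C^T; rewrite -h.
Qed.

Lemma ginv_sym : ginv^T = ginv.
Proof.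
by rewrite /ginv !trmx_mul trmxK trmx_inv !trmx_mul trmxK symA !mulmxA.
Qed.

Lemma ginvK : A *m ginv *m A = A.
Proof.
have [C AC] := factor.
have AC' : A = A *m Q^T *m C^T by rewrite -{1}symA {1}AC !trmx_mul symA.
set U := Q *m A *m Q^T.
have e1 : A *m Q^T = C *m U by rewrite /U mulmxA; exact: (congr1 (mulmx^~ Q^T) AC).
have e2 : Q *m A = U *m C^T by rewrite /U -!mulmxA (mulmxA A); exact: (congr1 (mulmx Q) AC').
rewrite /ginv -/U !mulmxA e1 -!mulmxA e2 (mulmxA (invmx U)) mulVmx // mul1mx.
by rewrite (mulmxA A) -AC' -AC.
Qed.

Definition ginv_support : {set 'I_m} := [set f i | i in 'I_r].

Lemma card_ginv_support : #|ginv_support| = r.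
Proof. by rewrite card_imset ?card_ord //; exact: maxrankfun_inj. Qed.

Lemma ginv_solve (z : 'rV[F]_m) i : (forall j, j \notin ginv_support -> z 0 j = 0) ->
  i \in ginv_support -> (z *m ginv *m A) 0 i = z 0 i.
Proof.
move=> hz /imsetP [a _ ->].
have e (y : 'rV[F]_m) b : (y *m Q^T) 0 b = y 0 (f b).
  rewrite !mxE (bigD1 (f b)) //= !mxE eqxx mulr1 big1 ?addr0 // => l.
  by rewrite !mxE eq_sym => /negPf ->; rewrite mulr0.
have zQ : z = z *m Q^T *m Q.
  apply/rowP => j; rewrite [RHS]mxE.
  under eq_bigr do rewrite e !mxE.
  have [/imsetP [b _ ->]|js] := boolP (j \in ginv_support).
    rewrite (bigD1 b) //= eqxx mulr1 big1 ?addr0 // => b' bb'.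
    by rewrite (inj_eq (@maxrankfun_inj _ _ _ A)) (negPf bb') mulr0.
  rewrite hz // big1 // => b _; case: eqP => [eb|_]; last by rewrite mulr0.
  by case/negP: js; rewrite -eb imset_f.
have h : z *m ginv *m A *m Q^T = z *m Q^T.
  rewrite {1}zQ /ginv !mulmxA -[z *m Q^T *m Q *m Q^T]mulmxA QQ mulmx1.
  rewrite -[z *m Q^T *m _ *m Q *m A]mulmxA -[_ *m (Q *m A) *m _]mulmxA.
  by rewrite -[z *m Q^T *m _ *m _]mulmxA mulVmx ?mulmx1.
by rewrite -!e h.
Qed.

Lemma rank_col_mx_row (n k : nat) (x : 'rV[F]_k) (B : 'M[F]_(n, k)) :
  ~~ (x <= B)%MS -> \rank (col_mx x B) = (\rank B).+1.
Proof.
move=> xB; apply/eqP; rewrite eqn_leq; apply/andP; split.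
  rewrite -addsmxE; apply: leq_trans (mxrank_adds_leqif x B) _.
  by rewrite -[(\rank B).+1]add1n leq_add2r rank_leq_row.
apply: rank_ltmx; rewrite /ltmx -!addsmxE addsmxSr /=.
by rewrite addsmx_sub submx_refl andbT.
Qed.

(** A new row outside the row space counts twice, once as a row and, by symmetry, once
    as a column. *)
Lemma rank_border_notin (x : 'rV[F]_m) (d : 'M[F]_1) : ~~ (x <= A)%MS ->
  \rank (block_mx d x x^T A) = (r + 2)%N.
Proof.
move=> xA; rewrite block_mxEv rank_col_mx_row.
  by rewrite -mxrank_tr tr_row_mx trmxK symA rank_col_mx_row // addn2.
apply: contra xA => /submxP [c]; rewrite mul_mx_row => /eq_row_mx [_ ->].
exact: submxMl.
Qed.

(** A congruence clears a new row lying in the row space and leaves its scalar Schur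
    complement. *)
Lemma rank_border_in (x : 'rV[F]_m) (d : 'M[F]_1) : (x <= A)%MS ->
  \rank (block_mx d x x^T A) = (r + ((x *m ginv *m x^T) 0 0 != d 0 0)%R)%N.
Proof.
move=> /submxP [y xy].
have qy : x *m ginv *m x^T = y *m A *m y^T.
  by rewrite -[in RHS]ginvK xy trmx_mul symA !mulmxA.
pose U : 'M[F]_(1 + m) := block_mx 1%:M (- y) 0 1%:M.
have Uu : U \in unitmx by rewrite unitmxE det_ublock !det1 mulr1 unitr1.
have e : U *m block_mx d x x^T A *m U^T = block_mx (d - x *m ginv *m x^T) 0 0 A.
  rewrite /U tr_block_mx !trmx1 trmx0 !mulmx_block !mul1mx !mul0mx !mulmx1 !mulmx0.
  rewrite !add0r linearN /= !mulmxN !mulNmx -xy subrr mul0mx subr0.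
  have -> : x^T - A *m y^T = 0 by rewrite xy trmx_mul symA subrr.
  congr (block_mx (d - _) _ _ _).
  by rewrite qy xy trmx_mul symA mulmxA.
have <- : \rank (U *m block_mx d x x^T A *m U^T) = \rank (block_mx d x x^T A).
  rewrite mxrankMfree ?row_free_unit ?unitmx_tr // .
  by rewrite eqmxMfull // row_full_unit.
rewrite e rank_diag_block_mx addnC; congr (_ + _)%N.
rewrite rank_rV; congr (nat_of_bool (~~ _)); rewrite subr_eq0 eq_sym.
by apply/eqP/eqP => [->//|h]; apply/rowP => i; rewrite ord1.
Qed.

End Bordering.

(** * One step of the corank process *)

Section Fourier.
Variables (R : realType) (p : nat).
Hypotheses (p_pr : prime p) (p_gt2 : (2 < p)%N).
Local Notation F := 'F_p.
Local Notation ec := (@ec R p).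
Local Notation es := (@es R p).

(** Fourier inversion averages over the characters, so their number does not enter
    the bound. *)
Lemma equidistributed (T J : finType) (y : T -> J -> F) (B : R) : (0 < #|T|)%N -> 0 <= B ->
  (forall t : {ffun J -> F}, t != 0 -> `|mean (fun x => ec (\sum_j t j * y x j))| <= B) ->
  `|mean (fun x => [forall j, y x j == 0]%:R) - p%:R ^- #|J| : R| <= B.
Proof.
move=> T0 B0 H; have p0 := p_gt0R R p_pr.
have e x : [forall j, y x j == 0]%:R =
   p%:R ^- #|J| * \sum_(t : {ffun J -> F}) ec (\sum_j t j * y x j).
  by rewrite (sum_ec_dot R p_pr p_gt2) mulKf ?expf_neq0 ?gt_eqF.
rewrite (eq_mean e) meanMl mean_sum (bigD1 (0 : {ffun J -> F})) //=.
have -> : mean (fun x => ec (\sum_j (0 : {ffun J -> F}) j * y x j)) = 1.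
  rewrite -[RHS](mean_const 1 T0); apply: eq_mean => x.
  by rewrite big1 ?ec0 // => j _; rewrite ffunE mul0r.
rewrite mulrDr mulr1 addrC addrA addNr add0r normrM.
rewrite ger0_norm ?invr_ge0 ?exprn_ge0 ?(ltW p0) // mulrC ler_pdivrMr ?exprn_gt0 //.
apply: le_trans (ler_norm_sum _ _ _) _.
apply: (@le_trans _ _ (\sum_(t : {ffun J -> F} | t != 0) B)); first exact: ler_sum.
apply: (@le_trans _ _ (\sum_(t : {ffun J -> F}) B)).
  by rewrite [X in _ <= X](bigD1 (0 : {ffun J -> F})) //= lerDr.
by rewrite sumr_const card_ffun card_F // -[X in X <= _]mulr_natr natrX.
Qed.

(** Squaring and resampling the coordinates in [J] subtracts two phases, which for a
    quadratic phase leaves one linear in the other coordinates. The square of the sine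
    mean is added to that of the cosine mean to make the phases subtract. *)
Lemma decouple (K : finType) (J : {set K}) (al : {ffun K -> bool} -> F)
    (b : {ffun K -> bool} -> {ffun K -> bool} -> K -> F)
    (c : {ffun K -> bool} -> {ffun K -> bool} -> F) :
  (forall y y' u, al (splice J y u) - al (splice J y' u) =
      c y y' + \sum_(k in ~: J) b y y' k * sg p (u k)) ->
  mean (fun x => ec (al x)) ^+ 2 <=
  mean (fun y => mean (fun y' => \prod_(k in ~: J) `|ec (b y y' k)|)).
Proof.
move=> H; rewrite (mean_splice J); apply: le_trans (mean_sqr _) _.
apply: (@le_trans _ _ (mean (fun u => mean (fun y => mean (fun y' =>
     ec (al (splice J y u) - al (splice J y' u))))))).
  apply: ler_mean => u; set s := mean (fun y => es (al (splice J y u))).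
  set s' := mean (fun y => ec (al (splice J y u))).
  rewrite [X in _ <= X](_ : _ = s' ^+ 2 + s ^+ 2); first by rewrite lerDl sqr_ge0.
  rewrite !expr2 -!meanMr -meanD; apply: eq_mean => y; rewrite -!meanMl -meanD.
  by apply: eq_mean => y'; rewrite ecB.
rewrite mean_exchange; apply: ler_mean => y; rewrite mean_exchange; apply: ler_mean => y'.
under eq_mean => u do rewrite H big_mkcond /=.
rewrite (eq_mean (_ : _ =1 (fun u : {ffun K -> bool} =>
  ec (c y y' + \sum_k (if k \in ~: J then b y y' k else 0) * sg p (u k))))); last first.
  move=> u; congr (ec (_ + _)); apply: eq_bigr => k _; case: ifP => //; by rewrite mul0r.
rewrite (mean_ec_sg R p_pr (fun k => if k \in ~: J then b y y' k else 0)).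
apply: le_trans (ler_norm _) _; rewrite normrM normr_prod.
rewrite [X in _ <= X]big_mkcond /=.
apply: (@le_trans _ _ (\prod_k `|ec (if k \in ~: J then b y y' k else 0)|)).
  by rewrite ler_piMl ?prodr_ge0 ?ec_norm.
apply: ler_prod => k _; rewrite normr_ge0 /=; case: ifP => // _.
by rewrite ec_norm.
Qed.

Lemma mean_agree (K : finType) (J : {set K}) :
  mean (fun y : {ffun K -> bool} => mean (fun y' : {ffun K -> bool} =>
     [forall k in J, y k == y' k]%:R)) = 2 ^- #|J| :> R.
Proof.
rewrite -[RHS](mean_const _ (card_signs K)); apply: eq_mean => y.
have -> : mean (fun y' : {ffun K -> bool} => [forall k in J, y k == y' k]%:R) =
   mean (fun y' : {ffun K -> bool} => \prod_k (if k \in J then (y k == y' k)%:R else 1)) :> R.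
  apply: eq_mean => y'; rewrite -big_mkcond /=.
  case: forall_inP => [h|/forall_inP]; first by rewrite big1 // => k /h ->.
  rewrite negb_forall_in => /exists_inP [k kJ /negPf hk].
  by rewrite (bigD1 k) //= hk mul0r.
rewrite /mean -(bigA_distr_bigA (fun k (z : bool) => if k \in J then (y k == z)%:R else 1)) /=.
have -> : #|{: {ffun K -> bool}}|%:R = \prod_(k : K) 2 :> R.
  by rewrite card_ffun card_bool natrX prodr_const.
rewrite -prodf_div.
rewrite (eq_bigr (fun k => if k \in J then 2^-1 else 1)) => [|k _].
  by rewrite -big_mkcond /= prodr_const exprVn.
rewrite big_bool /=; case: ifP => _; last by rewrite -[1 + 1]/(2%:R) divff ?pnatr_eq0.
by case: (y k); rewrite ?addr0 ?add0r mul1r.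
Qed.

End Fourier.

Lemma close_small (R : realFieldType) (s i a b t ep et : R) : 0 <= s -> s <= i -> 0 <= b ->
  b <= t -> a <= t -> 0 <= ep -> `|i - a| <= ep -> t + ep <= et -> `|s - b| <= et.
Proof. by move=> ? ? ? ? ? ?; rewrite !ler_norml => /andP [? ?] ?; apply/andP; split; lra. Qed.

Section Step.
Variables (R : realType) (p : nat).
Hypotheses (p_pr : prime p) (p_gt2 : (2 < p)%N).
Local Notation F := 'F_p.
Local Notation ec := (@ec R p).
Variables (m e h : nat) (A : 'M[F]_m) (lam : F) (eps eta : R).
Hypothesis symA : A^T = A.
Hypothesis goodA : forall (E : {set 'I_m}) (w : {ffun 'I_m -> F}), (#|E| <= e)%N -> w != 0 ->
  (forall i, i \notin E -> \sum_j A i j * w j = 0) -> \prod_(i in ~: E) `|ec (w i)| <= eps.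
Hypothesis he : (2 * h <= e)%N.
Hypothesis hm : (2 * h <= m)%N.
Hypothesis eps0 : 0 <= eps.
Hypothesis eta0 : 0 <= eta.
Hypothesis eta1 : eta <= 1.
Hypothesis eta_ge : 2 ^- h + eps <= eta ^+ 2.

Local Notation X := {ffun 'I_m.+1 -> bool}.
Local Notation kd := (\rank (kermx A)).
Local Notation G := (ginv A).

Definition bord_row (x : X) : 'rV[F]_m := \row_i sg p (x (lift ord0 i)).
Definition bord_diag (x : X) : F := sg p (x ord0) - lam.
Definition qform (x : 'rV[F]_m) : F := (x *m G *m x^T) 0 0.

Lemma corankE : kd = (m - \rank A)%N.
Proof. exact: mxrank_ker. Qed.

Let Kb : 'M[F]_(kd, m) := row_base (kermx A).

Let KbA : Kb *m A = 0.
Proof. by apply/sub_kermxP; rewrite eq_row_base. Qed.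

Definition kdot (x : 'rV[F]_m) (j : 'I_kd) : F := (x *m Kb^T) 0 j.
Definition kvec (u : {ffun 'I_kd -> F}) : {ffun 'I_m -> F} := [ffun i => \sum_j u j * Kb j i].

Lemma sub_kdot (x : 'rV[F]_m) : (x <= A)%MS = [forall j, kdot x j == 0].
Proof.
have AK : (A <= kermx Kb^T)%MS.
  by apply/sub_kermxP; apply: trmx_inj; rewrite trmx_mul trmxK symA KbA trmx0.
have rk : \rank A = \rank (kermx Kb^T).
  rewrite mxrank_ker mxrank_tr (eqP (row_base_free (kermx A))) corankE subKn //.
  exact: rank_leq_row.
have KA : (kermx Kb^T <= A)%MS by rewrite -(mxrank_leqif_sup AK) rk.
have -> : (x <= A)%MS = (x <= kermx Kb^T)%MS.
  by apply/idP/idP => hx; apply: submx_trans hx _.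
apply/sub_kermxP/forallP => [hx j|hx]; first by rewrite /kdot hx mxE.
by apply/rowP => j; rewrite [RHS]mxE; apply/eqP; exact: hx.
Qed.

Lemma kdot_lin (u : {ffun 'I_kd -> F}) (x : 'rV[F]_m) :
  \sum_j u j * kdot x j = \sum_i kvec u i * x 0 i.
Proof.
under eq_bigr => j _ do rewrite /kdot mxE mulr_sumr.
rewrite exchange_big /=; apply: eq_bigr => i _; rewrite ffunE mulr_suml.
by apply: eq_bigr => j _; rewrite mxE [x 0 i * _]mulrC mulrA.
Qed.

Lemma kvec_row (u : {ffun 'I_kd -> F}) i : kvec u i = ((\row_j u j) *m Kb) 0 i.
Proof. by rewrite ffunE [RHS]mxE; apply: eq_bigr => j _; congr (_ * _); rewrite mxE. Qed.

Lemma kvec_neq0 (u : {ffun 'I_kd -> F}) : u != 0 -> kvec u != 0.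
Proof.
apply: contra => /eqP h0; apply/eqP/ffunP => j.
have : (\row_j u j) *m Kb = 0 *m Kb.
  by apply/rowP => i; rewrite -kvec_row h0 mul0mx mxE ffunE.
by move/(row_free_inj (row_base_free _))/rowP/(_ j); rewrite !mxE ffunE.
Qed.

Lemma kvec_ker (u : {ffun 'I_kd -> F}) i : \sum_j A i j * kvec u j = 0.
Proof.
transitivity ((\row_j u j *m Kb *m A) 0 i); last by rewrite -mulmxA KbA mulmx0 mxE.
rewrite mxE; apply: eq_bigr => j _; rewrite -kvec_row mulrC; congr (_ * _).
by rewrite -{1}symA mxE.
Qed.

(** A kernel vector is annihilated by all rows, so it is the case of no failing row. *)
Lemma kvec_char (u : {ffun 'I_kd -> F}) : u != 0 -> \prod_i `|ec (kvec u i)| <= eps.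
Proof.
move=> u0; have := goodA (E := finset.set0) (w := kvec u).
rewrite cards0 => /(_ isT (kvec_neq0 u0) (fun i _ => kvec_ker u i)).
by rewrite (eq_bigl xpredT) // => i; rewrite !inE.
Qed.

Lemma mean_lin (b : 'I_m -> F) (b0 c : F) :
  mean (fun x : X => ec (c + (b0 * sg p (x ord0) + \sum_i b i * bord_row x 0 i))) =
  ec c * (ec b0 * \prod_i ec (b i)).
Proof.
pose bb (k : 'I_m.+1) := if unlift ord0 k is Some i then b i else b0.
have := mean_ec_sg R p_pr bb c; rewrite big_ord_recl /bb unlift_none.
rewrite (eq_bigr (fun i => ec (b i))) => [<-|i _]; last by rewrite liftK.
apply: eq_mean => x; rewrite big_ord_recl unlift_none; congr (ec (_ + (_ + _))).
by apply: eq_bigr => i _; rewrite liftK mxE.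
Qed.

Lemma lin_le (u : {ffun 'I_kd -> F}) : u != 0 ->
  `|mean (fun x : X => ec (\sum_j u j * kdot (bord_row x) j))| <= eps.
Proof.
move=> u0; have e1 x : ec (\sum_j u j * kdot (bord_row x) j) =
    ec (0 + (0 * sg p (x ord0) + \sum_i kvec u i * bord_row x 0 i)).
  by rewrite kdot_lin mul0r !add0r.
rewrite (eq_mean e1) mean_lin ec0 !mul1r normr_prod; exact: kvec_char.
Qed.

Definition prob_in : R := mean (fun x : X => (bord_row x <= A)%MS%:R).
Definition prob_sing : R :=
  mean (fun x : X => ((bord_row x <= A)%MS && (qform (bord_row x) == bord_diag x))%:R).

Lemma prob_in_close : `|prob_in - p%:R ^- kd| <= eps.
Proof.
have := equidistributed p_pr p_gt2 (y := fun x : X => kdot (bord_row x)) (card_signs _) eps0 lin_le.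
rewrite card_ord; congr (`|_ - _| <= _).
by apply: eq_mean => x; rewrite sub_kdot.
Qed.

Lemma sg_inj : injective (sg p).
Proof.
have n1 : -1 != 1 :> F.
  by rewrite eq_sym -subr_eq0 opprK -[1 + 1]/(2%:R) (two_neq0 p_pr p_gt2).
by move=> [] [] // => /eqP; rewrite /sg expr1 expr0 ?(negPf n1) // eq_sym (negPf n1).
Qed.

(** The resampled coordinates [J0] are taken inside the support of the generalized
    inverse. On that support [A *m G] acts as the identity, so the coefficients [w] of
    the linearized phase satisfy [A w = 0] outside [J0] and outside the [kd]
    coordinates that the support misses. *)
Lemma quad_le (th : F) (v : {ffun 'I_m -> F}) : th != 0 -> (kd <= h)%N ->
  `|mean (fun x : X => ec (th * (qform (bord_row x) - bord_diag x) +
      \sum_i v i * bord_row x 0 i))| <= eta.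
Proof.
move=> th0 kh; pose al (x : X) := th * (qform (bord_row x) - bord_diag x) +
      \sum_i v i * bord_row x 0 i.
have rm : (\rank A <= m)%N by exact: rank_leq_row.
have [J0 J0S cJ0] : exists2 J0 : {set 'I_m}, J0 \subset ginv_support A & #|J0| = h.
  have hr : (h <= #|ginv_support A|)%N by rewrite card_ginv_support; move: kh hm; rewrite corankE; lia.
  have := set_0Vmem [set B : {set 'I_m} | B \subset ginv_support A & #|B| == h].
  case=> [h0|[B]]; last by rewrite inE => /andP [B1 /eqP B2]; exists B.
  have := cards_draws (ginv_support A) h.
  by rewrite h0 cards0 => /esym/eqP; rewrite -leqn0 leqNgt bin_gt0 hr.
pose J : {set 'I_m.+1} := [set lift ord0 i | i in J0].
have inJ i : (lift ord0 i \in J) = (i \in J0).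
  by apply/imsetP/idP => [[i' i'J /lift_inj ->]|iJ] //; exists i.
have inJ0 : (ord0 \in J) = false.
  by apply/negbTE/imsetP => -[i _ /eqP]; rewrite (negPf (neq_lift _ _)).
pose res (y : X) : 'rV[F]_m := \row_i (if i \in J0 then bord_row y 0 i else 0).
pose rest (u : X) : 'rV[F]_m := \row_i (if i \in J0 then 0 else bord_row u 0 i).
have bs y u : bord_row (splice J y u) = res y + rest u.
  by apply/rowP => i; rewrite !mxE ffunE inJ; case: ifP => _; rewrite ?addr0 ?add0r.
have ds y u : bord_diag (splice J y u) = bord_diag u by rewrite /bord_diag ffunE inJ0.
pose w (y y' : X) i := (2%:R * th) * ((res y - res y') *m G) 0 i.
pose b (y y' : X) (k : 'I_m.+1) := if unlift ord0 k is Some i then w y y' i else 0.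
pose c (y y' : X) := th * (qform (res y) - qform (res y')) + \sum_i v i * (res y - res y') 0 i.
have H y y' u : al (splice J y u) - al (splice J y' u) =
      c y y' + \sum_(k in ~: J) b y y' k * sg p (u k).
  rewrite /al !bs !ds.
  have -> : \sum_(k in ~: J) b y y' k * sg p (u k) = 2%:R * th * ((res y - res y') *m G *m (rest u)^T) 0 0.
    rewrite big_mkcond big_ord_recl /= {1}/b unlift_none mul0r if_same add0r.
    rewrite [in RHS]mxE mulr_sumr; apply: eq_bigr => i _.
    have -> : (rest u)^T i 0 = if i \in J0 then 0 else sg p (u (lift ord0 i)) by rewrite !mxE.
    rewrite inE inJ /b liftK; case: (i \in J0) => /=; first by rewrite !mulr0.
    by rewrite /w mulrA.
  have -> : \sum_i v i * (res y + rest u) 0 i = \sum_i v i * (res y - res y') 0 i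
      + \sum_i v i * (res y' + rest u) 0 i.
    rewrite -big_split /=; apply: eq_bigr => i _; rewrite -mulrDr; congr (_ * _).
    by rewrite !mxE addrA subrK.
  have aE (M N : 'M[F]_1) : (M + N) 0 0 = M 0 0 + N 0 0 by rewrite mxE.
  have oE (M : 'M[F]_1) : (- M) 0 0 = - M 0 0 by rewrite mxE.
  have qD a t : qform (a + t) = qform a + qform t + 2%:R * (a *m G *m t^T) 0 0.
    have sw : (t *m G *m a^T) 0 0 = (a *m G *m t^T) 0 0.
      have <- : (t *m G *m a^T)^T 0 0 = (t *m G *m a^T) 0 0 by rewrite mxE.
      by rewrite trmx_mul trmxK [(t *m G)^T]trmx_mul ginv_sym // mulmxA.
    rewrite /qform linearD /= mulmxDl mulmxDr !mulmxDl !aE sw; ring.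
  by rewrite !qD /c !mulmxBl aE oE; ring.
have dec := decouple R p_pr H.
have bd y y' : \prod_(k in ~: J) `|ec (b y y' k)| <= [forall k in J, y k == y' k]%:R + eps.
  case: forall_inP => [_|/forall_inP].
    apply: (@le_trans _ _ 1); last by rewrite lerDl.
    by apply: prodr_le1 => k _; rewrite normr_ge0 ec_norm.
  rewrite negb_forall_in => /exists_inP [_ /imsetP [i0 i0J ->] yi0]; rewrite add0r.
  have i0S : i0 \in ginv_support A by exact: (fintype.subsetP J0S).
  have eqn i : i \in ginv_support A -> \sum_j A i j * w y y' j = 2%:R * th * (res y - res y') 0 i.
    move=> iS; rewrite -(ginv_solve symA (z := res y - res y') (i := i)) //; last first.
      move=> j jS; have jJ : j \notin J0 by apply: contra jS; exact: (fintype.subsetP J0S).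
      by rewrite !mxE (negPf jJ) subrr.
    rewrite [in RHS]mxE mulr_sumr; apply: eq_bigr => j _; rewrite /w.
    have -> : A i j = A j i by rewrite -{1}symA mxE.
    by ring.
  have th2 : 2%:R * th != 0 by rewrite mulf_neq0 // (two_neq0 p_pr p_gt2).
  pose E := J0 :|: ~: ginv_support A.
  have cE : (#|E| <= e)%N.
    rewrite (leq_trans (leq_card_setU _ _)) // cJ0.
    have cS : #|~: ginv_support A| = kd.
      have := cardsC (ginv_support A); rewrite card_ginv_support // card_ord corankE => hc.
      by rewrite -[LHS](addKn (\rank A)) hc.
    by rewrite cS (leq_trans _ he) // mul2n -addnn leq_add2l.
  have w0 : [ffun i => w y y' i] != 0.
    apply/eqP => w0; have := eqn i0 i0S; rewrite big1 => [/esym/eqP|j _]; last first.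
      by have /ffunP/(_ j) := w0; rewrite !ffunE => ->; rewrite mulr0.
    rewrite mulf_eq0 (negPf th2) /= !mxE i0J subr_eq0 (inj_eq sg_inj).
    by rewrite (negPf yi0).
  have kE i : i \notin E -> \sum_j A i j * [ffun i => w y y' i] j = 0.
    rewrite !inE negb_or negbK => /andP [iJ iS].
    under eq_bigr => j _ do rewrite ffunE.
    by rewrite eqn // !mxE (negPf iJ) subrr mulr0.
  have good := goodA cE w0 kE.
  apply: le_trans good; rewrite [X in X <= _]big_mkcond big_ord_recl /= {1}/b unlift_none ec0 normr1 if_same mul1r.
  rewrite [X in _ <= X]big_mkcond /=; apply: ler_prod => i _.
  rewrite inE inJ /b liftK !inE ffunE negb_or negbK.
  case: (i \in J0) => /=; first by rewrite ler01 lexx.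
  by rewrite normr_ge0 /=; case: ifP => _; rewrite ?ec_norm.
rewrite -ler_sqr ?nnegrE // real_normK ?num_real //.
apply: le_trans dec _; apply: le_trans eta_ge.
apply: (@le_trans _ _ (mean (fun y : X => mean (fun y' : X => [forall k in J, y k == y' k]%:R + eps)))).
  by apply: ler_mean => y; apply: ler_mean => y'; exact: bd.
under eq_mean => y do rewrite meanD (mean_const _ (card_signs _)).
rewrite meanD (mean_const _ (card_signs _)) mean_agree.
by rewrite card_imset ?cJ0 //; exact: lift_inj.
Qed.

Let eta2_le : eta ^+ 2 <= eta.
Proof. by rewrite expr2 ler_piMl. Qed.

Let eps_eta : eps <= eta.
Proof.
have h2 : 0 <= 2 ^- h :> R by rewrite invr_ge0 exprn_ge0.
have := eta_ge; have := eta2_le; lra.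
Qed.

Lemma prob_sing_small : (kd <= h)%N -> `|prob_sing - p%:R ^- kd.+1| <= eta.
Proof.
move=> kh.
pose y (x : X) (j : 'I_kd.+1) := if unlift ord0 j is Some j' then kdot (bord_row x) j'
   else qform (bord_row x) - bord_diag x.
have yE (t : {ffun 'I_kd.+1 -> F}) x : \sum_j t j * y x j =
    t ord0 * (qform (bord_row x) - bord_diag x) +
    \sum_i kvec [ffun j => t (lift ord0 j)] i * bord_row x 0 i.
  rewrite big_ord_recl /y unlift_none -kdot_lin; congr (_ + _).
  by apply: eq_bigr => j _; rewrite liftK ffunE.
have H (t : {ffun 'I_kd.+1 -> F}) : t != 0 -> `|mean (fun x => ec (\sum_j t j * y x j))| <= eta.
  move=> t0; under eq_mean => x do rewrite yE.
  have [t00|t00] := eqVneq (t ord0) 0; last exact: quad_le.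
  apply: le_trans eps_eta; under eq_mean => x do rewrite t00 mul0r add0r -kdot_lin.
  apply: lin_le; apply: contra t0 => /eqP u0; apply/eqP/ffunP => j; rewrite ffunE.
  case: (unliftP ord0 j) => [j' ->|-> //].
  by have /ffunP/(_ j') := u0; rewrite !ffunE.
have := equidistributed p_pr p_gt2 (card_signs _) eta0 H; rewrite card_ord.
congr (`|_ - _| <= _); apply: eq_mean => x; congr (nat_of_bool _)%:R.
rewrite sub_kdot; apply/forallP/andP => [hx|[/forallP hx hq] j]; last first.
  by rewrite /y; case: (unlift ord0 j) => [j'|]; rewrite ?subr_eq0.
split; first by apply/forallP => j; have := hx (lift ord0 j); rewrite /y liftK.
by have := hx ord0; rewrite /y unlift_none subr_eq0.
Qed.

(** Decoupling needs [kd <= h]; for larger coranks both probabilities are already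
    below [2 ^- h + eps]. *)
Lemma prob_sing_close : `|prob_sing - p%:R ^- kd.+1| <= eta.
Proof.
have [|hk] := leqP kd h; first exact: prob_sing_small.
have p0 := p_gt0R R p_pr; have p2 : 2 <= p%:R :> R by rewrite (ler_nat R 2) ltnW.
have inv2 c : (h <= c)%N -> p%:R ^- c <= 2 ^- h :> R.
  move=> hc; apply: (@le_trans _ _ (2 ^- c)).
    by rewrite lef_pV2 ?posrE ?exprn_gt0 // lerXn2r ?nnegrE ?(ltW p0).
  by rewrite lef_pV2 ?posrE ?exprn_gt0 // ler_weXn2l // ler1n.
have s0 : 0 <= prob_sing by apply: mean_ge0.
have si : prob_sing <= prob_in.
  by apply: ler_mean => x; rewrite ler_nat; case: (bord_row x <= A)%MS => //; exact: leq_b1.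
have k0 : 0 <= p%:R ^- kd.+1 :> R by rewrite invr_ge0 exprn_ge0 // ltW.
apply: (close_small s0 si k0 (inv2 _ (leqW (ltnW hk))) (inv2 _ (ltnW hk)) eps0 prob_in_close).
exact: le_trans eta_ge eta2_le.
Qed.

(** The bordered rank takes only three values, so its law is determined by [prob_in]
    and [prob_sing]. *)
Lemma step_close (g : nat -> R) : (forall c, 0 <= g c <= 1) ->
  `|mean (fun x : X => g (m.+1 - \rank (block_mx (bord_diag x)%:M (bord_row x) (bord_row x)^T A))%N)
    - ((1 - p%:R ^- kd) * g kd.-1 + (p%:R ^- kd - p%:R ^- kd.+1) * g kd + p%:R ^- kd.+1 * g kd.+1)|
  <= 2 * eta.
Proof.
move=> g01; have rm : (\rank A <= m)%N by exact: rank_leq_row.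
have e1 x : g (m.+1 - \rank (block_mx (bord_diag x)%:M (bord_row x) (bord_row x)^T A))%N =
    g kd.-1 + (bord_row x <= A)%MS%:R * (g kd - g kd.-1) +
    ((bord_row x <= A)%MS && (qform (bord_row x) == bord_diag x))%:R * (g kd.+1 - g kd).
  rewrite corankE; have [xA|xA] := boolP (bord_row x <= A)%MS.
    rewrite rank_border_in // -/(qform _) [_%:M 0 0]mxE eqxx mulr1n.
    case: eqVneq => _ /=; first by rewrite addn0 subSn //; ring.
    by rewrite addn1 subSS; ring.
  by rewrite rank_border_notin // addn2 subSS subnS /= !mul0r !addr0.
rewrite (eq_mean e1) !meanD !meanMr (mean_const _ (card_signs _)) -/prob_in -/prob_sing.
set a := p%:R ^- kd; set b := p%:R ^- kd.+1.
have -> : forall u v w s t : R, u + s * (v - u) + t * (w - v) - ((1 - a) * u + (a - b) * v + b * w) =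
   (s - a) * (v - u) + (t - b) * (w - v) by move=> *; ring.
have d1 c c' : `|g c - g c'| <= 1.
  by have /andP [? ?] := g01 c; have /andP [? ?] := g01 c'; rewrite ler_norml; apply/andP; split; lra.
apply: le_trans (ler_normD _ _) _; rewrite !normrM.
have -> : 2 * eta = eta * 1 + eta * 1 by ring.
apply: lerD; apply: ler_pM => //; last exact: prob_sing_close.
exact: le_trans prob_in_close eps_eta.
Qed.

End Step.

Import numFieldNormedType.Exports.

(** * The limiting corank chain *)

Section Chain.
Variables (R : realType) (p : nat).
Hypothesis p_gt2 : (2 < p)%N.
Local Notation x := (p%:R : R).
Local Notation q := (x^-1).

Let x3 : 3 <= x. Proof. by rewrite (ler_nat R 3). Qed.
Let x0 : 0 < x. Proof. by have := x3; lra. Qed.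
Let q0 : 0 < q. Proof. by rewrite invr_gt0. Qed.
Let q3 : q <= 3^-1. Proof. by rewrite lef_pV2 ?posrE //; lra. Qed.
Let qn0 n : 0 <= q ^+ n. Proof. by rewrite exprn_ge0 // ltW. Qed.
Let qn1 n : q ^+ n <= 1.
Proof. by rewrite exprn_ile1 // ?(ltW q0) //; have := q3; lra. Qed.

(** Corank transitions of a symmetric matrix bordered by uniform entries. *)
Definition chain (g : nat -> R) (k : nat) : R :=
  (1 - q ^+ k) * g k.-1 + (q ^+ k - q ^+ k.+1) * g k + q ^+ k.+1 * g k.+1.

Definition incr (g : nat -> R) (k : nat) : R := g k.+1 - g k.

Lemma chain01 g : (forall k, 0 <= g k <= 1) -> forall k, 0 <= chain g k <= 1.
Proof.
move=> h k; rewrite /chain.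
have /andP [a0 a1] := h k.-1; have /andP [b0 b1] := h k; have /andP [c0 c1] := h k.+1.
have e1 : q ^+ k.+1 <= q ^+ k by rewrite exprS ler_piMl ?qn0 //; have := q3; lra.
have := qn0 k.+1; have := qn1 k; set u := q ^+ k; set v := q ^+ k.+1.
move: e1; rewrite -/u -/v => e1 e2 e3; apply/andP; split.
  by rewrite !addr_ge0 // mulr_ge0 //; lra.
have h1 : (1 - u) * g k.-1 <= 1 - u by rewrite ler_piMr //; lra.
have h2 : (u - v) * g k <= u - v by rewrite ler_piMr //; lra.
have h3 : v * g k.+1 <= v by rewrite ler_piMr.
lra.
Qed.

(** Increments evolve by a positive kernel whose total weight is below 1
    after rescaling by [2 ^ k]. *)
Lemma incr_chain g k :
  incr (chain g) k = q ^+ k.+2 * incr g k.+1 + (1 - q ^+ k) * incr g k.-1.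
Proof.
case: k => [|k]; first by rewrite /incr /chain !expr0 /=; ring.
by rewrite /incr /chain /=; ring.
Qed.

Lemma incr_contract g M : (forall k, `|incr g k| <= M * 2 ^+ k) ->
  forall k, `|incr (chain g) k| <= 3 / 5 * M * 2 ^+ k.
Proof.
move=> h k; have M0 : 0 <= M by have := h 0%N; rewrite expr0 mulr1; apply: le_trans.
rewrite incr_chain; apply: le_trans (ler_normD _ _) _; rewrite [`|q ^+ _ * _|]normrM [`|(1 - _) * _|]normrM (ger0_norm (qn0 _)).
have k1 : 0 <= 1 - q ^+ k by rewrite subr_ge0 qn1.
rewrite (ger0_norm k1).
have q2 : q ^+ k.+2 <= 9^-1 * q ^+ k.
  rewrite -[k.+2]add2n exprD ler_wpM2r ?qn0 //.
  by apply: (@le_trans _ _ (3^-1 ^+ 2)); [rewrite lerXn2r ?nnegrE ?invr_ge0 ?(ltW x0)|lra].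
have p2 : 0 < 2 ^+ k :> R by rewrite exprn_gt0.
have M2 : 0 <= M * 2 ^+ k by rewrite mulr_ge0 // ltW.
have A : q ^+ k.+2 * `|incr g k.+1| <= 9^-1 * q ^+ k * (2 * (M * 2 ^+ k)).
  by apply: ler_pM => //; apply: le_trans (h _) _; rewrite exprS mulrCA.
case: k q2 p2 M2 A k1 => [|k] q2 p2 M2 A k1.
  rewrite expr0 subrr mul0r addr0; move: A; rewrite expr0; lra.
have B : (1 - q ^+ k.+1) * `|incr g k.+1.-1| <= M * 2 ^+ k.
  apply: le_trans (h k); rewrite ler_piMl // lerBlDr lerDl; exact: qn0.
have : q ^+ k.+1 <= 3^-1 by rewrite exprS -[X in _ <= X]mulr1 ler_pM ?(ltW q0) ?qn0 ?qn1.
move=> q13; have : 9^-1 * q ^+ k.+1 * (2 * (M * 2 ^+ k.+1)) <= 27^-1 * (2 * (M * 2 ^+ k.+1)).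
  by rewrite ler_wpM2r //; lra.
move: A B M2; rewrite (_ : M * 2 ^+ k.+1 = 2 * (M * 2 ^+ k)); last by rewrite exprS; ring.
rewrite -[3 / 5 * M * _]mulrA (_ : M * 2 ^+ k.+1 = 2 * (M * 2 ^+ k)); last by rewrite exprS; ring.
move: (M * 2 ^+ k) (q ^+ k.+1) => Z Y; lra.
Qed.

Lemma incr_iter g N k : (forall k, 0 <= g k <= 1) ->
  `|incr (iter N chain g) k| <= (3 / 5) ^+ N * 2 ^+ k.
Proof.
move=> g01; elim: N k => [|N IH] k /=.
  rewrite expr0 mul1r; apply: (@le_trans _ _ 1); last by rewrite exprn_ege1 // ler1n.
  by have /andP [? ?] := g01 k; have /andP [? ?] := g01 k.+1; rewrite ler_norml; apply/andP; split; rewrite /incr; lra.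
by rewrite exprS; exact: incr_contract.
Qed.

Lemma iter_chain01 g N : (forall k, 0 <= g k <= 1) -> forall k, 0 <= iter N chain g k <= 1.
Proof. by move=> g01; elim: N => [//|N IH] /=; exact: chain01. Qed.

Lemma iter_chain_near0 g N j : (forall k, 0 <= g k <= 1) ->
  `|iter N chain g j - iter N chain g 0| <= (3 / 5) ^+ N * 2 ^+ j.
Proof.
move=> g01; have c0 : 0 <= (3 / 5) ^+ N :> R by rewrite exprn_ge0 //; lra.
apply: (@le_trans _ _ ((3 / 5) ^+ N * (2 ^+ j - 1))); last by rewrite ler_wpM2l // lerBlDr lerDl.
elim: j => [|j IH]; first by rewrite subrr normr0 expr0 subrr mulr0.
rewrite (_ : _ - _ = incr (iter N chain g) j + (iter N chain g j - iter N chain g 0)); last first.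
  by rewrite /incr; ring.
apply: le_trans (ler_normD _ _) _.
have := incr_iter N j g01; move=> h1.
have -> : (3 / 5) ^+ N * (2 ^+ j.+1 - 1) = (3 / 5) ^+ N * 2 ^+ j + (3 / 5) ^+ N * (2 ^+ j - 1) :> R.
  by rewrite exprS; ring.
exact: lerD.
Qed.

(** Unnormalized stationary weights. *)
Definition weight (k : nat) : R := (\prod_(1 <= i < k.+1) (x ^+ i - 1))^-1.

Let xn1 i : 0 < x ^+ i.+1 - 1.
Proof. by rewrite subr_gt0 exprn_egt1 //; have := x3; lra. Qed.

Lemma weight0 : weight 0 = 1.
Proof. by rewrite /weight big_geq // invr1. Qed.

Lemma weightS k : weight k.+1 = weight k / (x ^+ k.+1 - 1).
Proof. by rewrite /weight big_nat_recr //= invfM. Qed.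

Lemma weight_gt0 k : 0 < weight k.
Proof. by elim: k => [|k IH]; rewrite ?weight0 // weightS divr_gt0. Qed.

Lemma weight_le k : weight k <= 4 * 8 ^- k.
Proof.
case: k => [|k]; first by rewrite weight0 expr0 invr1; lra.
elim: k => [|k IH].
  rewrite weightS weight0 mul1r !expr1.
  apply: (@le_trans _ _ 2^-1); last by lra.
  by rewrite lef_pV2 ?posrE //; [have := x3; lra|have := x3; lra].
rewrite weightS; apply: (@le_trans _ _ ((4 * 8 ^- k.+1) / 8)); last first.
  by rewrite [8 ^+ k.+2]exprSr invfM mulrA.
apply: ler_pM => //; rewrite ?(ltW (weight_gt0 _)) ?invr_ge0 ?(ltW (xn1 _)) //.
rewrite lef_pV2 ?posrE //.
have : 3 ^+ 2 <= x ^+ k.+2.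
  apply: (@le_trans _ _ (x ^+ 2)); first by rewrite lerXn2r ?nnegrE ?(ltW x0).
  by rewrite ler_weXn2l //; have := x3; lra.
by lra.
Qed.

(** Detailed balance: the flows between the neighbours [k] and [k.+1] agree. *)
Lemma weight_balance k : weight k.+1 * (1 - q ^+ k.+1) = weight k * q ^+ k.+1.
Proof.
rewrite weightS; have h := lt0r_neq0 (xn1 k).
have hx : x ^+ k.+1 != 0 by rewrite expf_neq0 // lt0r_neq0.
rewrite exprVn; apply/eqP; rewrite -subr_eq0; apply/eqP.
by field; rewrite hx h.
Qed.

(** By detailed balance all flows inside [0..J] cancel and only the one across [J]
    remains. *)
Lemma stationary_step g J :
  \sum_(j < J.+1) weight j * chain g j =
  \sum_(j < J.+1) weight j * g j + weight J * q ^+ J.+1 * incr g J.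
Proof.
elim: J => [|J IH].
  by rewrite !big_ord_recl !big_ord0 /= weight0 /chain /incr expr0 /=; ring.
rewrite big_ord_recr /= IH [in RHS]big_ord_recr /= -weight_balance /chain /incr /=; ring.
Qed.

Lemma stationary_iter g N J : (forall k, 0 <= g k <= 1) ->
  `|\sum_(j < J.+1) weight j * iter N chain g j - \sum_(j < J.+1) weight j * g j| <= N%:R * weight J.
Proof.
move=> g01; elim: N => [|N IH]; first by rewrite subrr normr0 mul0r.
rewrite (_ : _ - _ = weight J * q ^+ J.+1 * incr (iter N chain g) J +
  (\sum_(j < J.+1) weight j * iter N chain g j - \sum_(j < J.+1) weight j * g j)); last first.
  by rewrite /= stationary_step; ring.
apply: le_trans (ler_normD _ _) _; rewrite -[N.+1%:R]natr1 mulrDl mul1r addrC lerD //.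
have w0 := weight_gt0 J; rewrite !normrM (ger0_norm (ltW w0)) (ger0_norm (qn0 _)) -mulrA ler_piMr ?(ltW w0) //.
rewrite mulr_ile1 ?qn0 ?qn1 //; have g2 := iter_chain01 N g01; rewrite /incr ler_norml.
by have /andP [? ?] := g2 J; have /andP [? ?] := g2 J.+1; apply/andP; split; lra.
Qed.

Lemma sum_geo (a : R) n : 0 <= a -> a <= 2^-1 -> \sum_(j < n) a ^+ j <= 2.
Proof.
move=> a0 a1; apply: (@le_trans _ _ (\sum_(j < n) 2^-1 ^+ j)).
  by apply: ler_sum => j _; rewrite lerXn2r ?nnegrE ?invr_ge0.
have -> : \sum_(j < n) 2^-1 ^+ j = 2 - 2 * 2^-1 ^+ n :> R.
  elim: n => [|n IH]; first by rewrite big_ord0 expr0; lra.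
  by rewrite big_ord_recr /= IH exprS; lra.
by rewrite lerBlDr lerDl mulr_ge0 // exprn_ge0 // invr_ge0.
Qed.

Lemma sum_weight2_le J : \sum_(j < J.+1) weight j * 2 ^+ j <= 8.
Proof.
apply: (@le_trans _ _ (\sum_(j < J.+1) 4 * 4^-1 ^+ j)).
  apply: ler_sum => j _; apply: (@le_trans _ _ (4 * 8 ^- j * 2 ^+ j)).
    by rewrite ler_wpM2r ?exprn_ge0 ?weight_le.
  rewrite -mulrA -exprVn -exprMn (_ : 8^-1 * 2 = 4^-1) //; lra.
have := @sum_geo 4^-1 J.+1; rewrite -mulr_sumr => h.
have : \sum_(j < J.+1) 4^-1 ^+ j <= 2 :> R by apply: h; lra.
lra.
Qed.

Definition mass (J : nat) : R := \sum_(j < J.+1) weight j.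

Lemma mass_le J : mass J <= 8.
Proof.
apply: le_trans (sum_weight2_le J); apply: ler_sum => j _.
by rewrite ler_peMr ?(ltW (weight_gt0 _)) // exprn_ege1 // ler1n.
Qed.

(** Stationarity replaces [g] by its [N]-th iterate in the weighted sum, and
    contraction makes this iterate nearly constant. *)
Lemma weight_near (g : nat -> R) N J : (forall k, 0 <= g k <= 1) ->
  `|\sum_(j < J.+1) weight j * g j - mass J * iter N chain g 0| <=
  N%:R * weight J + 8 * (3 / 5) ^+ N.
Proof.
move=> g01; set h := iter N chain g.
rewrite (_ : _ - _ = - (\sum_(j < J.+1) weight j * h j - \sum_(j < J.+1) weight j * g j)
   + \sum_(j < J.+1) weight j * (h j - h 0%N)); last first.
  have -> : \sum_(j < J.+1) weight j * (h j - h 0%N) =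
      \sum_(j < J.+1) weight j * h j - mass J * h 0%N.
    by rewrite /mass mulr_suml -sumrB; apply: eq_bigr => j _; rewrite mulrBr.
  by ring.
apply: le_trans (ler_normD _ _) _; rewrite normrN lerD ?stationary_iter //.
apply: le_trans (ler_norm_sum _ _ _) _.
apply: (@le_trans _ _ (\sum_(j < J.+1) (weight j * 2 ^+ j) * (3 / 5) ^+ N)).
  apply: ler_sum => j _; rewrite normrM (ger0_norm (ltW (weight_gt0 _))) -mulrA.
  by rewrite ler_wpM2l ?(ltW (weight_gt0 _)) // mulrC; exact: iter_chain_near0.
by rewrite -mulr_suml ler_wpM2r ?sum_weight2_le // exprn_ge0 //; lra.
Qed.

(** Truncated generating function [f z = \sum_j weight j * z ^ j] at [z = q ^ N]. *)
Definition tilt (J N : nat) : R := \sum_(j < J.+1) weight j * q ^+ (N * j).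

(** Detailed balance is the functional equation [f z = (1 + q z) * f (q z)] of the
    generating function; iterated from [z = 1] it makes the total mass the product of
    the [1 + q ^ i]. *)
Lemma tilt_step J N : exists2 e, 0 <= e <= weight J &
  tilt J N = (1 + q ^+ N.+1) * tilt J N.+1 - e.
Proof.
exists (weight J * q ^+ (N.+1 * J.+1)).
  by rewrite mulr_ge0 ?qn0 ?(ltW (weight_gt0 _)) //= ler_piMr ?qn1 // ltW // weight_gt0.
elim: J => [|J IH].
  by rewrite /tilt !big_ord_recl !big_ord0 /= weight0 !muln0 muln1 expr0; ring.
have tS M : tilt J.+1 M = tilt J M + weight J.+1 * q ^+ (M * J.+1) by rewrite /tilt big_ord_recr.
rewrite !tS IH.
have b := weight_balance J.
have e1 : q ^+ (N * J.+1) * q ^+ J.+1 = q ^+ (N.+1 * J.+1) by rewrite -exprD mulSn addnC.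
have e2 : q ^+ (N.+1 * J.+2) = q ^+ N.+1 * q ^+ (N.+1 * J.+1) by rewrite -exprD -mulnS.
have -> : weight J * q ^+ (N.+1 * J.+1) = weight J.+1 * (1 - q ^+ J.+1) * q ^+ (N * J.+1).
  by rewrite b -e1; ring.
by rewrite e2 -e1; ring.
Qed.

Definition plus_prod N : R := \prod_(1 <= i < N.+1) (1 + q ^+ i).

Lemma mass_tilt J N : exists2 e, 0 <= e <= N%:R * 2 ^+ N * weight J &
  mass J = plus_prod N * tilt J N - e.
Proof.
elim: N => [|N [e /andP [e0 e1] IH]].
  exists 0; first by rewrite !mul0r lexx.
  rewrite /plus_prod big_geq // mul1r subr0 /mass /tilt.
  by apply: eq_bigr => j _; rewrite mul0n mulr1.
have [e' /andP [e'0 e'1] ht] := tilt_step J N.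
have P2 : 0 <= plus_prod N <= 2 ^+ N.
  rewrite /plus_prod; apply/andP; split.
    by apply: prodr_ge0 => i _; rewrite addr_ge0 ?qn0.
  rewrite -[X in 2 ^+ X](subn1 N.+1) -prodr_const_nat ler_prod // => i _.
  by have := qn0 i; have := qn1 i; lra.
have /andP [P0 P1] := P2.
exists (plus_prod N * e' + e); last first.
  rewrite IH ht {2}/plus_prod big_nat_recr //= -/(plus_prod N); ring.
rewrite addr_ge0 ?mulr_ge0 //=.
have w0 := ltW (weight_gt0 J).
have h1 : plus_prod N * e' <= 2 ^+ N * weight J by exact: ler_pM.
have h2 : 0 <= N.+1%:R * 2 ^+ N * weight J by rewrite !mulr_ge0 ?exprn_ge0.
have eN : N.+1%:R = N%:R + 1 :> R by rewrite natr1.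
move: h1 h2 e1; rewrite exprS eN.
have -> : (N%:R + 1) * (2 * 2 ^+ N) * weight J = 2 * (N%:R * 2 ^+ N * weight J) + 2 * (2 ^+ N * weight J) :> R by ring.
have -> : (N%:R + 1) * 2 ^+ N * weight J = (N%:R * 2 ^+ N * weight J) + (2 ^+ N * weight J) :> R by ring.
move: (N%:R * 2 ^+ N * weight J) (2 ^+ N * weight J) (plus_prod N * e') => a b c; lra.
Qed.

Definition odd_prod N : R := \prod_(0 <= i < N) (1 - x ^- (2 * i + 1)).
Definition full_prod N : R := \prod_(1 <= i < N.+1) (1 - q ^+ i).

Let f1 i : 0 < 1 - q ^+ i.+1 <= 1.
Proof.
rewrite lerBlDr lerDl qn0 andbT subr_gt0 exprn_ilt1 ?(ltW q0) //.
by have := q3; lra.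
Qed.

Lemma full_prodS N : full_prod N.+1 = full_prod N * (1 - q ^+ N.+1).
Proof. by rewrite /full_prod big_nat_recr. Qed.

Lemma full_prod_gt0 N : 0 < full_prod N.
Proof.
rewrite /full_prod big_add1 /=; apply: prodr_gt0 => i _; by have /andP [] := f1 i.
Qed.

(** Finite form of Euler's identity: [(1 + q ^ i) * (1 - q ^ i)] is the factor of
    exponent [2 i], so the odd exponents and these together give all of them. *)
Lemma odd_plus_full N : odd_prod N * plus_prod N * full_prod N = full_prod (2 * N).
Proof.
elim: N => [|N IH].
  by rewrite /odd_prod /plus_prod /full_prod !big_geq // !mul1r.
have -> : full_prod (2 * N.+1) = full_prod (2 * N) * (1 - q ^+ (2 * N).+1) * (1 - q ^+ (2 * N).+2).
  by rewrite (_ : (2 * N.+1 = (2 * N).+2)%N) ?mulnS // !full_prodS.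
rewrite -IH /odd_prod big_nat_recr //= -/(odd_prod N) /plus_prod big_nat_recr //= -/(plus_prod N).
rewrite full_prodS addn1 -exprVn.
have -> : q ^+ (2 * N).+2 = q ^+ N.+1 ^+ 2 by rewrite -exprM; congr (_ ^+ _); rewrite muln2 mul2n doubleS.
ring.
Qed.

Lemma odd_plus_bounds N : 1 - N%:R * q ^+ N <= odd_prod N * plus_prod N <= 1.
Proof.
have F := full_prod_gt0 N.
have H j : full_prod N * (1 - j%:R * q ^+ N) <= full_prod (N + j) <= full_prod N.
  elim: j => [|j /andP [IH1 IH2]]; first by rewrite addn0 mul0r subr0 mulr1 lexx.
  rewrite addnS full_prodS.
  have /andP [g0 g1] := f1 (N + j); have Fj := full_prod_gt0 (N + j).
  apply/andP; split; last by apply: le_trans IH2; rewrite ler_piMr // ltW.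
  have e : q ^+ (N + j).+1 <= q ^+ N.
    rewrite -addnS exprD ler_piMr ?qn0 ?qn1 //.
  rewrite -natr1.
  have h1 : full_prod (N + j) * q ^+ (N + j).+1 <= full_prod N * q ^+ N.
    by apply: ler_pM => //; rewrite ?qn0 // ltW.
  rewrite mulrBr mulr1 mulrBr mulr1 mulrDl mulrDr mul1r.
  by move: IH1; rewrite mulrBr mulr1; lra.
have := H N; rewrite addnn -mul2n -odd_plus_full => /andP [h1 h2].
rewrite -(ler_pM2l F) mulrC -[X in _ && X](ler_pM2l F) mulr1.
by rewrite [full_prod N * (_ * _)]mulrC h2 andbT mulrC.
Qed.

Lemma odd_prod01 N : 0 <= odd_prod N <= 1.
Proof.
have h i : 0 <= 1 - x ^- (2 * i + 1) <= 1.
  by rewrite -exprVn addn1; have /andP [/ltW -> ->] := f1 (2 * i).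
apply/andP; split; first by apply: prodr_ge0 => i _; have /andP [] := h i.
by apply: prodr_le1 => i _; exact: h.
Qed.

Lemma odd_mass_near N : `|odd_prod N * mass N - 1| <= 20 * (2 / 3) ^+ N.
Proof.
have [e /andP [e0 e1] ->] := mass_tilt N N.
have o01 := odd_prod01 N; have u01 := odd_plus_bounds N.
have /andP [w0 w1] := o01; have /andP [u0 u1] := u01.
set U := odd_prod N * plus_prod N in u0 u1.
have c0 : 0 <= (2 / 3) ^+ N :> R by rewrite exprn_ge0 //; lra.
have N2 : N%:R <= 2 ^+ N :> R by rewrite -natrX ler_nat ltnW // ltn_expl.
have qN : q ^+ N <= 3^-1 ^+ N by rewrite lerXn2r ?nnegrE ?(ltW q0) ?invr_ge0.
have NqN : N%:R * q ^+ N <= (2 / 3) ^+ N.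
  by rewrite exprMn; apply: ler_pM.
have qc : q ^+ N <= (2 / 3) ^+ N.
  apply: le_trans qN _; rewrite lerXn2r ?nnegrE ?invr_ge0 ?mulr_ge0 ?invr_ge0 //; lra.
have ec : e <= 4 * (2 / 3) ^+ N.
  apply: le_trans e1 _; apply: (@le_trans _ _ (2 ^+ N * 2 ^+ N * (4 * 8 ^- N))).
    by apply: ler_pM; rewrite ?mulr_ge0 ?exprn_ge0 ?weight_le ?(ltW (weight_gt0 _)) // ler_wpM2r ?exprn_ge0.
  rewrite mulrCA -exprMn -exprVn -exprMn ler_wpM2l //.
  by rewrite lerXn2r ?nnegrE //; lra.
have t1 : 1 <= tilt N N <= 1 + 8 * (2 / 3) ^+ N.
  rewrite /tilt big_ord_recl /= muln0 expr0 mulr1 weight0.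
  have s0 : 0 <= \sum_(i < N) weight (bump 0 i) * q ^+ (N * bump 0 i).
    by apply: sumr_ge0 => i _; rewrite mulr_ge0 ?qn0 // ltW // weight_gt0.
  rewrite lerDl s0 lerD2l /=.
  apply: (@le_trans _ _ (mass N * q ^+ N)); last first.
    by apply: ler_pM; rewrite ?mass_le ?qn0 // sumr_ge0 // => i _; rewrite ltW // weight_gt0.
  rewrite /mass big_ord_recl /= mulrDl mulr_suml ler_wpDl ?mulr_ge0 ?qn0 ?(ltW (weight_gt0 _)) //.
  apply: ler_sum => i _; rewrite ler_wpM2l ?(ltW (weight_gt0 _)) //.
  by rewrite /bump /= mulnDr muln1 exprD ler_piMr ?qn0 ?qn1.
have /andP [t2 t3] := t1.
have -> : odd_prod N * (plus_prod N * tilt N N - e) - 1 = U * tilt N N - 1 - odd_prod N * e.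
  by rewrite /U; ring.
have oe : 0 <= odd_prod N * e by rewrite mulr_ge0.
have oe1 : odd_prod N * e <= e by rewrite ler_piMl // w1.
have a1 : U * tilt N N <= tilt N N by rewrite ler_piMl //; lra.
have a2 : (1 - N%:R * q ^+ N) * tilt N N <= U * tilt N N by rewrite ler_wpM2r //; lra.
have c1 : (2 / 3) ^+ N <= 1 :> R by rewrite exprn_ile1 //; lra.
have a3 : N%:R * q ^+ N * tilt N N <= (2 / 3) ^+ N * 9.
  by apply: ler_pM => //; lra.
have a4 : (1 - N%:R * q ^+ N) * tilt N N = tilt N N - N%:R * q ^+ N * tilt N N by ring.
rewrite ler_norml; apply/andP; split; lra.
Qed.

Lemma odd_euler_product01 : 0 <= odd_euler_product R p <= 1.
Proof.
have c := @is_cvg_odd_euler_product R p (ltnW (ltnW p_gt2)).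
by apply/andP; split; [apply: limr_ge|apply: limr_le] => //; apply: nearW => N;
  have /andP [] := odd_prod01 N.
Qed.

(** All finite-[J] errors vanish as [J] grows, which leaves the contraction error of the
    [N] steps and the distance from the corank [j] to 0. *)
Lemma chain_limit (N k j : nat) :
  `|iter N chain (fun i => (i == k)%:R) j - corank_main_term R p k| <= (8 + 2 ^+ j) * (3 / 5) ^+ N.
Proof.
pose g i : R := (i == k)%:R.
have g01 i : 0 <= g i <= 1 by rewrite /g; case: (i == k); rewrite ?lexx ?ler01.
pose c := odd_euler_product R p.
have /andP [c0 c1] : 0 <= c <= 1 := odd_euler_product01.
have cvc : (odd_prod @ \oo --> c)%classic by apply: is_cvg_odd_euler_product; exact: (ltnW (ltnW p_gt2)).
have main : corank_main_term R p k = c * weight k by [].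
pose h0 := iter N chain g 0%N.
have /andP [h00 h01] : 0 <= h0 <= 1 := iter_chain01 N g01 0.
have bnd J : (k <= J)%N -> `|c * weight k - h0| <=
    N%:R * (4 * 8^-1 ^+ J) + 8 * (3 / 5) ^+ N + 20 * (2 / 3) ^+ J + 8 * `|c - odd_prod J|.
  move=> kJ; have := weight_near N J g01.
  have -> : \sum_(j < J.+1) weight j * g j = weight k.
    rewrite (bigD1 (inord k)) //= inordK // /g eqxx mulr1 big1 ?addr0 // => i ik.
    rewrite -(inj_eq val_inj) /= inordK // in ik.
    by rewrite (negPf ik) mulr0.
  rewrite -/h0 => h1; have h2 := odd_mass_near J.
  rewrite (_ : c * weight k - h0 = c * (weight k - mass J * h0) +
     ((odd_prod J * mass J - 1) * h0 + (c - odd_prod J) * (mass J * h0))); last by ring.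
  apply: le_trans (ler_normD _ _) _; rewrite -addrA; apply: lerD.
    rewrite normrM (ger0_norm c0); apply: le_trans (ler_piMl _ c1) _ => //.
    apply: le_trans h1 _; rewrite lerD2r ler_wpM2l // exprVn; exact: weight_le.
  apply: le_trans (ler_normD _ _) _; apply: lerD.
    rewrite normrM (ger0_norm h00); apply: le_trans (ler_piMr _ h01) _ => //.
  have m0 : 0 <= mass J by apply: sumr_ge0 => i _; rewrite ltW // weight_gt0.
  rewrite !normrM (ger0_norm m0) (ger0_norm h00) mulrC ler_wpM2r //.
  by rewrite -[X in _ <= X]mulr1; apply: ler_pM => //; exact: mass_le.
have key : `|c * weight k - h0| <= 8 * (3 / 5) ^+ N.
  have g0 (a : R) : 0 <= a -> a < 1 -> ((fun J => a ^+ J) @ \oo --> (0 : R))%classic.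
    by move=> a0 a1; apply: cvg_expr; rewrite ger0_norm.
  have cv : ((fun J => N%:R * (4 * 8^-1 ^+ J) + 8 * (3 / 5) ^+ N + 20 * (2 / 3) ^+ J + 8 * `|c - odd_prod J|)
      @ \oo --> N%:R * (4 * 0) + 8 * (3 / 5) ^+ N + 20 * 0 + 8 * `|c - c|)%classic.
    apply: cvgD; last first.
      by apply: cvgMr; apply: cvg_norm; apply: cvgB => //; exact: cvg_cst.
    apply: cvgD; last by apply: cvgMr; apply: g0; lra.
    apply: cvgD; last exact: cvg_cst.
    by apply: cvgMr; apply: cvgMr; apply: g0; lra.
  have lim := cvg_lim (@Rhausdorff R) cv.
  have := limr_ge (x := `|c * weight k - h0|) (cvgP _ cv); rewrite lim subrr normr0 !mulr0 add0r !addr0.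
  by apply; exists k => // J /= kJ; exact: bnd.
rewrite main (_ : _ - _ = (iter N chain g j - h0) + - (c * weight k - h0)); last by ring.
apply: le_trans (ler_normD _ _) _; rewrite normrN mulrDl addrC; apply: lerD => //.
rewrite mulrC; exact: iter_chain_near0.
Qed.

End Chain.

(** * Growing a random symmetric matrix *)

Section Model.
Variables (R : realType) (p : nat).
Local Notation F := 'F_p.
Variables (n' : nat) (lam : F).
Local Notation n := n'.+1.
Local Notation Idx := (upper_index n).
Local Notation Om := {ffun Idx -> bool}.

(** [minn] and [maxn] order the pair, so below [n] the default value of [insubd] is
    never reached. *)
Definition upper_of (a b : nat) : Idx :=
  (insubd (exist _ (ord0, ord0) (leqnn 0) : {ij : 'I_n * 'I_n | (ij.1 <= ij.2)%N})
    (inord (minn a b), inord (maxn a b))).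

Lemma upper_ofC a b : upper_of a b = upper_of b a.
Proof. by rewrite /upper_of minnC maxnC. Qed.

Lemma val_upper_of a b : (a < n)%N -> (b < n)%N ->
  val (upper_of a b) = (inord (minn a b), inord (maxn a b)).
Proof.
move=> an bn; rewrite /upper_of insubdK // unfold_in /= !inordK; first by lia.
  by rewrite gtn_max an.
by rewrite gtn_min an.
Qed.

Lemma upper_of_inj a b a' b' : (a < n)%N -> (b < n)%N -> (a' < n)%N -> (b' < n)%N ->
  upper_of a b = upper_of a' b' -> (a = a' /\ b = b') \/ (a = b' /\ b = a').
Proof.
move=> an bn an' bn' /(congr1 val); rewrite !val_upper_of // => -[].
move=> /(congr1 val) /= e1 /(congr1 val) /= e2.
by move: e1 e2; rewrite !inordK; lia.
Qed.

(** Trailing rather than leading submatrices, so that passing from [m] to [m.+1] adds a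
    first row and column, as in [block_mx]. *)
Definition trail_index (m : nat) (i j : 'I_m) : Idx := upper_of (n - m + i) (n - m + j).

Definition trail (m : nat) (x : Om) : 'M[F]_m :=
  \matrix_(i, j) sg p (x (trail_index i j)) - lam%:M.

Lemma trailE m (x : Om) (i j : 'I_m) :
  trail m x i j = sg p (x (upper_of (n - m + i) (n - m + j))) - lam *+ (i == j).
Proof. by rewrite !mxE. Qed.

Lemma trail_bound m (i : 'I_m) : (m <= n)%N -> (n - m + i < n)%N.
Proof. by move=> mn; have := ltn_ord i; lia. Qed.

Lemma trail_index_inj m : (m <= n)%N -> forall i j i' j' : 'I_m,
  trail_index i j = trail_index i' j' -> (i = i' /\ j = j') \/ (i = j' /\ j = i').
Proof.
move=> mn i j i' j' /upper_of_inj; rewrite !trail_bound // => /(_ isT isT isT isT).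
by case=> -[/addnI/val_inj -> /addnI/val_inj ->]; [left|right].
Qed.

Lemma trail_sym m (x : Om) : (trail m x)^T = trail m x.
Proof.
apply/matrixP => i j; rewrite !mxE /trail_index upper_ofC; congr (_ - _).
by rewrite eq_sym.
Qed.

Lemma row_form_trail m (x : Om) (w : {ffun 'I_m -> F}) i :
  row_form (@trail_index m) lam x w i = \sum_j trail m x i j * w j.
Proof.
rewrite /row_form; under [RHS]eq_bigr => j _ do rewrite !mxE mulrBl.
rewrite sumrB; congr (_ - _); rewrite (bigD1 i) //= eqxx mulr1n big1 ?addr0 // => j ji.
by rewrite eq_sym (negPf ji) mul0r.
Qed.

Definition new_index (m : nat) (i : 'I_m.+1) : Idx := upper_of (n - m.+1) (n - m.+1 + i).

Lemma new_index_inj m : (m < n)%N -> injective (@new_index m).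
Proof.
move=> mn i j /upper_of_inj H; apply: val_inj => /=.
have := ltn_ord i; have := ltn_ord j => hj hi.
by case: H => [||||[_ /addnI //]|[]]; lia.
Qed.

Lemma trailS m (x : Om) : (m < n)%N ->
  let y := [ffun i => x (@new_index m i)] in
  trail m.+1 x = block_mx (bord_diag lam y)%:M (bord_row p y) (bord_row p y)^T (trail m x)
    :> 'M[F]_(1 + m).
Proof.
move=> mn y.
have sh (i : 'I_m) : (n - m.+1 + i.+1)%N = (n - m + i)%N by have := ltn_ord i; lia.
apply/matrixP => i j.
case: (split_ordP i) => i' ->; case: (split_ordP j) => j' ->.
- rewrite block_mxEul trailE !ord1 [RHS]mxE !eqxx !mulr1n.
  by rewrite /bord_diag ffunE /new_index /= !addn0.
- rewrite block_mxEur trailE !ord1 [RHS]mxE ffunE (_ : (_ == _) = false) ?mulr0n ?subr0 //.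
  by rewrite /new_index /= addn0.
- rewrite block_mxEdl trailE !ord1 [RHS]mxE [RHS]mxE ffunE (_ : (_ == _) = false) ?mulr0n ?subr0 //.
  by rewrite /new_index upper_ofC /= addn0.
rewrite block_mxEdr !trailE (inj_eq (@rshift_inj _ _)).
by rewrite /= !add1n !sh.
Qed.

Lemma trail_new_indep m (x x' : Om) : (m < n)%N ->
  (forall k, k \notin codom (@new_index m) -> x k = x' k) -> trail m x = trail m x'.
Proof.
move=> mn H; apply/matrixP => i j; rewrite !mxE H //.
apply/codomP => -[k /upper_of_inj e].
have := ltn_ord i; have := ltn_ord j; have := ltn_ord k => hk hj hi.
by case: e => [||||[]|[]]; lia.
Qed.

Definition corank m (x : Om) : nat := (m - \rank (trail m x))%N.

Hypotheses (p_pr : prime p) (p_gt2 : (2 < p)%N).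
Variables (m0 e h : nat) (ka eta delta : R).
Hypothesis he : (2 * h <= e)%N.
Hypothesis hm0 : (2 * h <= m0)%N.
Hypothesis eta0 : 0 <= eta.
Hypothesis eta1 : eta <= 1.
Hypothesis eta_ge : 2 ^- h + expR (- ka) <= eta ^+ 2.
Hypothesis bad_le : forall m, (m0 <= m)%N -> (m <= n)%N ->
  mean (fun x : Om => (bad (@trail_index m) lam e ka x)%:R) <= delta.

(** The new entries are independent of [trail m], whose corank then evolves by
    [step_close] outside the bad event. *)
Lemma corank_step m (g : nat -> R) : (m0 <= m)%N -> (m < n)%N -> (forall c, 0 <= g c <= 1) ->
  `|mean (fun x : Om => g (corank m.+1 x)) - mean (fun x : Om => chain p g (corank m x))|
  <= 2 * eta + delta.
Proof.
move=> m0m mn g01.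
pose G (x : Om) (y : {ffun 'I_m.+1 -> bool}) : R :=
  g (m.+1 - \rank (block_mx (bord_diag lam y)%:M (bord_row p y) (bord_row p y)^T (trail m x)))%N.
have -> : mean (fun x : Om => g (corank m.+1 x)) = mean (fun x : Om => mean (G x)).
  rewrite -(mean_resample (new_index_inj mn)); last first.
    by move=> x x' z H; rewrite /G (trail_new_indep mn H).
  by apply: eq_mean => x; rewrite /G /corank trailS.
rewrite -meanB; apply: le_trans (ler_mean_norm _) _.
apply: (@le_trans _ _ (mean (fun x : Om => 2 * eta + (bad (@trail_index m) lam e ka x)%:R))); last first.
  by rewrite meanD (mean_const _ (card_signs _)) lerD2l bad_le // ltnW.
apply: ler_mean => x; case: (boolP (bad _ _ _ _ _)) => [_|good].
  apply: (@le_trans _ _ 1); last by rewrite lerDr mulr_ge0.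
  have a1 : 0 <= mean (G x) <= 1.
    apply/andP; split; first by apply: mean_ge0 => y; have /andP [] := g01 (m.+1 - \rank (block_mx (bord_diag lam y)%:M (bord_row p y) (bord_row p y)^T (trail m x)))%N.
    by apply: mean_le1 => y; have /andP [] := g01 (m.+1 - \rank (block_mx (bord_diag lam y)%:M (bord_row p y) (bord_row p y)^T (trail m x)))%N.
  have a2 := chain01 p_gt2 g01 (corank m x).
  have /andP [? ?] := a1; have /andP [? ?] := a2.
  by rewrite ler_norml; apply/andP; split; lra.
rewrite addr0.
have goodA (E : {set 'I_m}) (w : {ffun 'I_m -> F}) : (#|E| <= e)%N -> w != 0 ->
  (forall i, i \notin E -> \sum_j trail m x i j * w j = 0) ->
  \prod_(i in ~: E) `|ec R (w i)| <= expR (- ka).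
  move=> Ee w0 ker; rewrite leNgt; apply: contra good => st.
  apply/existsP; exists E; rewrite Ee /=; apply/existsP; exists w; rewrite w0 /=.
  rewrite /structured ltW //=; apply/forall_inP => i; rewrite inE => iE.
  by rewrite row_form_trail ker.
have := step_close p_pr p_gt2 lam (trail_sym m x) goodA he (leq_trans hm0 m0m) (expR_ge0 _) eta0 eta1 eta_ge g01.
rewrite corankE /chain -/(corank m x) !exprVn; exact.
Qed.

Lemma corank_telescope (N : nat) (g : nat -> R) : (m0 + N <= n)%N -> (forall c, 0 <= g c <= 1) ->
  `|mean (fun x : Om => g (corank (m0 + N) x)) -
    mean (fun x : Om => iter N (chain p) g (corank m0 x))| <= N%:R * (2 * eta + delta).
Proof.
elim: N g => [|N IH] g Nn g01.
  by rewrite addn0 subrr normr0 mul0r.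
have s1 := @corank_step (m0 + N) g (leq_addr _ _).
rewrite addnS in Nn *; have {}s1 := s1 Nn g01.
have s2 := IH (chain p g) (ltnW Nn) (chain01 p_gt2 g01).
rewrite -iterSr in s2.
set A := mean _ in s1 *; set B := mean _ in s1 s2; set C := mean _ in s2 *.
have -> : A - C = (A - B) + (B - C) by ring.
apply: le_trans (ler_normD _ _) _; rewrite -natr1 mulrDl mul1r addrC; exact: lerD.
Qed.

(** The chain is started from an arbitrary corank at size [m0]: the factor [2 ^+ m0]
    covers the worst case and is compensated by the number [N] of steps. *)
Lemma corank_law (N k : nat) : (m0 + N = n)%N ->
  `|mean (fun x : Om => (corank n x == k)%:R) - corank_main_term R p k| <=
   N%:R * (2 * eta + delta) + (8 + 2 ^+ m0) * (3 / 5) ^+ N.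
Proof.
move=> Nn; pose g i : R := (i == k)%:R.
have g01 i : 0 <= g i <= 1 by rewrite /g; case: (i == k); rewrite ?lexx ?ler01.
have := @corank_telescope N g; rewrite Nn leqnn => /(_ isT g01) h1.
set A := mean _ in h1 *; set B := mean _ in h1.
have -> : A - corank_main_term R p k = (A - B) + (B - corank_main_term R p k) by ring.
apply: le_trans (ler_normD _ _) _; apply: lerD => //.
rewrite -(mean_const (corank_main_term R p k) (card_signs Idx)) -meanB.
apply: le_trans (ler_mean_norm _) _.
apply: (@le_trans _ _ (mean (fun _ : Om => (8 + 2 ^+ m0) * (3 / 5) ^+ N))); last first.
  by rewrite (mean_const _ (card_signs Idx)).
apply: ler_mean => x.
apply: (le_trans (chain_limit R p_gt2 N k _)).
have c0 : 0 <= (3 / 5) ^+ N :> R by apply: exprn_ge0; lra.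
have cm : (corank m0 x <= m0)%N by exact: leq_subr.
move: (corank m0 x) cm => c cm; apply: (ler_wpM2r c0); rewrite lerD2l.
by apply: ler_weXn2l cm; rewrite ler1n.
Qed.

End Model.

(** * Choice of the parameters *)

Section Numerics.
Variable R : realType.
Local Notation A4 := (4 ^+ 22 : R).
Local Notation be := (4^-1 ^+ 9 : R).

Lemma A4_ge1 : 1 <= A4.
Proof. by rewrite exprn_ege1 // (ler_nat R 1). Qed.

Lemma be_gt0 : 0 < be.
Proof. by rewrite exprn_gt0 // invr_gt0. Qed.

Lemma be_le : be <= 8^-1.
Proof.
apply: (@le_trans _ _ (4^-1 ^+ 2)); last by lra.
apply: ler_wiXn2l => //; rewrite ?invr_ge0 //; lra.
Qed.

Lemma be_A4 : 1 <= be * A4.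
Proof.
rewrite -[22%N]/(9 + 13)%N [4 ^+ _]exprD mulrA -exprMn mulVf ?pnatr_eq0 // expr1n mul1r.
by rewrite exprn_ege1 // (ler_nat R 1).
Qed.

Lemma expR_inv_le (x y : R) : 0 < y -> y <= x -> expR (- x) <= y^-1.
Proof.
move=> y0 yx; rewrite expRN lef_pV2 ?posrE ?expR_gt0 //.
by apply: le_trans (expR_ge1Dx x); lra.
Qed.

Lemma two_le_exp : 2 <= expR 1 :> R.
Proof. by have := expR_ge1Dx (1 : R); lra. Qed.

Lemma half_le_exp (c : nat) : 2 ^- c <= expR (- (c%:R / 2)) :> R.
Proof.
rewrite expRN lef_pV2 ?posrE ?expR_gt0 ?exprn_gt0 //.
rewrite mulrC expRM_natr lerXn2r ?nnegrE ?expR_ge0 //.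
rewrite -ler_sqr ?nnegrE ?expR_ge0 // -expRM_natl mulfV ?pnatr_eq0 //.
(* [exp 1 <= 4], by squaring [1 / 2 <= exp (- 1 / 2)]. *)
have h : 2^-1 <= expR (- 2^-1) :> R by have := expR_ge1Dx (- 2^-1 : R); lra.
have : 2^-1 ^+ 2 <= expR (- 2^-1) ^+ 2 :> R by rewrite lerXn2r ?nnegrE ?expR_ge0 ?invr_ge0.
rewrite -expRM_natl (_ : 2%:R * - 2^-1 = - 1 :> R); last by field.
rewrite expRN exprVn lef_pV2 ?posrE ?expR_gt0 ?exprn_gt0 //.
Qed.

(* Used with [t = m0 / (10 ^ 4 * L)] and [W = 4 ^ 22 * L ^ 3]. *)
Lemma arith_d (t W h d : R) : 100 ^+ 6 * W <= t -> 1 <= W -> h <= t -> 25 / 2 * t - 1 <= d ->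
  [/\ 2 * h + 2 * t <= d, 2 * h + 480 * 100 ^+ 3 * W <= d & 2 * h + 80 * 100 ^+ 3 * W <= d].
Proof. by move=> h1 h2 h3 h4; split; lra. Qed.

Lemma two_thirds_small : (2 / 3) ^+ 22 <= 1536^-1 :> R.
Proof.
have h : 2^-1 ^+ 11 <= 1536^-1 :> R by rewrite !exprS expr0; lra.
rewrite -[22%N]/(2 * 11)%N exprM; apply: le_trans h.
by rewrite lerXn2r ?nnegrE ?exprn_ge0 ?invr_ge0 ?mulr_ge0 ?invr_ge0 //; lra.
Qed.

Lemma two_thirds_8 : (2 / 3) ^+ 8 <= 25^-1 :> R.
Proof. by rewrite !exprS expr0; lra. Qed.

Lemma divn_real (m c : nat) : (0 < c)%N ->
  (m %/ c)%:R * c%:R <= m%:R :> R /\ m%:R <= ((m %/ c)%:R + 1) * c%:R :> R.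
Proof.
move=> c0; rewrite natr1 -!natrM !ler_nat leq_trunc_div; split=> //.
by rewrite ltnW // ltn_ceil.
Qed.

Section Fixed.
Variables (p n' : nat) (lam : 'F_p) (L m0 : nat).
Hypotheses (p_pr : prime p) (p_gt2 : (2 < p)%N).
Local Notation n := n'.+1.
Hypothesis pL : (p <= 2 ^ L)%N.
Hypothesis L1 : (0 < L)%N.
Hypothesis n_ge : (16 * m0 <= n)%N.
Hypothesis n_le : (n <= 17 * m0)%N.
Hypothesis big : A4 * 100 ^+ 8 * L%:R ^+ 4 <= m0%:R.

Local Notation l := (L%:R : R).
Local Notation M := (m0%:R : R).
Local Notation t := (M / (100 ^+ 2 * l)).
Local Notation W := (A4 * l ^+ 3).
(* With [L] of order [log p]: [q = 10 ^ 4 * L] blocks, [h] of order [m0 / L] resampled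
   coordinates, [2 h] failing rows, [d] of order [m0 / L] exceptional coordinates, and
   below [3 L] frequencies per block at levels of order [L]. The exceptions produced by
   [greedy] number of order [L ^ 3], level times frequencies times blocks, and have to
   fit in [d]: this is the condition [big]. *)
Let q := (100 * 100 * L)%N.
Let s := (n %/ q).+1.
Let h := (m0 %/ (100 * 100 * L))%N.
Let d := (m0 %/ (8 * 100 * L))%N.

Let l1 : 1 <= l. Proof. by rewrite (ler_nat R 1). Qed.
Let l0 : 0 < l. Proof. exact: lt_le_trans l1. Qed.
Let W1 : 1 <= W.
Proof. by apply: mulr_ege1; rewrite ?A4_ge1 ?exprn_ege1. Qed.
Let l3 : l ^+ 3 <= W.
Proof. by rewrite ler_peMl ?A4_ge1 // exprn_ge0 // ltW. Qed.

Let tM : M = 100 ^+ 2 * l * t.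
Proof. by field; rewrite gt_eqF. Qed.

Let t_ge : 100 ^+ 6 * W <= t.
Proof.
rewrite ler_pdivlMr ?mulr_gt0 ?exprn_gt0 //; apply: le_trans big.
rewrite le_eqVlt; apply/orP; left; apply/eqP; ring.
Qed.

Let t100 : 100 ^+ 6 <= t.
Proof. by apply: le_trans t_ge; rewrite ler_peMr // exprn_ge0. Qed.

Let hb : h%:R <= t /\ t - 1 <= h%:R.
Proof.
have c0 : (0 < 100 * 100 * L)%N by rewrite !muln_gt0.
have [] := divn_real m0 c0; rewrite -/h !natrM -expr2.
have cc : 0 < 100 ^+ 2 * l by rewrite mulr_gt0 ?exprn_gt0.
move=> h1 h2; split; first by rewrite ler_pdivlMr.
have : t <= h%:R + 1 by rewrite ler_pdivrMr.
by move: t => z; lra.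
Qed.

Let db : 25 / 2 * t - 1 <= d%:R.
Proof.
have c0 : (0 < 8 * 100 * L)%N by rewrite !muln_gt0.
have [_] := divn_real m0 c0; rewrite -/d !natrM.
have cc : 0 < 8 * 100 * l by rewrite !mulr_gt0.
rewrite -ler_pdivrMr // => h1.
have e : M / (8 * 100 * l) = 25 / 2 * t by field; rewrite gt_eqF.
by move: h1; rewrite e; move: t => z; lra.
Qed.

Let sb : s%:R <= 17 * t + 1.
Proof.
have c0 : (0 < q)%N by rewrite !muln_gt0.
have [h1 _] := divn_real n c0; rewrite -[s%:R]natr1 lerD2r.
have cc : 0 < 100 ^+ 2 * l by rewrite mulr_gt0 ?exprn_gt0.
have qe : q%:R = 100 ^+ 2 * l by rewrite /q !natrM expr2.
move: h1; rewrite qe -ler_pdivlMr // => h1; apply: le_trans h1 _.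
rewrite ler_pdivrMr // -mulrA [t * _]mulrC -tM.
by rewrite -natrM ler_nat.
Qed.

Let es_le : (100 * (L * (2 * h + s)) <= m0)%N.
Proof.
rewrite -(ler_nat R) !natrM natrD natrM {1}tM.
have [h1 _] := hb; have t1 := t100.
have -> : 100 * (l * (2 * h%:R + s%:R)) = l * (100 * (2 * h%:R + s%:R)) by ring.
have -> : 100 ^+ 2 * l * t = l * (100 ^+ 2 * t) by ring.
rewrite ler_pM2l //; move: sb t1 h1; lra.
Qed.

Let kq_le : (100 * (L * (3 * L * q + 2)) <= m0)%N.
Proof.
rewrite -(ler_nat R) !natrM natrD !natrM; apply: le_trans big.
have e1 : l <= l ^+ 4 by rewrite -{1}[l]expr1 ler_weXn2l.
have e3 : l ^+ 3 <= l ^+ 4 by rewrite ler_weXn2l.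
have e4 : l ^+ 4 <= A4 * l ^+ 4 by rewrite ler_peMl ?A4_ge1 // exprn_ge0 // ltW.
have e0 : 0 <= l ^+ 4 by rewrite exprn_ge0 // ltW.
have -> : 100 * (l * (3 * l * (100 * 100 * l) + 2)) = 300 * 100 ^+ 2 * l ^+ 3 + 200 * l by ring.
have -> : A4 * 100 ^+ 8 * l ^+ 4 = 100 ^+ 8 * (A4 * l ^+ 4) by ring.
by move: (A4 * l ^+ 4) e4 => Y; move: (l ^+ 4) e0 e1 e3 => X; move: (l ^+ 3) => Z; lra.
Qed.

Let d_le : (800 * (L * d) <= m0)%N.
Proof. by rewrite -[800%N]/(8 * 100)%N mulnA mulnC leq_trunc_div. Qed.

Let pLR : p%:R <= expR l :> R.
Proof.
apply: (@le_trans _ _ (2 ^+ L)); first by rewrite -natrX ler_nat.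
by rewrite -[l]mul1r expRM_natr lerXn2r ?nnegrE ?expR_ge0 ?two_le_exp.
Qed.

Let k_le : (3 / 4) ^+ (3 * L) * p%:R <= 1 :> R.
Proof.
apply: (@le_trans _ _ ((2^-1) ^+ L * 2 ^+ L)); last by rewrite -exprMn mulVf ?pnatr_eq0 // expr1n.
apply: ler_pM => //.
  by rewrite exprM lerXn2r ?nnegrE ?exprn_ge0 ?invr_ge0 //; lra.
by rewrite -natrX ler_nat.
Qed.

Let r := 40 * 100 * l.

Let g0_le : (2 / 3 : R) ^+ 22 + expR (- (r / 2)) <= 768^-1.
Proof.
have h1 : expR (- (r / 2)) <= 1536^-1 by apply: expR_inv_le; [rewrite ltr0n|rewrite /r; have := l1; lra].
have := two_thirds_small; lra.
Qed.

Let pf_le : p%:R * expR (- (A4 * r / 2)) <= 4^-1 :> R.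
Proof.
apply: (@le_trans _ _ (expR l * expR (- (A4 * r / 2)))); first by rewrite ler_wpM2r ?expR_ge0.
rewrite -expRD (_ : l + - (A4 * r / 2) = - (A4 * r / 2 - l)); last by ring.
apply: expR_inv_le => //.
have : r <= A4 * r by rewrite ler_peMl ?A4_ge1 // /r !mulr_ge0 // ltW.
by rewrite /r; have := l1; lra.
Qed.

Let be8 : 4 ^+ 8 * be < 1 / 2.
Proof. by rewrite [be]exprSr mulrA -exprMn mulfV ?pnatr_eq0 // expr1n; lra. Qed.

Let ka := be * t.
Let eta := expR (- (ka / 4)).

Let ka_t : ka <= 8^-1 * t.
Proof. by rewrite ler_wpM2r ?be_le. Qed.

Let ka_ge : 100 ^+ 6 <= ka.
Proof.
apply: (@le_trans _ _ (be * (100 ^+ 6 * W))); last by rewrite ler_wpM2l // ltW // be_gt0.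
have -> : be * (100 ^+ 6 * W) = 100 ^+ 6 * ((be * A4) * l ^+ 3) by ring.
by rewrite ler_peMr ?exprn_ge0 //; apply: mulr_ege1; rewrite ?be_A4 ?exprn_ege1.
Qed.

Let ka0 : 0 <= ka.
Proof. by apply: le_trans ka_ge; rewrite exprn_ge0. Qed.

Let eta_ge : 2 ^- h + expR (- ka) <= eta ^+ 2.
Proof.
have [_ h2] := hb.
have e1 : 2 ^- h <= expR (- ka) :> R.
  by apply: le_trans (half_le_exp h) _; rewrite ler_expR; move: ka_t t100; lra.
have e2 : eta ^+ 2 = expR (- ka) * expR (ka / 2).
  by rewrite /eta -expRM_natl -expRD; congr expR; field.
have e3 : 2 <= expR (ka / 2) by apply: le_trans (expR_ge1Dx _); move: ka_ge; lra.
rewrite e2; have := ler_wpM2l (expR_ge0 (- ka)) e3; lra.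
Qed.

Lemma bad_small m : (m0 <= m)%N -> (m <= n)%N ->
  mean (fun x : {ffun upper_index n -> bool} => (bad (@trail_index n' m) lam (2 * h) ka x)%:R)
   <= 3 * expR (- (M / 10)).
Proof.
move=> m0m mn; have [h1 h2] := hb.
have s0 : (0 < s)%N by [].
have pf (i : 'I_m) : (i %/ s < q)%N.
  rewrite ltn_divLR // mulnC; apply: leq_trans (_ : n < _)%N.
    by rewrite ltnS ltnW // (leq_trans (ltn_ord i)).
  by rewrite /s ltn_ceil // !muln_gt0.
pose col i := Ordinal (pf i).
have col_le j : (#|[set i | col i == j]| <= s)%N.
  have mods (i : 'I_m) : (i %% s < s)%N by rewrite ltn_mod.
  rewrite -[X in (_ <= X)%N]card_ord -(card_in_imset (f := fun i => Ordinal (mods i))) ?max_card //.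
  move=> i i'; rewrite !inE => /eqP ci /eqP ci' [e1]; apply: val_inj.
  have e2 : (i %/ s = i' %/ s)%N := congr1 val (etrans ci (esym ci')).
  by rewrite [LHS](divn_eq i s) e1 e2 -divn_eq.
have [a1 a2 a3] := arith_d t_ge W1 h1 db.
apply: le_trans (_ : 3 * expR (- (m%:R / 10)) <= _); last first.
  by rewrite ler_wpM2l // ler_expR lerN2 ler_wpM2r ?invr_ge0 // ler_nat.
have := @bad_prob R p p_pr p_gt2 _ _ _ lam (trail_index_inj mn) L q s (2 * h) d (3 * L) 22 8 r be ka
  col pLR L1 _ col_le g0_le pf_le be8 be_gt0 two_thirds_8 k_le.
rewrite card_ord; apply => //.
- by rewrite /r !mulr_ge0 // ltW.
- rewrite natrM /ka (_ : 2 * (be * t) / be = 2 * t) //; field; rewrite gt_eqF // gt_eqF // ?be_gt0.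
- rewrite (_ : _ + _ = 2 * h%:R + 480 * 100 ^+ 3 * W) //.
  by rewrite /q /r !natrM; ring.
- apply: le_trans a3; rewrite natrM lerD2l.
  have l2 : A4 * l ^+ 2 <= W.
    by rewrite ler_wpM2l ?(le_trans _ A4_ge1) // ler_weXn2l.
  apply: le_trans (_ : 80 * 100 ^+ 3 * (A4 * l ^+ 2) <= _); last by rewrite ler_wpM2l // mulr_ge0 // exprn_ge0.
  by rewrite /q /r !natrM le_eqVlt; apply/orP; left; apply/eqP; ring.
- exact: leq_trans d_le m0m.
- exact: leq_trans es_le m0m.
- exact: leq_trans kq_le m0m.
Qed.

Local Notation y := (ka / 8).

(* Half of the exponent pays for the number of steps, as [m0] is at most [t ^ 2]. *)
Let M_exp : M <= 128 / be ^+ 2 * expR y.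
Proof.
have b0 := be_gt0; have y0 : 0 <= y by rewrite divr_ge0.
have h1 : y ^+ 2 / 2 <= expR y.
  have := @expR_ge1Dxn R y 1 y0; rewrite -[2`!]/2%N; lra.
rewrite -ler_pdivrMl ?divr_gt0 ?exprn_gt0 //; apply: le_trans h1.
have -> : y ^+ 2 / 2 = (128 / be ^+ 2)^-1 * (t * t).
  by rewrite /ka; field; rewrite !gt_eqF.
rewrite ler_wpM2l ?invr_ge0 ?divr_ge0 ?exprn_ge0 ?(ltW b0) //.
have t0 : 0 < t by apply: lt_le_trans t100; rewrite exprn_gt0.
rewrite {1}tM ler_pM2r //; apply: le_trans t_ge.
have : l <= l ^+ 3 by rewrite -{1}[l]expr1 ler_weXn2l.
by have := l3; have := l0; move: (l ^+ 3) W l => X Y Z; lra.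
Qed.

Lemma final_bound (N : nat) : (m0 + N = n)%N ->
  N%:R * (2 * eta + 3 * expR (- (M / 10))) + (8 + 2 ^+ m0) * (3 / 5) ^+ N <=
  94 * (128 / be ^+ 2) * expR (- y).
Proof.
move=> Nn; have b0 := be_gt0.
have M1 : 1 <= M.
  have h100 : 1 <= 100 :> R by rewrite (ler_nat R 1).
  apply: le_trans big; apply: mulr_ege1; last exact: exprn_ege1.
  by apply: mulr_ege1; [exact: A4_ge1|exact: exprn_ege1].
have etaE : eta = expR (- y) * expR (- y).
  by rewrite /eta -expRD; congr expR; field.
have e1 : expR (- (M / 10)) <= eta.
  rewrite /eta ler_expR {1}tM.
  have t0 : 0 < t by apply: lt_le_trans t100; rewrite exprn_gt0.
  have : t <= l * t by rewrite ler_peMl ?(ltW t0).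
  rewrite -(mulrA (100 ^+ 2)); move: ka_t t0.
  by move: ka (l * t) t => k X z; lra.
have N17 : N%:R <= 17 * M by rewrite -natrM ler_nat; apply: leq_trans n_le; rewrite -Nn leq_addl.
have N15 : (15 * m0 <= N)%N by move: n_ge; rewrite -Nn mulSn leq_add2l.
have e2 : (8 + 2 ^+ m0) * (3 / 5) ^+ N <= 9 * eta.
  have a1 : 8 + 2 ^+ m0 <= 9 * 2 ^+ m0 :> R.
    have : 1 <= 2 ^+ m0 :> R by rewrite exprn_ege1 // (ler_nat R 1).
    lra.
  have a2 : (3 / 5) ^+ N <= (4^-1) ^+ m0 :> R.
    apply: (@le_trans _ _ ((3 / 5) ^+ (15 * m0))).
      by apply: ler_wiXn2l => //; lra.
    rewrite exprM lerXn2r ?nnegrE ?exprn_ge0 ?invr_ge0 //; lra.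
  have a0 : 0 <= (3 / 5) ^+ N :> R by apply: exprn_ge0; lra.
  apply: (@le_trans _ _ ((9 * 2 ^+ m0) * (4^-1) ^+ m0)).
    by apply: ler_pM => //; rewrite addr_ge0 // exprn_ge0.
  rewrite -mulrA -exprMn ler_wpM2l // (_ : 2 * 4^-1 = 2^-1); last by field.
  rewrite exprVn; apply: le_trans (half_le_exp m0) _; apply: le_trans e1.
  by rewrite ler_expR; lra.
apply: (@le_trans _ _ (94 * M * eta)).
  have E0 : 0 <= eta by exact: expR_ge0.
  have b1 : N%:R * (2 * eta + 3 * expR (- (M / 10))) <= (17 * M) * (5 * eta).
    by apply: ler_pM => //; [rewrite addr_ge0 ?mulr_ge0 ?expR_ge0|lra].
  have : eta <= M * eta by rewrite ler_peMl.
  move: b1 e2; rewrite (_ : 17 * M * (5 * eta) = 85 * (M * eta)); last by ring.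
  by rewrite -[94 * M * eta]mulrA; lra.
have key : M * expR (- y) <= 128 / be ^+ 2.
  by rewrite expRN ler_pdivrMr ?expR_gt0 //; exact: M_exp.
rewrite etaE; have -> : 94 * M * (expR (- y) * expR (- y)) = 94 * (M * expR (- y)) * expR (- y) by ring.
by rewrite ler_wpM2r ?expR_ge0 // ler_wpM2l.
Qed.

Lemma fixed_law k :
  `|mean (fun x : {ffun upper_index n -> bool} => (corank lam n x == k)%:R) - corank_main_term R p k|
  <= 94 * (128 / be ^+ 2) * expR (- y).
Proof.
have Nn : (m0 + (n - m0) = n)%N by rewrite subnKC // (leq_trans _ n_ge) // leq_pmull.
apply: le_trans (final_bound Nn).
have E1 : eta <= 1.
  by rewrite /eta expR_le1 oppr_le0 divr_ge0.
apply: (@corank_law R p n' lam p_pr p_gt2 m0 (2 * h) h ka eta) => //.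
- apply: leq_trans (leq_trunc_div m0 (100 * 100 * L)); rewrite mulnC leq_mul2l.
  by apply/orP; right; rewrite -mulnA (@leq_trans 100) // leq_pmulr // !muln_gt0.
- exact: expR_ge0.
- exact: bad_small.
Qed.

End Fixed.
End Numerics.

Local Open Scope classical_set_scope.

(** * From Rademacher matrices to uniform sign patterns *)

Section Link.
Variables (R : realType) (p n' : nat) (lam : 'F_p).
Local Notation F := 'F_p.
Local Notation n := n'.+1.
Local Notation Idx := (upper_index n).
Local Notation Om := {ffun Idx -> bool}.
Variables (d : measure_display) (T : measurableType d) (P : probability T R).
Variable M : T -> 'M[int]_n.
Hypothesis HM : symmetric_rademacher_matrix P M.

Definition fill (B : {ffun Idx -> F}) : 'M[F]_n :=
  \matrix_(i, j) B (upper_of n' i j) - lam%:M.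

Definition residues (w : T) : {ffun Idx -> F} := [ffun ij => (upper_entry M ij w)%:~R].

Lemma entry_upper w (i j : 'I_n) : M w i j = upper_entry M (upper_of n' i j) w.
Proof.
have [sM _ _] := HM; rewrite /upper_entry val_upper_of //=.
have [ij|ji] := leqP i j.
  by rewrite !inord_val.
rewrite !inord_val.
by rewrite -[in LHS](sM w) mxE.
Qed.

Lemma shifted_fill w : shifted_mod (M w) lam = fill (residues w).
Proof. by apply/matrixP => i j; rewrite !mxE !ffunE entry_upper. Qed.

Definition sign_event (x : Om) : set T :=
  \bigcap_(ij in [set: Idx]) (upper_entry M ij @^-1` [set (-1) ^+ x ij]).

Lemma measurable_entry ij (Y : set int) : measurable (upper_entry M ij @^-1` Y).
Proof.
have [_ rM _] := HM; have [mM _ _] := rM ij.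
by rewrite -[X in measurable X]setTI; apply: mM.
Qed.

Lemma measurable_sign_event x : measurable (sign_event x).
Proof. by apply: fin_bigcap_measurable => // ij _; exact: measurable_entry. Qed.

Lemma prob_sign_event x : P (sign_event x) = (2^-1 ^+ #|Idx|)%:E.
Proof.
have [_ rM iM] := HM.
have := iM [set: Idx]%SET (fun ij => [set (-1) ^+ x ij]).
have -> : [set` [set: Idx]%SET] = [set: Idx] by apply/seteqP; split => // ij _ /=; rewrite inE.
move=> ->; last by [].
rewrite (eq_bigr (fun=> (2^-1)%:E)) => [|ij _].
  by rewrite -(big_morph EFin (@EFinM R) erefl) prodr_const cardsT.
by have [_ h1 h2] := rM ij; case: (x ij); rewrite ?expr1 ?expr0.
Qed.

Lemma trivIset_sign_event (D : set Om) : trivIset D sign_event.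
Proof.
apply/trivIsetP => x y _ _ xy; apply/seteqP; split => // w [hx hy].
move/eqP: xy; apply; apply/ffunP => ij.
have : (-1 : int) ^+ x ij = (-1) ^+ y ij by rewrite -(hx ij I) -(hy ij I).
by case: (x ij); case: (y ij).
Qed.

Lemma prob_sign_union (Q : pred Om) :
  P (\bigcup_(x in [set` enum Q]) sign_event x) = (mean (fun x => (Q x)%:R : R))%:E.
Proof.
rewrite measure_fin_bigcup //; last first.
- by move=> x _; exact: measurable_sign_event.
- exact: trivIset_sign_event.
rewrite -fsbig_seq ?enum_uniq // (eq_bigr _ (fun x _ => prob_sign_event x)).
rewrite -(big_morph EFin (@EFinD R) erefl) big_enum /= /mean; congr EFin.
rewrite sumr_const -natr_sum -big_mkcond /= sum1_card card_ffun card_bool natrX exprVn.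
by rewrite -[LHS]mulr_natl.
Qed.

Lemma sign_event_fill x w : sign_event x w -> shifted_mod (M w) lam = trail lam n x.
Proof.
move=> xw; rewrite shifted_fill; apply/matrixP => i j; rewrite /fill /residues trailE.
rewrite subnn !add0n !mxE ffunE (xw (upper_of n' i j) I); congr (_ - _).
by rewrite /sg; case: (x _); rewrite ?expr1 ?expr0 ?mulrN1z.
Qed.

(** Almost surely the entries form one of the equally likely sign patterns, and
    the pattern determines the rank. *)
Lemma prob_rank (k : nat) : (k <= n)%N ->
  fine (P [set w | \rank (shifted_mod (M w) lam) = (n - k)%N]) =
  mean (fun x : Om => (corank lam n x == k)%:R).
Proof.
move=> kn; set A := [set w | _].
pose Q (x : Om) := corank lam n x == k.
have rQ x : Q x = (\rank (trail lam n x) == (n - k)%N).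
  have rn := rank_leq_row (trail lam n x); rewrite /Q /corank.
  by apply/eqP/eqP => h; [rewrite -h subKn|rewrite h subKn].
(* The event depends only on finitely many residues of measurable entries. *)
have mA : measurable A.
  have -> : A = \bigcup_(B in [set B : {ffun Idx -> F} | \rank (fill B) = (n - k)%N])
      \bigcap_(ij in [set: Idx]) (upper_entry M ij @^-1` [set z | z%:~R = B ij]).
    apply/seteqP; split => w.
      move=> hw; exists (residues w); first by rewrite /= -shifted_fill.
      by move=> ij _ /=; rewrite ffunE.
    move=> [B hB hw]; rewrite /A /= shifted_fill (_ : residues w = B) //.
    by apply/ffunP => ij; rewrite ffunE; exact: hw.
  apply: fin_bigcup_measurable => // B _; apply: fin_bigcap_measurable => // ij _.
  exact: measurable_entry.
have mU (S : pred Om) : measurable (\bigcup_(x in [set` enum S]) sign_event x).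
  by apply: fin_bigcup_measurable => // x _; exact: measurable_sign_event.
have le1 : (P (\bigcup_(x in [set` enum Q]) sign_event x) <= P A)%E.
  apply: le_measure; [exact: mem_set (mU Q)|exact: mem_set|].
  move=> w [x /=]; rewrite mem_enum => hx xw.
  have {}hx : Q x by exact: hx.
  move: hx; rewrite rQ => /eqP hx.
  by rewrite /A /= (sign_event_fill xw).
have le2 : (P (\bigcup_(x in [set` enum (predC Q)]) sign_event x) <= P (~` A))%E.
  have mA' : measurable (~` A) by apply: measurableC.
  apply: le_measure; [exact: mem_set (mU (predC Q))|exact: mem_set|].
  move=> w [x /=]; rewrite mem_enum => hx xw.
  have {}hx : ~~ Q x by exact: hx.
  move: hx; rewrite rQ => /eqP hx.
  by rewrite /A /= (sign_event_fill xw).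
move: le1 le2; rewrite probability_setC // !prob_sign_union.
have -> : mean (fun x => (predC Q x)%:R : R) = 1 - mean (fun x => (Q x)%:R).
  rewrite -[X in X - _](mean_const 1 (card_signs Idx)) -meanB; apply: eq_mean => x.
  by rewrite [predC Q x]/(~~ Q x); case: (Q x); rewrite /= ?subrr ?subr0.
have fA : P A \is a fin_num by exact: fin_num_measure.
rewrite -(fineK fA) -EFinB !lee_fin => h1 h2; apply/eqP; rewrite eq_le h1 andbT; lra.
Qed.

End Link.

(** * Conclusion *)

(** With [L] the number of binary digits of [p], the hypothesis on [p] becomes
    [L ^ 4 <= 256 * eta * n], and a small [eta] leaves room for all parameters. *)
Lemma uniform_law (R : realType) :
  exists eta : R, 0 < eta /\ exists C : R, 0 < C /\
  forall (n' p : nat) (lam : 'F_p) (k : nat), prime p -> (2 < p)%N ->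
    p%:R <= expR (eta * (n'.+1%:R `^ (4%:R)^-1)) ->
    `|mean (fun x : {ffun upper_index n'.+1 -> bool} => (corank lam n'.+1 x == k)%:R)
       - corank_main_term R p k| <= C * expR (- eta * n'.+1%:R / ln p%:R).
Proof.
pose be : R := 4^-1 ^+ 9; pose A4 : R := 4 ^+ 22.
have b0 : 0 < be := be_gt0 R; have b1 : be <= 8^-1 := be_le R.
have A1 : 1 <= A4 := A4_ge1 R; have A0 : 0 < A4 by lra.
have hun : 1 <= 100 :> R by rewrite (ler_nat R 1).
pose eta : R := be / (A4 * 100 ^+ 10).
have den : 0 < A4 * 100 ^+ 10 by rewrite mulr_gt0 // exprn_gt0.
have eta0 : 0 < eta by rewrite divr_gt0.
have eta_be : eta * 100 ^+ 4 <= be.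
  rewrite /eta mulrAC ler_pdivrMr //; apply: ler_wpM2l; first exact: ltW.
  apply: (@le_trans _ _ (1 * 100 ^+ 10)); first by rewrite mul1r ler_weXn2l.
  by rewrite ler_wpM2r // exprn_ge0.
have etaA : eta * (A4 * 100 ^+ 10) = be by rewrite /eta mulfVK // gt_eqF.
have eta_1 : eta * 100 ^+ 2 <= 8^-1.
  by apply: le_trans b1; apply: le_trans eta_be; rewrite (ler_pM2l eta0) ler_weXn2l.
exists eta; split=> //; exists (94 * (128 / be ^+ 2)); split.
  by rewrite mulr_gt0 // divr_gt0 // exprn_gt0.
move=> n' p lam k p_pr p_gt2 hp; set n := n'.+1.
pose lp : R := ln p%:R.
have pp : 0 < p%:R :> R by rewrite ltr0n prime_gt0.
have elp : expR lp = p%:R by rewrite lnK // posrE.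
have lp_half : 1 / 2 <= lp.
  rewrite -ler_expR elp; apply: (@le_trans _ _ 2); last by rewrite (ler_nat R 2) ltnW.
  have := half_le_exp R 1; rewrite expr1 expRN lef_pV2 ?posrE ?expR_gt0 //.
have lp0 : 0 < lp by lra.
pose L := (trunc_log 2 p).+1.
have /andP [pL1 pL2] := @trunc_log_bounds 2 p isT (prime_gt0 p_pr).
pose l : R := L%:R.
have l_lp : l <= 4 * lp.
  have h1 : (trunc_log 2 p)%:R / 2 <= lp.
    rewrite -ler_expR elp; apply: (@le_trans _ _ (2 ^+ trunc_log 2 p)).
      have := half_le_exp R (trunc_log 2 p).
      by rewrite expRN lef_pV2 ?posrE ?expR_gt0 ?exprn_gt0.
    by rewrite -natrX ler_nat.
  have lE : l = (trunc_log 2 p)%:R + 1 by rewrite natr1.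
  by rewrite lE; lra.
have l1 : 1 <= l by rewrite (ler_nat R 1).
pose n4 : R := n%:R `^ 4^-1.
have n40 : 0 <= n4 by exact: powR_ge0.
have n4E : n4 ^+ 4 = n%:R.
  by rewrite -powR_mulrn // -powRrM mulVf ?pnatr_eq0 // powRr1.
have lp_n4 : lp <= eta * n4 by rewrite -ler_expR elp.
have l4 : l ^+ 4 <= 256 * eta * n%:R.
  have h1 : l ^+ 4 <= (4 * (eta * n4)) ^+ 4.
    have l_0 : 0 <= l by exact: ler0n.
    have h0 : l <= 4 * (eta * n4) by lra.
    by apply: lerXn2r; rewrite ?nnegrE // (le_trans l_0).
  apply: le_trans h1 _.
  have e4 : eta ^+ 4 <= eta.
    rewrite exprS ler_piMr ?(ltW eta0) // exprn_ile1 ?(ltW eta0) //; lra.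
  have := ler_wpM2r (ler0n R n) e4.
  have -> : 256 * eta * n%:R = 256 * (eta * n%:R) by ring.
  have -> : (4 * (eta * n4)) ^+ 4 = 256 * (eta ^+ 4 * n%:R) by rewrite -n4E; ring.
  by move: (eta ^+ 4 * n%:R) (eta * n%:R) => u v; lra.
have n_big : 256 <= n%:R :> R.
  have : 1 <= l ^+ 4 by rewrite exprn_ege1.
  have : eta * n%:R * 100 ^+ 2 <= 8^-1 * n%:R by rewrite mulrAC ler_wpM2r.
  move: l4; rewrite -(mulrA 256); move: (eta * n%:R) (l ^+ 4) (n%:R : R) => u v w; lra.
pose m0 := (n %/ 16)%N.
have n256 : (256 <= n)%N by rewrite -(ler_nat R).
have n_ge : (16 * m0 <= n)%N by rewrite mulnC leq_trunc_div.
have n_le : (n <= 17 * m0)%N.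
  rewrite [X in (X <= _)%N](divn_eq n 16) -/m0 (mulSn 16) addnC leq_add //; last by rewrite mulnC.
  apply: (@leq_trans 15); first by rewrite -ltnS ltn_pmod.
  by rewrite leq_divRL // (leq_trans _ n256).
have nM : n%:R <= 17 * m0%:R :> R by rewrite -natrM ler_nat.
have M0 : 0 <= m0%:R :> R by exact: ler0n.
have big : A4 * 100 ^+ 8 * L%:R ^+ 4 <= m0%:R.
  have h1 : A4 * 100 ^+ 8 * l ^+ 4 <= A4 * 100 ^+ 8 * (256 * eta * n%:R).
    by rewrite ler_wpM2l // mulr_ge0 ?exprn_ge0 ?(ltW A0).
  apply: le_trans h1 _.
  have -> : A4 * 100 ^+ 8 * (256 * eta * n%:R) = 256 / 100 ^+ 2 * (eta * (A4 * 100 ^+ 10)) * n%:R.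
    by field.
  rewrite etaA; have : be * n%:R <= 8^-1 * (17 * m0%:R).
    by apply: ler_pM => //; exact: ltW.
  by rewrite -mulrA; move: (be * n%:R) (m0%:R : R) M0 => u v; lra.
apply: le_trans (fixed_law lam p_pr p_gt2 (ltnW pL2) (ltn0Sn _) n_ge n_le big k) _.
rewrite -/be ler_wpM2l //; first by rewrite mulr_ge0 // divr_ge0 // exprn_ge0 // ltW.
rewrite ler_expR mulNr mulNr lerN2 -/lp -/l ler_pdivrMr //.
have l0 : 0 < l by lra.
have h : 4^-1 <= lp / l by rewrite ler_pdivlMr //; lra.
have -> : be * (m0%:R / (100 ^+ 2 * l)) / 8 * lp = be * m0%:R / (8 * 100 ^+ 2) * (lp / l).
  by field; rewrite gt_eqF.
apply: (@le_trans _ _ (be * m0%:R / (8 * 100 ^+ 2) * 4^-1)); last first.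
  by rewrite ler_wpM2l // divr_ge0 // mulr_ge0 // ltW.
have h1 : eta * n%:R <= eta * (17 * m0%:R) by rewrite ler_wpM2l // ltW.
apply: le_trans h1 _.
have h2 : eta * 100 ^+ 4 * m0%:R <= be * m0%:R by rewrite ler_wpM2r.
have e1 : eta * 100 ^+ 4 * m0%:R = 100 ^+ 4 * (eta * m0%:R) by ring.
have h3 : 0 <= eta * m0%:R by rewrite mulr_ge0 // ltW.
rewrite mulrCA; move: h2; rewrite e1.
by move: (eta * m0%:R) (be * m0%:R) h3 => u v; lra.
Qed.

Theorem theorem1p2 (R : realType) :
  exists eta : R, 0 < eta /\ exists C : R, 0 < C /\
    forall (n p : nat) (lambda : 'F_p) (k : nat)
           (d : measure_display) (T : measurableType d) (P : probability T R)
           (M : T -> 'M[int]_n),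
      (0 < n)%N -> prime p -> (2 < p)%N ->
      p%:R <= expR (eta * (n%:R `^ (4%:R)^-1)) ->
      (k <= n)%N ->
      symmetric_rademacher_matrix P M ->
      `| fine (P [set w | \rank (shifted_mod (M w) lambda) = (n - k)%N])
         - corank_main_term R p k |
        <= C * expR (- eta * n%:R / ln p%:R).
Proof.
have [eta [eta0 [C [C0 H]]]] := uniform_law R.
exists eta; split=> //; exists C; split=> //.
move=> [//|n'] p lam k d T P M _ p_pr p_gt2 hp kn HM.
by rewrite (prob_rank lam HM kn); exact: H.
Qed.
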